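(* Let $\delta > 0$ and $\epsilon > 0$. There exists a constant $C_0 = C_0(\delta, \epsilon) > 0$, depending only on $\delta,\epsilon$, such that the following statements hold for all $\mathbf{v} \in S_\delta \cap \mathbb{Z}_{>0}^2$, $p \ge 1$, $w > 0$ and $z < 1$. (a) If $\epsilon \le w \le \zeta_{\mathbf{v}}-\epsilon \min \{p^{1/3}\|\mathbf{v}\|^{-1/3}, 1\}$ then $$\mathbf{E}[|G^{w, \mathrm{hor}}_{\mathbf{v}}-M^{w}_{\mathbf{v}}|^p] \le C_0^p p^{p/2} \max \{p, (\zeta_{\mathbf{v}}-w)\|\mathbf{v}\|\}^{p/2}.$$ (b) If $\zeta_{\mathbf{v}}+\epsilon \min \{p^{1/3}\|\mathbf{v}\|^{-1/3}, 1\} \le z \le 1-\epsilon$ then $$\mathbf{E}[|G^{z, \mathrm{ver}}_{\mathbf{v}}-M^{z}_{\mathbf{v}}|^p] \le C_0^p p^{p/2} \max \{p, (z-\zeta_{\mathbf{v}})\|\mathbf{v}\|\}^{p/2}.$$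
   Context: $\mathrm{Exp}(\lambda)$ is the exponential distribution with rate $\lambda$. For $w>0$ and $z<1$, let $\{\omega^{w,z}_{\mathbf{v}}:\mathbf{v}\in\mathbb{Z}_{\ge0}^2\}$ be independent weights with $\omega^{w,z}_{\mathbf{v}}\sim\mathrm{Exp}(1)$ for $\mathbf{v}\in\mathbb{Z}_{>0}^2$, $\omega^{w,z}_{(i,0)}\sim\mathrm{Exp}(w)$ for $i\in\mathbb{Z}_{>0}$, $\omega^{w,z}_{(0,j)}\sim\mathrm{Exp}(1-z)$ for $j\in\mathbb{Z}_{>0}$, and $\omega^{w,z}_{(0,0)}=0$. $\Pi_{\mathbf{u},\mathbf{v}}$ is the set of up-right lattice paths from $\mathbf{u}$ to $\mathbf{v}$ with steps $(1,0)$ and $(0,1)$, viewed as vertex sets including both endpoints. Put $G^{w,\mathrm{hor}}_{\mathbf{v}}=\max_{\pi\in\Pi_{(1,0),\mathbf{v}}}\sum_{\mathbf{p}\in\pi}\omega^{w,z}_{\mathbf{p}}$ (which does not depend on $z$) and $G^{z,\mathrm{ver}}_{\mathbf{v}}=\max_{\pi\in\Pi_{(0,1),\mathbf{v}}}\sum_{\mathbf{p}\in\pi}\omega^{w,z}_{\mathbf{p}}$ (which does not depend on $w$), for $\mathbf{v}\in\mathbb{Z}_{>0}^2$. For $\mathbf{x}=(x,y)\in\mathbb{R}_{>0}^2$, $\zeta_{\mathbf{x}}=\frac{\sqrt{x}}{\sqrt{x}+\sqrt{y}}$, and $M^t_{\mathbf{x}}=\frac{x}{t}+\frac{y}{1-t}$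 for $t\in(0,1)$. $\|\cdot\|$ is the $L^1$ norm. $S_\delta = \{(x,y)\in\mathbb{R}_{>0}^2: x\ge \delta y,\ y\ge\delta x\}$. *)

(* Defs.v *)
From HB Require Import structures.
From mathcomp Require Import all_boot all_order all_algebra.
From mathcomp Require Import finmap.
From mathcomp Require Import all_classical all_reals all_analysis.

Set Implicit Arguments.
Unset Strict Implicit.
Unset Printing Implicit Defensive.

Import Order.TTheory GRing.Theory Num.Theory.

Local Open Scope classical_set_scope.
Local Open Scope ring_scope.

Section probability_notions.
Context {R : realType} {d : measure_display} {T : measurableType d}.
Variable P : probability T R.

(* The law is only compared on Borel sets: [exponential_prob] is an integral,
   meaningless on non-measurable sets. *)
Definition exponential_rv (X : {RV P >-> R}) (rate : R) : Prop :=
  forall A : set R, measurable A ->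
    distribution P X A = exponential_prob rate A.

Definition independent_rvs (I : choiceType) (X : I -> {RV P >-> R}) : Prop :=
  forall (J : {fset I}) (A : I -> set R),
    (forall i, i \in J -> measurable (A i)) ->
    P (\bigcap_(i in [set` J]) (X i @^-1` A i)) =
    (\prod_(i <- J) P (X i @^-1` A i))%E.

Definition lpp_weights (w z : R) (omega : nat * nat -> {RV P >-> R}) : Prop :=
  [/\ independent_rvs omega,
      forall i j : nat, (0 < i)%N -> (0 < j)%N ->
        exponential_rv (omega (i, j)) 1,
      forall i : nat, (0 < i)%N -> exponential_rv (omega (i, 0%N)) w,
      forall j : nat, (0 < j)%N -> exponential_rv (omega (0%N, j)) (1 - z) &
      forall t : T, omega (0%N, 0%N) t = 0].

End probability_notions.

Section last_passage.

Definition up_right_step : rel (nat * nat) :=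
  fun u v => (v == (u.1.+1, u.2)) || (v == (u.1, u.2.+1)).

Definition up_right_paths (u v : nat * nat) : set {fset nat * nat} :=
  [set [fset x in u :: s]%fset | s in
    [set s : seq (nat * nat) | path up_right_step u s /\ last u s = v]].

Context {R : realType}.

Definition passage_time (omega : nat * nat -> R) (pi : {fset nat * nat}) : R :=
  \sum_(x <- pi) omega x.

(* [up_right_paths u v] is finite, and nonempty when [u] is coordinatewise below
   [v]; the supremum is then a maximum, see [last_passage_max]. *)
Definition last_passage (omega : nat * nat -> R) (u v : nat * nat) : R :=
  sup [set passage_time omega pi | pi in up_right_paths u v].

End last_passage.

Section boundary_last_passage.
Context {R : realType} {d : measure_display} {T : measurableType d}.
Variables (P : probability T R) (omega : nat * nat -> {RV P >-> R}).

Definition G_hor (v : nat * nat) (t : T) : R :=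
  last_passage (fun x => omega x t) (1%N, 0%N) v.

Definition G_ver (v : nat * nat) (t : T) : R :=
  last_passage (fun x => omega x t) (0%N, 1%N) v.

End boundary_last_passage.

Section planar_functions.
Context {R : realType}.
Implicit Type x : R * R.

Definition vec (v : nat * nat) : R * R := (v.1%:R, v.2%:R).

(* Not [`|x|], which is the sup norm on [R * R]. *)
Definition normL1 x : R := `|x.1| + `|x.2|.

Definition zeta x : R := Num.sqrt x.1 / (Num.sqrt x.1 + Num.sqrt x.2).

Definition meanM (t : R) x : R := x.1 / t + x.2 / (1 - t).

Definition cone (delta : R) : set (R * R) :=
  [set x | [/\ 0 < x.1, 0 < x.2, delta * x.2 <= x.1 & delta * x.1 <= x.2]].

End planar_functions.

Section last_passage_facts.

Lemma up_right_paths_finite (u v : nat * nat) : finite_set (up_right_paths u v).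
Proof.
have below s x : path up_right_step u s -> x \in u :: s ->
    (x.1 <= (last u s).1)%N && (x.2 <= (last u s).2)%N.
  elim: s u x {v} => [|y s IHs] u x /=.
    by rewrite inE => _ /eqP ->; rewrite !leqnn.
  case/andP => uy ys; rewrite inE => /orP[/eqP -> {x}|]; last exact: IHs ys.
  have /andP[y1 y2] := IHs y y ys (mem_head y s).
  by case/orP: uy y1 y2 => /eqP -> /= y1 y2; rewrite ?y1 ?y2 ?(ltnW y1) ?(ltnW y2).
pose r : {fset nat * nat} :=
  [fset x in [seq (i, j) | i <- iota 0 v.1.+1, j <- iota 0 v.2.+1]]%fset.
apply: (@sub_finite_set _ _ [set` fpowerset r]); last exact: finite_fset.
move=> pi [s [us vE] <-] /=; rewrite fpowersetE; apply/fsubsetP => x.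
rewrite !in_fset => xs; have {xs} := below s x us xs; rewrite vE.
move=> /andP[x1 x2]; apply/allpairsP; exists x.
by rewrite !mem_iota !add0n !ltnS; split=> //; case: x {x1 x2}.
Qed.

Lemma up_right_paths_nonempty (u v : nat * nat) :
  (u.1 <= v.1)%N -> (u.2 <= v.2)%N -> up_right_paths u v !=set0.
Proof.
case: u v => [a b] [a' b'] /= /subnKC {1}<- /subnKC {1}<-.
move: (a' - a)%N (b' - b)%N => m n {a' b'}.
suff [s us] : exists s, path up_right_step (a, b) s /\
    last (a, b) s = ((a + m)%N, (b + n)%N).
  by exists [fset x in (a, b) :: s]%fset, s.
elim: m a => [|m IHm] a.
  elim: n b => [|n IHn] b; first by exists [::]; rewrite !addn0.
  have [s [ps ls]] := IHn b.+1.
  exists ((a, b.+1) :: s); split; last by rewrite /= ls addSnnS.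
  by rewrite /= ps andbT /up_right_step eqxx orbT.
have [s [ps ls]] := IHm a.+1.
exists ((a.+1, b) :: s); split; last by rewrite /= ls addSnnS.
by rewrite /= ps andbT /up_right_step eqxx.
Qed.

Lemma last_passage_max (R : realType) (omega : nat * nat -> R) (u v : nat * nat) :
  (u.1 <= v.1)%N -> (u.2 <= v.2)%N ->
  (exists2 pi, up_right_paths u v pi &
     last_passage omega u v = passage_time omega pi) /\
  (forall pi, up_right_paths u v pi ->
     passage_time omega pi <= last_passage omega u v).
Proof.
move=> uv1 uv2; rewrite /last_passage; set E := image _ _.
have finE : finite_set E by apply/finite_image/up_right_paths_finite.
have [pi0 hpi0] := up_right_paths_nonempty uv1 uv2.
have E0 : E !=set0 by exists (passage_time omega pi0), pi0.
have [F EF] := finite_fsetP.1 finE.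
have [y Ey ymax] : exists2 y, E y & ubound E y.
  have [x0 x0F] : exists x0, x0 \in F by case: E0 => x; rewrite EF; exists x.
  pose i0 : F := [` x0F]%fset.
  have [/= i _ imax] := @Order.TotalTheory.arg_maxP _ _ _ i0 xpredT (@fsval _ F) isT.
  exists (val i); first by rewrite EF /=; exact: valP.
  by move=> x; rewrite EF /= => xF; exact: (imax [` xF]%fset).
have supE : sup E = y.
  apply/eqP; rewrite eq_le ge_sup //=.
  by apply: ub_le_sup => //; exists y.
split.
  by case: Ey => pi hpi piy; exists pi => //; rewrite supE -piy.
by move=> pi hpi; rewrite supE; apply: ymax; exists pi.
Qed.

End last_passage_facts.

(* Main.v *)
Require Import Defs.
From HB Require Import structures.
From mathcomp Require Import all_boot all_order all_algebra.
From mathcomp Require Import finmap.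
From mathcomp Require Import all_classical all_reals all_analysis.
From mathcomp Require Import measurable_realfun.
From mathcomp Require Import ring lra.

Set Implicit Arguments.
Unset Strict Implicit.
Unset Printing Implicit Defensive.

Import Order.TTheory GRing.Theory Num.Theory.

Local Open Scope classical_set_scope.
Local Open Scope ring_scope.

(** Let [c] be the critical parameter of the endpoint [v = (m, n)], let
    [mu w = m / w + n / (1 - w)], and let [h = c - w > 0] be the distance of the
    boundary rate [w] from [c].  Part (b) is part (a) reflected in the diagonal,
    so only [hor w], the passage time that starts along the horizontal axis, is
    studied; it has to be shown that its [p]-th moments around [mu w] are at most
    those of a variable with deviations of order [sqrt (p * h * m)].

    Rescaling the boundary weights puts all boundary rates on one probability
    space.  The source of every bound is one exact formula, [hor_ver_mgf]: for
    [w] and [z] in the unit interval,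
      [E exp ((w - z) * max (hor w) (ver z))
         = (w / z) ^ m * ((1 - z) / (1 - w)) ^ n].
    For [w = z] the model is stationary, by the Burke property: the increments
    of the passage time along each horizontal line are independent exponential
    variables.  Hence tilting the vertical boundary changes its rate from [1 - z]
    to [1 - w], a sweep through the rows transports the law of the horizontal
    boundary to the line of height [n], and tilting the increments there, which
    add up to the passage time less the vertical boundary, changes their rate
    from [w] to [z].  The two tilting densities multiply to the exponential on
    the left, and the total mass of the tilted measure is the right-hand side.
    The logarithm of the right-hand side is the integral of [mu] from [z] to [w],
    which the trapezoidal and the midpoint rules compare with
    [(w - z) * mu w].

    Upper deviations follow by Chernoff's method, as [hor w] is at most the
    maximum ([hor_upper_moment]).

    For lower deviations the formula controls [hor w] only when [hor w] is the
    larger of [hor w] and [ver z].  With [z] slightly above [w], the opposite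
    event has a probability that is exponentially small in [sqrt (p * h ^ 3 * m)],
    again by the formula ([hor_lower_split]), and on that event any bound for the
    moment of order [2 * p] that loses only a constant factor is good enough
    ([mean_le_split_event]).  Such a bound comes from the same statement at the
    doubled distance [2 * h]: the increments of [hor w] in the vertical direction
    are monotone in [w] ([hor_compare]), so lowering the endpoint to a height
    [n'] whose critical parameter is larger by [h], and replacing [w] by
    [c - 2 * h], expresses the deviation at distance [h] through deviations at
    distances at least [2 * h] and a deterministic error of order [h ^ 2 * m]
    ([hor_lower_compare]).  The resulting induction on the scale of [h]
    ([hor_lower_step], [hor_lower_main]) starts from distances of order one,
    where [hor w >= 0] suffices on the exceptional event, and works while [h ^ 3 * m] is at least a large
    constant times [p].

    The assumption on [w] says that [h ^ 3 * normL1 v] is at least a multiple of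
    [p] when [p <= normL1 v].  If it is below the large constant, one more
    comparison, with a distance that the induction reaches, bridges the gap
    ([hor_lower_gap]).  When [p] is of the order of [normL1 v] or larger,
    the trivial bound [hor w >= 0] and the exponential moment with a fixed
    parameter are enough. *)

(** * Measures with a density *)

Section density.
Context d (T : measurableType d) (R : realType).
Variables (mu : {measure set T -> \bar R}) (g : T -> R).
Hypotheses (mg : measurable_fun setT g) (g_ge0 : forall x, 0 <= g x).

Definition weighted (A : set T) : \bar R := (\int[mu]_(x in A) (g x)%:E)%E.

Let weighted0 : weighted set0 = 0%E.
Proof. by rewrite /weighted integral_set0. Qed.

Let weighted_ge0 A : (0 <= weighted A)%E.
Proof. by apply: integral_ge0 => x _; rewrite lee_fin. Qed.

Let weighted_sigma_additive : semi_sigma_additive weighted.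
Proof.
move=> /= F mF tF mUF; rewrite /weighted; apply: cvg_toP.
  apply: ereal_nondecreasing_is_cvgn => m n mn.
  by apply: lee_sum_nneg_natr => // k _ _; apply: integral_ge0 => x _; rewrite lee_fin.
rewrite ge0_integral_bigcup//=.
- by apply/measurable_EFinP/measurable_funTS.
- by move=> x _; rewrite lee_fin.
Qed.

HB.instance Definition _ := isMeasure.Build _ _ _ weighted
  weighted0 weighted_ge0 weighted_sigma_additive.

Definition weighted_measure : {measure set T -> \bar R} := weighted.

Import HBNNSimple.

(** The identity holds for simple functions by definition of the density,
    and passes to the limit by monotone convergence. *)
Lemma integral_weighted (f : T -> R) : measurable_fun setT f ->
  (forall x, 0 <= f x) ->
  (\int[weighted_measure]_x (f x)%:E = \int[mu]_x (f x * g x)%:E)%E.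
Proof.
move=> mf f0; have mEf : measurable_fun setT (EFin \o f) by apply/measurable_EFinP.
pose f_ := nnsfun_approx measurableT mEf.
have cf x : (EFin \o (fun n => f_ n x)) n @[n --> \oo] --> (f x)%:E.
  by apply: cvg_nnsfun_approx => // y _; rewrite lee_fin.
have fE x : (f x)%:E = limn (fun n => (f_ n x)%:E) by apply/esym/cvg_lim => //; exact: cf.
have fgE x : (f x * g x)%:E = limn (fun n => (f_ n x * g x)%:E).
  apply/esym/cvg_lim => //; under eq_fun do rewrite EFinM.
  by rewrite EFinM; apply: cvgeZr => //; exact: cf.
under eq_integral do rewrite fE.
rewrite monotone_convergence//; last 3 first.
- by move=> n; exact/measurable_EFinP/measurable_funP.
- by move=> n x _; rewrite lee_fin.
- by move=> x _ m n mn; rewrite lee_fin; exact/lefP/nd_nnsfun_approx.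
under [RHS]eq_integral do rewrite fgE.
rewrite monotone_convergence//; last 3 first.
- by move=> n; apply/measurable_EFinP/measurable_funM.
- by move=> n x _; rewrite lee_fin mulr_ge0.
- move=> x _ m n mn; rewrite lee_fin ler_wpM2r//.
  exact/lefP/nd_nnsfun_approx.
congr (limn _); apply/funext => n.
under eq_integral do rewrite fimfunE -fsumEFin//.
rewrite ge0_integral_fsum//; last 2 first.
- by move=> y; exact/measurable_EFinP/measurable_funM.
- by move=> y x _; rewrite nnfun_muleindic_ge0.
transitivity (\sum_(k \in range (f_ n))
    \int[mu]_x (k * \1_(f_ n @^-1` [set k]) x * g x)%:E)%E.
  apply: eq_fsbigr => r _.
  have [r0|r0] := ltP r 0.
    rewrite preimage_nnfun0//.
    by rewrite !integral0_eq// => x _; rewrite indic0 mulr0 ?mul0r.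
  under eq_integral do rewrite EFinM.
  rewrite ge0_integralZl//; last by apply/measurable_EFinP.
  rewrite integral_indic//= setIT.
  under [RHS]eq_integral do rewrite -mulrA EFinM.
  rewrite ge0_integralZl//; last 2 first.
  - by apply/measurable_EFinP/measurable_funM.
  - by move=> x _; rewrite lee_fin mulr_ge0.
  congr (_ * _)%E; rewrite /weighted integral_mkcond/=.
  apply: eq_integral => x _; rewrite patchE indicE.
  by case: ifPn => _; rewrite ?mul1r ?mul0r.
rewrite -ge0_integral_fsum//.
- apply: eq_integral => x _; rewrite fsumEFin//; congr _%:E.
  by rewrite [in RHS]fimfunE !fsbig_finite//= mulr_suml.
- by move=> r; apply/measurable_EFinP/measurable_funM => //; exact: measurable_funM.
- move=> r x _; rewrite lee_fin mulr_ge0//.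
  by have := nnfun_muleindic_ge0 (f_ n) r x; rewrite lee_fin.
Qed.

End density.

(** * Product laws under a finite measure *)

Definition push d d' (T1 : measurableType d) (T2 : measurableType d') (R : realType)
    (m : {measure set T1 -> \bar R}) (f : T1 -> T2) (mf : measurable_fun [set: T1] f) :
  {measure set T2 -> \bar R} :=
  measure_function_pushforward__canonical__measure_function_Measure m mf.

Section joint_law.
Context d (T : measurableType d) (R : realType) (I : choiceType).
Implicit Types (mu : {measure set T -> \bar R}) (X : I -> T -> R)
  (nu : I -> probability R R).

(** Independence of the [X i] with laws [nu i], for a finite measure [mu] of
    total mass [c]: exponential tilting leaves the class of probability measures,
    and the mass that it creates is the exponential moment to be computed. *)
Definition joint_law mu X nu (c : R) :=
  forall (J : {fset I}) (A : I -> set R), (forall i, measurable (A i)) ->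
    mu (\bigcap_(i in [set` J]) (X i @^-1` A i)) =
    (c%:E * \prod_(i <- J) nu i (A i))%E.

Definition update S (f : I -> S) (k : I) (y : S) : I -> S :=
  fun i => if i == k then y else f i.

Lemma updateE S (f : I -> S) k y : update f k y k = y.
Proof. by rewrite /update eqxx. Qed.

Lemma updateN S (f : I -> S) k y i : i != k -> update f k y i = f i.
Proof. by rewrite /update => /negbTE ->. Qed.

(** An index [k] may be assumed to occur in the test family, because [A k]
    may be the whole space. *)
Lemma joint_law_focus mu X nu c (k : I) :
  (forall (J : {fset I}) (A : I -> set R), (forall i, measurable (A i)) ->
    k \notin J ->
    mu (X k @^-1` A k `&` \bigcap_(i in [set` J]) (X i @^-1` A i)) =
    (c%:E * (nu k (A k) * \prod_(i <- J) nu i (A i)))%E) ->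
  joint_law mu X nu c.
Proof.
move=> H J A mA.
have [kJ|kJ] := boolP (k \in J).
  rewrite (bigcap_fsetD1 _ kJ) H//; last by rewrite !inE eqxx.
  by rewrite [in RHS](big_fsetD1 k).
have mU i : measurable (update A k setT i) by rewrite /update; case: ifP.
have := H J (update A k setT) mU kJ.
rewrite updateE preimage_setT setTI probability_setT mul1e => H'.
have E i : i \in J -> update A k setT i = A i.
  by move=> iJ; rewrite updateN//; apply: contraNneq kJ => <-.
rewrite (eq_bigcapr (G := fun i => X i @^-1` update A k setT i)); last first.
  by move=> i /= iJ; rewrite E.
rewrite H'; by congr (_ * _)%E; apply: eq_big_seq => i iJ; rewrite E.
Qed.

Lemma joint_law_unfocus mu X nu c (k : I) (J : {fset I}) (A : I -> set R) :
  joint_law mu X nu c -> (forall i, measurable (A i)) -> k \notin J ->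
  mu (X k @^-1` A k `&` \bigcap_(i in [set` J]) (X i @^-1` A i)) =
  (c%:E * (nu k (A k) * \prod_(i <- J) nu i (A i)))%E.
Proof.
move=> H mA kJ; have := H (k |` J)%fset A mA.
by rewrite bigcap_fsetU1 (big_fsetU1 _ _ kJ).
Qed.

Lemma joint_law_mass mu X nu c : joint_law mu X nu c -> mu setT = c%:E.
Proof.
move=> /(_ fset0 (fun=> setT) (fun=> measurableT)).
rewrite big_seq_fset0 mule1 => <-; congr (mu _).
by apply/seteqP; split => // x _ i /=.
Qed.

Lemma joint_law_ge0 mu X nu c : joint_law mu X nu c -> 0 <= c.
Proof. by move=> /joint_law_mass cE; rewrite -lee_fin -cE. Qed.

Lemma prod_prob_ge0 nu (s : seq I) (A : I -> set R) :
  0 <= \prod_(i <- s) fine (nu i (A i)).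
Proof. by apply: prodr_ge0 => i _; exact/fine_ge0/measure_ge0. Qed.

Lemma prod_probE nu (s : seq I) (A : I -> set R) : (forall i, measurable (A i)) ->
  (\prod_(i <- s) nu i (A i))%E = (\prod_(i <- s) fine (nu i (A i)))%:E.
Proof.
move=> mA; elim/big_rec2: _ => // i x y _ ->.
by rewrite EFinM fineK//; exact: fin_num_measure.
Qed.

Lemma measurable_bigcap_preimage X (J : {fset I}) (A : I -> set R) :
  (forall i, measurable_fun setT (X i)) -> (forall i, measurable (A i)) ->
  measurable (\bigcap_(i in [set` J]) (X i @^-1` A i)).
Proof.
move=> mX mA; rewrite bigcap_fset; apply: bigsetI_measurable => i _.
by rewrite -[X in measurable X]setTI; exact: mX.
Qed.

(** A density that depends on [X k] alone acts on the factor [nu k] alone: [b]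
    is the mass of the tilted factor and [nu'] its normalization. *)
Lemma joint_law_tilt mu X nu c (k : I) (g : R -> R) (mg : measurable_fun setT g)
    (g0 : forall x, 0 <= g x) (nu' : probability R R) (b : R) :
  (forall i, measurable_fun setT (X i)) ->
  (forall A, measurable A ->
    \int[nu k]_(x in A) (g x)%:E = b%:E * nu' A)%E ->
  forall (mgX : measurable_fun setT (g \o X k)) (gX0 : forall t, 0 <= (g \o X k) t),
  joint_law mu X nu c ->
  joint_law (weighted_measure mu mgX gX0) X (update nu k nu') (c * b).
Proof.
move=> mX gb mgX gX0 H; apply: (joint_law_focus (k := k)) => J A mA kJ.
rewrite updateE.
set E := \bigcap_(i in _) _.
have mE : measurable E by exact: measurable_bigcap_preimage.
have mXA B : measurable B -> measurable (X k @^-1` B).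
  by move=> mB; rewrite -[X in measurable X]setTI; exact: mX.
have mI : measurable_fun setT (\1_E : T -> R) by exact: measurable_indic.
have I0 x : 0 <= (\1_E : T -> R) x by [].
set p := \prod_(i <- J) fine (nu i (A i)).
have p0 : 0 <= p by exact: prod_prob_ge0.
have cp0 : 0 <= c * p by rewrite mulr_ge0// (joint_law_ge0 H).
pose f := fun x : R => g x * \1_(A k) x.
have mf : measurable_fun setT f by apply: measurable_funM => //; exact: measurable_indic.
have f0 x : 0 <= f x by rewrite mulr_ge0.
transitivity (\int[weighted_measure mu mI I0]_t (f (X k t))%:E)%E.
  rewrite integral_weighted//; last exact: measurableT_comp.
  rewrite /= /weighted integral_mkcond; apply: eq_integral => t _.
  rewrite patchE /f -mulrA.
  have -> : \1_(A k) (X k t) * \1_E t = (t \in X k @^-1` A k `&` E)%:R :> R.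
    by rewrite !indicE in_setI -natrM mulnb.
  by case: ifPn => _; rewrite ?mulr1 ?mulr0.
transitivity (\int[push (weighted_measure mu mI I0) (mX k)]_x (f x)%:E)%E.
  rewrite /push/= ge0_integral_pushforward//; first exact/measurable_EFinP.
  by move=> x _; rewrite lee_fin.
transitivity (\int[mscale (NngNum cp0) (nu k)]_x (f x)%:E)%E.
  apply: eq_measure_integral => B mB _.
  rewrite /push/= /pushforward /weighted integral_indic//; last exact: mXA.
  rewrite [X in mu X](_ : _ = X k @^-1` B `&` E); last by rewrite setIC.
  have := @joint_law_unfocus _ _ _ _ k J (update A k B) H _ kJ.
  rewrite updateE (eq_bigcapr (G := fun i => X i @^-1` A i)); last first.
    by move=> i /= iJ; rewrite updateN//; apply: contraNneq kJ => <-.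
  move=> ->; last by move=> i; rewrite /update; case: ifP.
  rewrite /mscale/= EFinM -muleA; congr (_ * _)%E; rewrite muleC; congr (_ * _)%E.
  rewrite /p -prod_probE//; apply: eq_big_seq => i iJ; rewrite updateN//.
  by apply: contraNneq kJ => <-.
rewrite ge0_integral_mscale//; last 2 first.
- by apply/measurable_EFinP.
- by move=> x _; rewrite lee_fin.
rewrite (_ : (\int[_]_x (f x)%:E = \int[nu k]_(x in A k) (g x)%:E)%E); last first.
  rewrite [RHS]integral_mkcond; apply: eq_integral => x _.
  by rewrite patchE /f indicE; case: ifPn => _; rewrite ?mulr1 ?mulr0.
rewrite gb//= !EFinM.
rewrite (_ : (\prod_(i <- J) update nu k nu' i (A i) = p%:E)%E); last first.
  rewrite /p -prod_probE//; apply: eq_big_seq => i iJ; rewrite updateN//.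
  by apply: contraNneq kJ => <-.
by rewrite -!muleA; congr (_ * _)%E; rewrite muleCA; congr (_ * _)%E; exact: muleC.
Qed.

(** A transformation of two coordinates that maps their product law to a
    product law keeps the whole family independent.  For an event [E] of the other
    coordinates, the pair has a product law under the measure restricted to [E],
    because rectangles determine a finite measure on the plane. *)
Lemma joint_law_pair mu X nu c (k1 k2 : I) (f1 f2 : R * R -> R)
    (nu1 nu2 : probability R R) :
  k1 != k2 -> (forall i, measurable_fun setT (X i)) ->
  measurable_fun setT f1 -> measurable_fun setT f2 ->
  (forall A B, measurable A -> measurable B ->
    (nu k1 \x nu k2) (f1 @^-1` A `&` f2 @^-1` B) = nu1 A * nu2 B)%E ->
  joint_law mu X nu c ->
  joint_law mu
    (update (update X k1 (fun t => f1 (X k1 t, X k2 t))) k2 (fun t => f2 (X k1 t, X k2 t)))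
    (update (update nu k1 nu1) k2 nu2) c.
Proof.
move=> k12 mX mf1 mf2 f12 H; apply: (joint_law_focus (k := k2)).
suff HJ (J : {fset I}) (A : I -> set R) : (forall i, measurable (A i)) ->
    k1 \notin J -> k2 \notin J ->
    mu ((fun t => f2 (X k1 t, X k2 t)) @^-1` A k2 `&`
       ((fun t => f1 (X k1 t, X k2 t)) @^-1` A k1 `&`
        \bigcap_(i in [set` J]) (X i @^-1` A i))) =
    (c%:E * (nu2 (A k2) * (nu1 (A k1) * \prod_(i <- J) nu i (A i))))%E.
  move=> J A mA k2J; rewrite updateE updateE.
  have k1J : k1 \notin (J `\ k1)%fset by rewrite !inE eqxx.
  have k2J' : k2 \notin (J `\ k1)%fset by rewrite !inE (negbTE k2J) andbF.
  (* an untested [X k1] is tested against the whole space *)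
  pose A' := if k1 \in J then A else update A k1 setT.
  have mA' i : measurable (A' i).
    by rewrite /A' /update; case: ifP => // _; case: ifP.
  have A'E i : i \in J -> A' i = A i.
    rewrite /A'; case: ifP => // k1J0 iJ.
    by rewrite updateN//; apply: contraFneq k1J0 => <-.
  have A'k2 : A' k2 = A k2.
    by rewrite /A'; case: ifP => // _; rewrite updateN// eq_sym.
  have := HJ (J `\ k1)%fset A' mA' k1J k2J'.
  rewrite A'k2 => HJ'.
  have JN i : i \in (J `\ k1)%fset -> [/\ i \in J, i != k1 & i != k2].
    rewrite !inE => /andP[ik1 iJ]; split => //.
    by apply: contraNneq k2J => <-.
  have capE : \bigcap_(i in [set` (J `\ k1)%fset])
      (update (update X k1 (fun t => f1 (X k1 t, X k2 t))) k2
         (fun t => f2 (X k1 t, X k2 t)) i @^-1` A i) =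
      \bigcap_(i in [set` (J `\ k1)%fset]) (X i @^-1` A' i).
    by apply: eq_bigcapr => i /= /JN[iJ i1 i2]; rewrite !updateN// A'E.
  have prodE : (\prod_(i <- (J `\ k1)%fset) update (update nu k1 nu1) k2 nu2 i (A i) =
      \prod_(i <- (J `\ k1)%fset) nu i (A' i))%E.
    by apply: eq_big_seq => i /JN[iJ i1 i2]; rewrite !updateN// A'E.
  have [k1J0|k1J0] := boolP (k1 \in J).
    rewrite (bigcap_fsetD1 _ k1J0) [in RHS](big_fsetD1 k1)// capE prodE.
    rewrite [update (update X _ _) _ _ k1]updateN// updateE [update (update nu _ _) _ _ k1]updateN// updateE.
    have A'k1 : A' k1 = A k1 by rewrite /A' k1J0.
    by rewrite A'k1 in HJ'; exact: HJ'.
  have JE : (J `\ k1)%fset = J.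
    by apply/fsetP => i; rewrite !inE; case: eqP => // ->; rewrite (negbTE k1J0).
  rewrite JE in capE prodE HJ'.
  rewrite capE prodE; move: HJ'.
  rewrite [A' k1](_ : _ = setT); last by rewrite /A' (negbTE k1J0) updateE.
  by rewrite preimage_setT setTI probability_setT mul1e => ->.
move=> mA k1J k2J.
set E := \bigcap_(i in _) _.
have mE : measurable E by exact: measurable_bigcap_preimage.
have mI : measurable_fun setT (\1_E : T -> R) by exact: measurable_indic.
have I0 x : 0 <= (\1_E : T -> R) x by [].
have mXX : measurable_fun setT (fun t => (X k1 t, X k2 t)).
  exact: measurable_fun_pair.
set p := \prod_(i <- J) fine (nu i (A i)).
have p0 : 0 <= p by exact: prod_prob_ge0.
have cp0 : 0 <= c * p by rewrite mulr_ge0// (joint_law_ge0 H).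
have mXA i B : measurable B -> measurable (X i @^-1` B).
  by move=> mB; rewrite -[X in measurable X]setTI; exact: mX.
pose S := f2 @^-1` A k2 `&` f1 @^-1` A k1.
have mS : measurable S.
  by apply: measurableI; rewrite -[X in measurable X]setTI; [exact: mf2|exact: mf1].
have massE B : measurable ((fun t => (X k1 t, X k2 t)) @^-1` B) ->
    push (weighted_measure mu mI I0) mXX B = mu ((fun t => (X k1 t, X k2 t)) @^-1` B `&` E).
  by move=> mB; rewrite /push/= /pushforward /weighted integral_indic// setIC.
transitivity (push (weighted_measure mu mI I0) mXX S).
  rewrite massE ?setIA//.
  by rewrite -[X in measurable X]setTI; exact: (mXX measurableT S mS).
rewrite -(@product_measure_unique _ _ _ _ _ (mscale (NngNum cp0) (nu k1)) (nu k2))//; last first.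
  move=> B1 B2 mB1 mB2; rewrite massE; last first.
    rewrite (_ : _ @^-1` _ = X k1 @^-1` B1 `&` X k2 @^-1` B2)//.
    by apply: measurableI; exact: mXA.
  pose A'' := update (update A k1 B1) k2 B2.
  have mA'' i : measurable (A'' i).
    by rewrite /A'' /update; case: ifP => // _; case: ifP.
  have A''E i : i \in J -> A'' i = A i.
    move=> iJ; rewrite /A'' !updateN//; first by apply: contraNneq k1J => <-.
    by apply: contraNneq k2J => <-.
  have k1J' : k1 \notin (k2 |` J)%fset by rewrite !inE negb_or k12.
  have := joint_law_unfocus H mA'' k1J'.
  rewrite bigcap_fsetU1 (big_fsetU1 _ _ k2J)/=.
  rewrite (eq_bigcapr (G := fun i => X i @^-1` A i)); last first.
    by move=> i /= iJ; rewrite A''E.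
  have -> : (\prod_(i <- J) nu i (A'' i) = p%:E)%E.
    by rewrite /p -prod_probE//; apply: eq_big_seq => i iJ; rewrite A''E.
  rewrite {1 2}/A'' [in A in X k1 @^-1` A]updateN// !updateE => E12.
  rewrite (_ : _ @^-1` (B1 `*` B2) `&` E = X k1 @^-1` B1 `&` (X k2 @^-1` B2 `&` E)); last first.
    by rewrite setIA.
  rewrite E12 /mscale/= /A'' updateN// updateE updateE EFinM -!muleA; congr (_ * _)%E.
  by rewrite [RHS]muleCA; congr (_ * _)%E; rewrite muleC.
transitivity ((c * p)%:E * (nu k1 \x nu k2)%E S)%E.
  rewrite /product_measure1 /= ge0_integral_mscale//=.
  exact: measurable_fun_xsection.
rewrite /S setIC f12// EFinM prod_probE// -/p -!muleA; congr (_ * _)%E.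
by rewrite [RHS]muleA muleC [in RHS](muleC (nu2 _)).
Qed.

End joint_law.

(** * Exponential laws *)

Section exponential.
Context (R : realType).
Notation leb := (@lebesgue_measure R).

Let idTR : measurableTypeR R -> R := idfun.

#[local] HB.instance Definition _ :=
  @isMeasurableFun.Build _ _ _ _ idTR (@measurable_id _ _ setT).

Let expoR (r : R) (r0 : 0 < r) : probability (measurableTypeR R) R :=
  exponential_distribution_exponential_prob__canonical__probability_measure_Probability r0.

(** The exponential law as a probability on [R] itself: [exponential_prob] is a
    measure on the copy [measurableTypeR R] of the reals. *)
Definition expo (r : R) (r0 : 0 < r) : probability R R :=
  distribution (expoR r0) idTR.

Lemma expoE (r : R) (r0 : 0 < r) A : expo r0 A = exponential_prob r A.
Proof. by []. Qed.

Lemma integral_expo (r : R) (r0 : 0 < r) (A : set R) (f : R -> R) :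
  measurable A -> measurable_fun setT f -> (forall x, 0 <= f x) ->
  (\int[expo r0]_(x in A) (f x)%:E = \int[leb]_(x in A) (f x * exponential_pdf r x)%:E)%E.
Proof.
move=> mA mf f0.
have mp : measurable_fun setT (exponential_pdf r) by exact: measurable_exponential_pdf.
have p0 x : 0 <= exponential_pdf r x by rewrite exponential_pdf_ge0// ltW.
have mI : measurable_fun setT (\1_A : R -> R) by exact: measurable_indic.
transitivity (\int[weighted_measure leb mp p0]_x (f x * \1_A x)%:E)%E.
  rewrite [LHS]integral_mkcond.
  transitivity (\int[expo r0]_x (f x * \1_A x)%:E)%E.
    apply: eq_integral => x _.
    by rewrite patchE indicE; case: ifPn => _; rewrite ?mulr1 ?mulr0.
  rewrite ge0_integral_distribution; last 2 first.
  - by apply/measurable_EFinP/measurable_funM.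
  - by move=> x; rewrite lee_fin mulr_ge0.
  exact: eq_measure_integral.
rewrite integral_weighted//; last 2 first.
- exact: measurable_funM.
- by move=> x; rewrite mulr_ge0.
rewrite [RHS]integral_mkcond; apply: eq_integral => x _.
by rewrite patchE indicE; case: ifPn => _; rewrite ?mulr1 ?mulr0 ?mul0r.
Qed.

(** Multiplying the density of rate [r] by [exp (l * x)] gives [r / (r - l)]
    times the density of rate [r - l]. *)
Lemma expo_tilt (r l : R) (r0 : 0 < r) (rl0 : 0 < r - l) A : measurable A ->
  (\int[expo r0]_(x in A) (expR (l * x))%:E = (r / (r - l))%:E * expo rl0 A)%E.
Proof.
move=> mA; rewrite integral_expo//; last first.
  by apply: (measurableT_comp (@measurable_expR R)); exact: measurable_funM.
rewrite expoE /exponential_prob -ge0_integralZl//; last 3 first.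
- by apply/measurable_EFinP/measurable_funTS; exact: measurable_exponential_pdf.
- by move=> x _; rewrite lee_fin exponential_pdf_ge0// ltW.
- by rewrite lee_fin divr_ge0// ltW.
apply: eq_integral => x _; rewrite -EFinM; congr _%:E.
have [x0|x0] := leP 0 x; last by rewrite !lt0_exponential_pdf// !mulr0.
rewrite !exponential_pdfE// mulrCA -expRD mulrA divfK ?gt_eqF//.
by congr (_ * expR _); ring.
Qed.

Lemma expo_lt0 (r : R) (r0 : 0 < r) : expo r0 `]-oo, 0[%classic = 0%E.
Proof.
rewrite expoE /exponential_prob integral0_eq// => x /=.
by rewrite in_itv/= => x0; rewrite lt0_exponential_pdf.
Qed.

Definition shift_down (y : R) : measurableTypeR R -> measurableTypeR R :=
  fun x : R => x - y.

Lemma measurable_shift_down (y : R) : measurable_fun setT (shift_down y).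
Proof. exact: (@measurable_funB _ _ R setT id (cst y)). Qed.

Lemma lebesgue_shift (y : R) (A : set R) : measurable A ->
  leb (shift_down y @^-1` A) = leb A.
Proof.
move=> mA; rewrite -[LHS]/(push leb (measurable_shift_down y) A).
apply/esym/lebesgue_measure_unique => //= _ [[a b]] _ <-.
rewrite /push/= /pushforward.
rewrite (_ : _ @^-1` _ = `]a + y, b + y]%classic); last first.
  by apply/seteqP; split => x /=; rewrite !in_itv/= ltrBrDr lerBlDr.
by rewrite !lebesgue_measure_itv/= !lte_fin ltrD2r -!EFinB; case: ifP => // _; congr _%:E; ring.
Qed.

(** Conditioned to exceed [y], an exponential variable is [y] plus a copy of
    itself. *)
Lemma expo_memoryless (r : R) (r0 : 0 < r) (y : R) (C : set R) : 0 <= y ->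
  measurable C -> C `<=` `[0, +oo[ ->
  expo r0 (shift_down y @^-1` C) = ((expR (- r * y))%:E * expo r0 C)%E.
Proof.
move=> y0 mC C0; rewrite !expoE /exponential_prob -ge0_integralZl//; last 2 first.
- by apply/measurable_EFinP/measurable_funTS; exact: measurable_exponential_pdf.
- by move=> x _; rewrite lee_fin exponential_pdf_ge0// ltW.
transitivity (\int[push leb (measurable_shift_down y)]_(x in C)
   ((expR (- r * y))%:E * (exponential_pdf r x)%:E))%E; last first.
  by apply: eq_measure_integral => B mB _; exact: lebesgue_shift.
rewrite (ge0_integral_pushforward (measurable_shift_down y))//; last 2 first.
- apply/measurable_funTS; apply/measurable_EFinP/measurable_funM => //.
  exact: measurable_exponential_pdf.
- by move=> x _; rewrite lee_fin mulr_ge0// ?expR_ge0// exponential_pdf_ge0// ltW.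
apply: eq_integral => x; rewrite inE => /C0/=; rewrite in_itv/= andbT => xy0.
rewrite -EFinM !exponential_pdfE//; last by rewrite (le_trans xy0)// gerBl.
by rewrite mulrCA -expRD; congr (_ * expR _)%:E; rewrite /shift_down; ring.
Qed.

Definition dilate (c : R) : measurableTypeR R -> measurableTypeR R :=
  fun x : R => c * x.

Lemma measurable_dilate (c : R) : measurable_fun setT (dilate c).
Proof. exact: (@measurable_funM _ _ R setT (cst c) id). Qed.

Lemma lebesgue_dilate (c : R) (c0 : 0 < c) (A : set R) : measurable A ->
  (c%:E * leb (dilate c @^-1` A) = leb A)%E.
Proof.
move=> mA; have c0' := ltW c0.
rewrite -[LHS]/(mscale (NngNum c0') (push leb (measurable_dilate c)) A).
apply/esym/lebesgue_measure_unique => //= _ [[a b]] _ <-.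
rewrite /mscale/= /push/= /pushforward.
rewrite (_ : _ @^-1` _ = `]a / c, b / c]%classic); last first.
  apply/seteqP; split => x /=; rewrite !in_itv/= /dilate.
    by rewrite ltr_pdivrMr// ler_pdivlMr// ![x * c]mulrC.
  by rewrite ltr_pdivrMr// ler_pdivlMr// ![x * c]mulrC.
rewrite !lebesgue_measure_itv/= !lte_fin ltr_pM2r ?invr_gt0//.
case: ifP => _; last by rewrite mule0.
by rewrite -!EFinB -EFinM; congr _%:E; rewrite -mulrBl mulrC divfK// gt_eqF.
Qed.

(** The positive part changes nothing almost surely, as negative numbers have
    probability zero; it makes the weights of the model nonnegative everywhere. *)
Lemma expo_dilate (r s c : R) (r0 : 0 < r) (s0 : 0 < s) (A : set R) : 0 < c ->
  s * c = r -> measurable A ->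
  expo r0 ((fun x => c * Num.max x 0) @^-1` A) = expo s0 A.
Proof.
move=> c0 scr mA; have c0' := ltW c0; rewrite !expoE /exponential_prob.
have p0 q x : 0 < q -> (0 <= (exponential_pdf q x : R)%:E)%E.
  by move=> q0; rewrite lee_fin exponential_pdf_ge0// ltW.
have mA' : measurable ((fun x : R => c * Num.max x 0) @^-1` A).
  rewrite -[X in measurable X]setTI; apply: measurable_funM => //.
  exact: measurable_maxr.
transitivity (\int[leb]_(x in dilate c @^-1` A) (exponential_pdf r x)%:E)%E.
  rewrite integral_mkcond [RHS]integral_mkcond; apply: eq_integral => x _.
  rewrite !patchE; have [x0|x0] := leP 0 x.
    by rewrite -[x \in (fun _ => _) @^-1` _]/(c * Num.max x 0 \in A) max_l.
  by rewrite lt0_exponential_pdf//; case: ifP; case: ifP.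
transitivity (\int[mscale (NngNum c0') (push leb (measurable_dilate c))]_(x in A)
    (exponential_pdf s x)%:E)%E; last first.
  by apply: eq_measure_integral => B mB _; exact: lebesgue_dilate.
rewrite ge0_integral_mscale//; last 2 first.
- by apply/measurable_EFinP/measurable_funTS; exact: measurable_exponential_pdf.
- by move=> x _; exact: p0.
rewrite (ge0_integral_pushforward (measurable_dilate c))//; last 2 first.
- by apply/measurable_EFinP/measurable_funTS; exact: measurable_exponential_pdf.
- by move=> x _; exact: p0.
rewrite -ge0_integralZl//; last 3 first.
- by have := @measurable_dilate c measurableT A mA; rewrite setTI.
- apply/measurable_EFinP/measurable_funTS.
  exact: (measurableT_comp (measurable_exponential_pdf s) (measurable_dilate c)).
- by move=> x _; exact: p0.
apply: eq_integral => x _; rewrite /= -EFinM /dilate; congr _%:E.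
have [x0|x0] := leP 0 x; last first.
  by rewrite !lt0_exponential_pdf ?mulr0// pmulr_rlt0.
rewrite !exponential_pdfE ?mulr_ge0// -scr mulrA [c * s]mulrC.
by congr (_ * expR _); ring.
Qed.

(** For independent variables [Y] of rate [b] and [Z] of rate [a]: given
    [Y = y], the event that [Z - y] lies in [C] has probability
    [exp (- a * y) * expo a0 C] by loss of memory, and the factor [exp (- a * y)]
    tilts the law of [Y] to the rate [b + a]. *)
Lemma expo_pair_section (a b : R) (a0 : 0 < a) (b0 : 0 < b) (ab0 : 0 < b + a)
   (A C : set R) :
  measurable A -> measurable C -> C `<=` `[0, +oo[ ->
  (expo b0 \x expo a0)%E [set z | A z.1 /\ C (z.2 - z.1)] =
  ((b / (b + a))%:E * expo ab0 A * expo a0 C)%E.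
Proof.
move=> mA mC C0; rewrite /product_measure1.
have ba0 : 0 < b - - a by rewrite opprK.
have -> : (expo ab0 A = expo ba0 A).
  by rewrite !expoE opprK.
rewrite [in b / _](_ : b + a = b - - a); last by rewrite opprK.
rewrite -expo_tilt//.
have fC : expo a0 C \is a fin_num by exact: fin_num_measure.
rewrite -(fineK fC) muleC -ge0_integralZl//; last 2 first.
- apply/measurable_EFinP/measurable_funTS; apply: (measurableT_comp (@measurable_expR R)).
  exact: measurable_funM.
- by rewrite lee_fin fine_ge0.
rewrite [RHS]integral_mkcond.
have mS : measurable [set z : R * R | A z.1 /\ C (z.2 - z.1)].
  rewrite (_ : [set _ | _] = (fst @^-1` A) `&` ((fun z : R * R => z.2 - z.1) @^-1` C))//.
  apply: measurableI; rewrite -[X in measurable X]setTI; first exact: measurable_fst.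
  exact: measurable_funB.
apply: ge0_ae_eq_integral => //.
- exact: measurable_fun_xsection.
- apply/(measurable_restrictT _ _).1 => //.
  apply/measurable_EFinP/measurable_funTS/measurable_funM => //.
  by apply: (measurableT_comp (@measurable_expR R)); exact: measurable_funM.
- move=> x _; rewrite patchE; case: ifP => // _.
  by rewrite -EFinM lee_fin mulr_ge0 ?fine_ge0 ?expR_ge0.
exists `]-oo, 0[%classic; split => //; first exact: expo_lt0.
move=> y /=; rewrite in_itv/=; apply: contra_notT; rewrite -leNgt => y0 _.
rewrite patchE; case: ifPn => [/set_mem yA|yA].
  rewrite fineK// muleC -expo_memoryless//; congr (expo a0 _).
  apply/seteqP; split => x /=; rewrite /xsection/= inE/=; first by case.
  by split.
rewrite (_ : xsection _ _ = set0) ?measure0//.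
apply/seteqP; split => x //=; rewrite /xsection/= inE/= => -[/mem_set yA'].
by rewrite yA' in yA.
Qed.

End exponential.

(** * The Burke property *)

Section burke.
Context (R : realType).

Lemma measurable_preim d1 d2 (T1 : measurableType d1) (T2 : measurableType d2)
    (f : T1 -> T2) (A : set T2) :
  measurable_fun setT f -> measurable A -> measurable (f @^-1` A).
Proof. by move=> mf mA; rewrite -[X in measurable X]setTI; exact: mf. Qed.

Lemma measurable_minR : measurable_fun setT (fun z : R * R => Num.min z.1 z.2).
Proof. exact: measurable_minr. Qed.

Let sub2 (z : R * R) : R := z.1 - z.2.

Let measurable_sub2 : measurable_fun setT sub2.
Proof. exact: measurable_funB. Qed.

#[local] HB.instance Definition _ := @isMeasurableFun.Build _ _ _ _ sub2 measurable_sub2.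

Definition diff_law (P1 P2 : probability R R) : probability R R :=
  distribution (P1 \x P2)%E sub2.

Lemma diff_lawE (P1 P2 : probability R R) (B : set R) :
  diff_law P1 P2 B = (P1 \x P2)%E [set z | B (z.1 - z.2)].
Proof. by []. Qed.

Let swap (z : R * R) : R * R := (z.2, z.1).

Let measurable_swap : measurable_fun setT swap.
Proof. exact: measurable_fun_pair. Qed.

Lemma product_measure_swap (m1 m2 : probability R R) (S : set (R * R)) : measurable S ->
  (m1 \x m2)%E S = (m2 \x m1)%E (swap @^-1` S).
Proof.
move=> mS.
rewrite -[RHS]/(push (m2 \x m1)%E measurable_swap S); apply: product_measure_unique => // A B mA mB.
rewrite /push/= /pushforward (_ : _ @^-1` _ = B `*` A); last first.
  by apply/seteqP; split => -[x y] /= [].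
by rewrite product_measure1E// muleC.
Qed.

(** The minimum of two independent exponential variables is independent of
    their difference.  On each of the two events that one of them is the smaller,
    [expo_pair_section] separates the minimum from the excess of the other. *)
Lemma expo_min_diff (a b : R) (a0 : 0 < a) (b0 : 0 < b) (ab0 : 0 < a + b) (A B : set R) :
  measurable A -> measurable B ->
  (expo a0 \x expo b0)%E [set z | A (Num.min z.1 z.2) /\ B (z.1 - z.2)] =
  (expo ab0 A * diff_law (expo a0) (expo b0) B)%E.
Proof.
move=> mA mB.
(* the two signs of the difference, reflected to the half-line *)
pose Bp := B `&` `[0, +oo[%classic.
pose Bn := (-%R @^-1` B) `&` `]0, +oo[%classic.
have mBp : measurable Bp by exact: measurableI.
have mBn : measurable Bn by apply: measurableI => //; exact: measurable_preim.
have ba0 : 0 < b + a by rewrite addrC.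
suff key (A' : set R) : measurable A' ->
    (expo a0 \x expo b0)%E [set z | A' (Num.min z.1 z.2) /\ B (z.1 - z.2)] =
    (expo ab0 A' * ((b / (b + a))%:E * expo a0 Bp + (a / (a + b))%:E * expo b0 Bn))%E.
  rewrite key//; congr (_ * _)%E.
  have := key setT measurableT; rewrite probability_setT mul1e => <-.
  rewrite diff_lawE.
  by congr ((_ \x _)%E _); apply/seteqP; split => z /=; [case|split].
move=> mA'.
pose S1 := [set z : R * R | A' z.1 /\ Bp (z.2 - z.1)].
pose S2 := [set z : R * R | A' z.1 /\ Bn (z.2 - z.1)].
have mS (C : set R) : measurable C -> measurable [set z : R * R | A' z.1 /\ C (z.2 - z.1)].
  move=> mC; rewrite (_ : [set _ | _] =
    (fst @^-1` A') `&` ((fun z : R * R => z.2 - z.1) @^-1` C))//.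
  apply: measurableI; apply: measurable_preim => //.
  exact: measurable_funB.
have mS1 : measurable S1 by exact: mS.
have mS2 : measurable S2 by exact: mS.
rewrite (_ : [set z | _] = swap @^-1` S1 `|` S2); last first.
  apply/seteqP; split => -[x y] /=; rewrite /S1 /S2 /Bp /Bn /=.
    rewrite !in_itv/= !andbT opprB subr_ge0 subr_gt0.
    case: (leP y x) => yx [Ax Bx]; [left|right].
      by split.
    by split.
  rewrite !in_itv/= !andbT opprB subr_ge0 subr_gt0.
  by move=> [] [Ax [Bx xy]]; split => //; case: (leP y x) xy => //;
    case: (leP x y) => //.
rewrite measureU//; last 2 first.
- exact: measurable_preim.
- apply/seteqP; split => -[x y] //=; rewrite /S1 /S2 /Bp /Bn /= !in_itv/= !andbT.
  rewrite subr_ge0 subr_gt0.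
  by case=> -[_ [_ xy]] [_ [_]]; rewrite ltNge xy.
transitivity ((expo b0 \x expo a0) S1 + (expo a0 \x expo b0) S2)%E.
  by rewrite (product_measure_swap (expo b0) (expo a0) mS1).
rewrite (expo_pair_section a0 b0 ba0)//; last by move=> x [].
rewrite (expo_pair_section b0 a0 ab0)//; last first.
  by move=> x [_]; rewrite /= !in_itv/= !andbT => /ltW.
have -> : expo ba0 A' = expo ab0 A' by rewrite !expoE addrC.
have q0 : (0 <= expo a0 Bp)%E by exact: measure_ge0.
have w0 : (0 <= expo b0 Bn)%E by exact: measure_ge0.
move: (expo ab0 A') (expo a0 Bp) (expo b0 Bn) q0 w0 => u q w q0 w0.
rewrite ge0_muleDr; last 2 first.
- by apply: mule_ge0 => //; rewrite lee_fin divr_ge0// ltW.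
- by apply: mule_ge0 => //; rewrite lee_fin divr_ge0// ltW.
by rewrite ![in RHS]muleA ![in RHS](muleC u).
Qed.

(** The map [(a, d) -> (a + d^+, a + d^-)] inverts
    [(x, y) -> (min x y, x - y)], hence carries the law in [expo_min_diff] back to
    the law of two independent exponential variables. *)
Lemma expo_recombine (a b : R) (a0 : 0 < a) (b0 : 0 < b) (ab0 : 0 < a + b) (A B : set R) :
  measurable A -> measurable B ->
  (expo ab0 \x diff_law (expo a0) (expo b0))%E
    ((fun z => z.1 + Num.max z.2 0) @^-1` A `&` (fun z => z.1 + Num.max (- z.2) 0) @^-1` B) =
  (expo a0 A * expo b0 B)%E.
Proof.
move=> mA mB.
have mphi : measurable_fun setT (fun z : R * R => (Num.min z.1 z.2, z.1 - z.2)).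
  by apply: measurable_fun_pair; [exact: measurable_minR|exact: measurable_sub2].
have mmax (f : R * R -> R) : measurable_fun setT f ->
    measurable_fun setT (fun z : R * R => z.1 + Num.max (f z) 0).
  move=> mf; apply: measurable_funD => //.
  by apply: measurable_maxr.
rewrite (@product_measure_unique _ _ _ _ _ _ _ (push (expo a0 \x expo b0)%E mphi)); last 2 first.
- by move=> C D mC mD; rewrite -expo_min_diff.
- apply: measurableI; apply: measurable_preim => //; apply: mmax => //.
  exact: measurableT_comp.
transitivity ((expo a0 \x expo b0)%E (A `*` B)); last by rewrite product_measure1E.
apply: (congr1 (expo a0 \x expo b0)%E); apply/seteqP; split => -[x y] /=.
  case: (leP x y) => xy.
    by rewrite max_r ?subr_le0// addr0 opprB max_l ?subr_ge0// addrC subrK.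
  by rewrite max_l ?subr_ge0 ?(ltW xy)// max_r ?opprB ?subr_le0 ?(ltW xy)// addr0 addrC subrK.
case: (leP x y) => xy.
  by rewrite max_r ?subr_le0// addr0 opprB max_l ?subr_ge0// [_ + (y - _)]addrC subrK.
by rewrite max_l ?subr_ge0 ?(ltW xy)// max_r ?opprB ?subr_le0 ?(ltW xy)// addr0 [_ + (x - _)]addrC subrK.
Qed.

Context d (T : measurableType d) (I : choiceType).
Implicit Types (mu : {measure set T -> \bar R}) (X : I -> T -> R)
  (nu : I -> probability R R).

(** The local rule of last-passage percolation on one cell: [h] and [v] hold
    the increments of the passage time along the lower and the left edge and [b]
    the weight of the cell; afterwards [h] and [v] hold the increments along the
    upper and the right edge.  With the minimum stored at [b], the step
    preserves the joint law of the three. *)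
Definition burke_step X (h v b : I) : I -> T -> R :=
  update (update (update X h (fun t => X b t + Num.max (X h t - X v t) 0))
    v (fun t => X b t + Num.max (X v t - X h t) 0))
    b (fun t => Num.min (X h t) (X v t)).

Lemma measurable_burke_step X h v b : (forall i, measurable_fun setT (X i)) ->
  forall i, measurable_fun setT (burke_step X h v b i).
Proof.
move=> mX i; rewrite /burke_step /update.
case: eqP => _; first exact: measurable_minr.
have mm i1 i2 : measurable_fun setT (fun t => X b t + Num.max (X i1 t - X i2 t) 0).
  apply: measurable_funD => //; apply: measurable_maxr => //.
  exact: measurable_funB.
by case: eqP => _ //; case: eqP => _.
Qed.

(** The increments at [h] and [v] consist of a minimum and a difference, which
    are independent.  The weight at [b] has the law of the minimum, so exchanging
    the two changes no law, and the new minimum and the old difference recombine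
    to new increments. *)
Lemma joint_law_burke mu X nu c (h v b : I) (x y : R) (x0 : 0 < x) (y0 : 0 < y)
    (xy0 : 0 < x + y) :
  h != v -> h != b -> v != b ->
  (forall i, measurable_fun setT (X i)) ->
  nu h = expo x0 -> nu v = expo y0 -> nu b = expo xy0 ->
  joint_law mu X nu c -> joint_law mu (burke_step X h v b) nu c.
Proof.
move=> hv hb vb mX nuh nuv nub H0.
have vh : v != h by rewrite eq_sym.
have bh : b != h by rewrite eq_sym.
have bv : b != v by rewrite eq_sym.
pose X1 := update (update X h (fun t => Num.min (X h t) (X v t))) v (fun t => X h t - X v t).
pose nu1 := update (update nu h (expo xy0)) v (diff_law (expo x0) (expo y0)).
have H1 : joint_law mu X1 nu1 c.
  apply: (@joint_law_pair _ _ _ _ _ _ _ _ h v (fun z => Num.min z.1 z.2) sub2) => //.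
    exact: measurable_minR.
  move=> A B mA mB; rewrite nuh nuv -expo_min_diff//.
have mX1 i : measurable_fun setT (X1 i).
  rewrite /X1 /update; case: eqP => _; first exact: measurable_funB.
  by case: eqP => _ //; exact: measurable_minr.
pose X2 := update (update X1 h (fun t => X1 b t)) b (fun t => X1 h t).
pose nu2 := update (update nu1 h (nu1 b)) b (nu1 h).
have H2 : joint_law mu X2 nu2 c.
  apply: (@joint_law_pair _ _ _ _ _ _ _ _ h b snd fst) => //.
  move=> A B mA mB; rewrite -[RHS]muleC -product_measure1E//.
  by congr ((_ \x _)%E _); apply/seteqP; split => -[p q] /= [].
have mX2 i : measurable_fun setT (X2 i).
  by rewrite /X2 /update; case: eqP => _ //; case: eqP => _.
pose f1 (z : R * R) := z.1 + Num.max z.2 0.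
pose f2 (z : R * R) := z.1 + Num.max (- z.2) 0.
pose X3 := update (update X2 h (fun t => f1 (X2 h t, X2 v t))) v (fun t => f2 (X2 h t, X2 v t)).
pose nu3 := update (update nu2 h (expo x0)) v (expo y0).
have nu1b : nu1 b = expo xy0 by rewrite /nu1 !updateN.
have nu2h : nu2 h = expo xy0 by rewrite /nu2 updateN// updateE.
have nu2v : nu2 v = diff_law (expo x0) (expo y0) by rewrite /nu2 !updateN// /nu1 updateE.
have H3 : joint_law mu X3 nu3 c.
  apply: (@joint_law_pair _ _ _ _ _ _ _ _ h v f1 f2) => //.
  - by apply: measurable_funD => //; exact: measurable_maxr.
  - apply: measurable_funD => //; apply: measurable_maxr => //.
    exact: measurableT_comp.
  - by move=> A B mA mB; rewrite nu2h nu2v; exact: expo_recombine.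
have nuE : nu3 = nu.
  apply/funext => i; rewrite /nu3 /nu2 /nu1 /update.
  by case: (eqVneq i v) => [->//|_]; case: (eqVneq i h) => [->//|_];
    case: (eqVneq i b) => [->|//]; rewrite eqxx (negbTE hv).
have XE : X3 = burke_step X h v b.
  apply/funext => i; rewrite /X3 /burke_step.
  have X2h : X2 h = X b by rewrite /X2 updateN// updateE /X1 !updateN.
  have X2v : X2 v = (fun t => X h t - X v t) by rewrite /X2 !updateN// /X1 updateE.
  have X2b : X2 b = (fun t => Num.min (X h t) (X v t)).
    by rewrite /X2 updateE /X1 updateN// updateE.
  rewrite /update; case: (eqVneq i v) => [->|iv].
    by rewrite (negbTE vb); apply/funext => t; rewrite /f2/= X2h X2v opprB.
  case: (eqVneq i h) => [->|ih].
    by rewrite (negbTE hb); apply/funext => t; rewrite /f1/= X2h X2v.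
  case: (eqVneq i b) => [->//|ib].
  by rewrite /X2 !updateN// /X1 !updateN.
by rewrite -nuE -XE.
Qed.

End burke.

(** * Recursions for last-passage times *)

Section last_passage_recursion.
Context (R : realType).
Implicit Types (W : nat * nat -> R) (u v : nat * nat) (s : seq (nat * nat)).

Lemma up_right_path_uniq u s : path up_right_step u s -> uniq (u :: s).
Proof.
move=> us; apply: (@sorted_uniq _ (fun x y => x.1 + x.2 < y.1 + y.2)%N).
- by move=> y x z; exact: ltn_trans.
- by move=> x; exact: ltnn.
rewrite /sorted; apply: sub_path us => x y /orP[] /eqP -> /=.
  by rewrite addSn.
by rewrite addnS.
Qed.

Lemma passage_time_path W u s : path up_right_step u s ->
  passage_time W [fset x in u :: s]%fset = \sum_(x <- u :: s) W x.
Proof.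
move=> us; rewrite /passage_time; apply: perm_big.
apply: uniq_perm; [exact: fset_uniq|exact: up_right_path_uniq|].
by move=> x; rewrite in_fset.
Qed.

Lemma le_last_passage W u s : path up_right_step u s ->
  (u.1 <= (last u s).1)%N -> (u.2 <= (last u s).2)%N ->
  \sum_(x <- u :: s) W x <= last_passage W u (last u s).
Proof.
move=> us u1 u2; rewrite -passage_time_path//.
by apply: (last_passage_max W u1 u2).2; exists s.
Qed.

Lemma last_passage_path W u v : (u.1 <= v.1)%N -> (u.2 <= v.2)%N ->
  exists s, [/\ path up_right_step u s, last u s = v &
    last_passage W u v = \sum_(x <- u :: s) W x].
Proof.
move=> u1 u2; have [[pi [s [us lv] <-]] LE _] := last_passage_max W u1 u2.
by exists s; split => //; rewrite LE passage_time_path.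
Qed.

Lemma up_right_path_le u s : path up_right_step u s ->
  (u.1 <= (last u s).1)%N && (u.2 <= (last u s).2)%N.
Proof.
elim: s u => [|y s IHs] u /=; first by rewrite !leqnn.
case/andP => uy /IHs /andP[y1 y2].
by case/orP: uy y1 y2 => /eqP -> /= y1 y2; rewrite ?y1 ?y2 ?(ltnW y1) ?(ltnW y2).
Qed.

Lemma last_passage_refl W u : last_passage W u u = W u.
Proof.
have [s [us lu ->]] := @last_passage_path W u u (leqnn _) (leqnn _).
case: s us lu => [|y s]; first by rewrite big_seq1.
move=> /= /andP[uy ys] lu; have := up_right_path_le ys; rewrite lu.
by case/orP: uy => /eqP ->; rewrite /= ltnn ?andbF.
Qed.

Lemma last_passage_extend W u v v' : (u.1 <= v'.1)%N -> (u.2 <= v'.2)%N ->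
  up_right_step v' v -> W v + last_passage W u v' <= last_passage W u v.
Proof.
move=> u1 u2 v'v; have [s [us lv' ->]] := @last_passage_path W u v' u1 u2.
have pv : path up_right_step u (rcons s v) by rewrite rcons_path us lv'.
have := up_right_path_le pv; rewrite last_rcons => /andP[uv1 uv2].
have := le_last_passage W pv; rewrite last_rcons -rcons_cons -cats1 big_cat big_seq1 /= addrC.
exact.
Qed.

Lemma last_passage_last_step W u v : (u.1 <= v.1)%N -> (u.2 <= v.2)%N -> u != v ->
  exists v', [/\ (u.1 <= v'.1)%N, (u.2 <= v'.2)%N, up_right_step v' v &
    last_passage W u v <= W v + last_passage W u v'].
Proof.
move=> u1 u2 uv; have [s [us lv ->]] := @last_passage_path W u v u1 u2.
case/lastP: s us lv => [|s y]; first by move=> _ /= /eqP; rewrite (negbTE uv).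
rewrite rcons_path last_rcons => /andP[us sy] yv; subst y.
have /andP[l1 l2] := up_right_path_le us.
exists (last u s); split => //.
rewrite -rcons_cons -cats1 big_cat big_seq1 /= addrC lerD2l.
exact: le_last_passage.
Qed.

Lemma last_passage_col W a b j : (b <= j)%N ->
  last_passage W (a, b) (a, j.+1) = W (a, j.+1) + last_passage W (a, b) (a, j).
Proof.
move=> bj; apply/eqP; rewrite eq_le; apply/andP; split; last first.
  by apply: last_passage_extend => //=; rewrite /up_right_step eqxx orbT.
have [|||[v1 v2] [/= u1 u2 st le]] := @last_passage_last_step W (a, b) (a, j.+1).
- by [].
- exact: leqW.
- by rewrite xpair_eqE eqxx /= ltn_eqF.
case/orP: st le u1 u2 => /eqP[-> ->]//=.
by move=> _; rewrite ltnn.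
Qed.

Lemma last_passage_row W a b i : (a <= i)%N ->
  last_passage W (a, b) (i.+1, b) = W (i.+1, b) + last_passage W (a, b) (i, b).
Proof.
move=> ai; apply/eqP; rewrite eq_le; apply/andP; split; last first.
  by apply: last_passage_extend => //=; rewrite /up_right_step eqxx.
have [|||[v1 v2] [/= u1 u2 st le]] := @last_passage_last_step W (a, b) (i.+1, b).
- exact: leqW.
- by [].
- by rewrite xpair_eqE eqxx andbT ltn_eqF.
case/orP: st le u1 u2 => /eqP[-> ->]//=.
by move=> _ _; rewrite ltnn.
Qed.

Lemma last_passageSS W a b i j : (a <= i)%N -> (b <= j)%N ->
  last_passage W (a, b) (i.+1, j.+1) =
  W (i.+1, j.+1) + Num.max (last_passage W (a, b) (i, j.+1)) (last_passage W (a, b) (i.+1, j)).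
Proof.
move=> ai bj; apply/eqP; rewrite eq_le; apply/andP; split.
  have [|||[v1 v2] [/= u1 u2 st le]] := @last_passage_last_step W (a, b) (i.+1, j.+1).
  - exact: leqW.
  - exact: leqW.
  - by rewrite xpair_eqE ltn_eqF.
  apply: (le_trans le); rewrite lerD2l le_max.
  by case/orP: st => /eqP[-> ->]; rewrite lexx ?orbT.
rewrite maxElt; case: ifP => _; apply: last_passage_extend => //=.
- exact: leqW.
- by rewrite /up_right_step eqxx orbT.
- exact: leqW.
- by rewrite /up_right_step eqxx.
Qed.

(** A path that leaves the origin visits (1, 0) or (0, 1) next. *)
Lemma last_passage_first_step W i j :
  last_passage W (0, 0)%N (i.+1, j.+1) = W (0, 0)%N +
  Num.max (last_passage W (1, 0)%N (i.+1, j.+1)) (last_passage W (0, 1)%N (i.+1, j.+1)).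
Proof.
have hb k : last_passage W (0, 0)%N (k.+1, 0)%N =
    W (0, 0)%N + last_passage W (1, 0)%N (k.+1, 0)%N.
  elim: k => [|k IHk].
    by rewrite last_passage_row// !last_passage_refl addrC.
  by rewrite last_passage_row// IHk [in RHS]last_passage_row// addrCA.
have vb k : last_passage W (0, 0)%N (0, k.+1)%N =
    W (0, 0)%N + last_passage W (0, 1)%N (0, k.+1)%N.
  elim: k => [|k IHk].
    by rewrite last_passage_col// !last_passage_refl addrC.
  by rewrite last_passage_col// IHk [in RHS]last_passage_col// addrCA.
elim: i j => [|i IHi]; elim=> [|j IHj].
- rewrite last_passageSS// hb vb -addr_maxr addrCA; congr (_ + _).
  rewrite (@last_passage_col W 1%N 0%N 0%N)// (@last_passage_row W 0%N 1%N 0%N)//.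
  by rewrite -addr_maxr maxC.
- rewrite last_passageSS// IHj vb -addr_maxr addrCA; congr (_ + _).
  rewrite (@last_passage_col W 1%N 0%N j.+1)// (@last_passageSS W 0%N 1%N 0%N j.+1)//.
  by rewrite -addr_maxr maxCA.
- rewrite last_passageSS// IHi hb -addr_maxr addrCA; congr (_ + _).
  rewrite (@last_passage_row W 0%N 1%N i.+1)// (@last_passageSS W 1%N 0%N i.+1 0%N)//.
  by rewrite -addr_maxr maxAC.
- rewrite last_passageSS// IHi IHj -addr_maxr addrCA; congr (_ + _).
  rewrite (@last_passageSS W 0%N 1%N i.+1 j.+1)// (@last_passageSS W 1%N 0%N i.+1 j.+1)//.
  by rewrite -addr_maxr maxACA.
Qed.

(** The increments along the edges of a cell satisfy a recursion that is monotone
    in opposite senses for the two directions, so the proof carries along the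
    reverse inequality for the horizontal increments. *)
Lemma last_passage_hor_increment W W' :
  (forall i j, W (i, j.+1) = W' (i, j.+1)) -> (forall i, W (i, 0%N) <= W' (i, 0%N)) ->
  forall i j,
  last_passage W' (1, 0)%N (i.+1, j.+1) - last_passage W' (1, 0)%N (i.+1, j) <=
  last_passage W (1, 0)%N (i.+1, j.+1) - last_passage W (1, 0)%N (i.+1, j).
Proof.
move=> WE Wle.
pose L (V : nat * nat -> R) i j := last_passage V (1, 0)%N (i.+1, j).
have LSS V i j : L V i.+1 j.+1 = V (i.+2, j.+1) + Num.max (L V i j.+1) (L V i.+1 j).
  by rewrite /L last_passageSS.
have LS0 V i : L V i.+1 0%N = V (i.+2, 0%N) + L V i 0%N by rewrite /L last_passage_row.
have L0S V j : L V 0%N j.+1 = V (1, j.+1)%N + L V 0%N j by rewrite /L last_passage_col.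
suff key j : (forall i, L W' i j.+1 - L W' i j <= L W i j.+1 - L W i j) by move=> i j; exact: key.
suff : (forall i, L W i.+1 j - L W i j <= L W' i.+1 j - L W' i j) /\
   (forall i, L W' i j.+1 - L W' i j <= L W i j.+1 - L W i j) by case.
have step j0 : (forall i, L W i.+1 j0 - L W i j0 <= L W' i.+1 j0 - L W' i j0) ->
    forall i, L W' i j0.+1 - L W' i j0 <= L W i j0.+1 - L W i j0.
  move=> HI; elim=> [|i IHi]; first by rewrite !L0S WE !addrK.
  rewrite !LSS WE; have := HI i; move: IHi.
  rewrite !maxElt; case: ltP => ? ?; case: ltP => ? ?; lra.
elim: j => [|j [HI HJ]].
  split; last first.
    by apply: step => i; rewrite !LS0 !addrK.
  by move=> i; rewrite !LS0 !addrK.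
have HI' : forall i, L W i.+1 j.+1 - L W i j.+1 <= L W' i.+1 j.+1 - L W' i j.+1.
  move=> i; rewrite !LSS WE; have := HI i; have := HJ i.
  rewrite !maxElt; case: ltP => ? ?; case: ltP => ? ?; lra.
by split => //; exact: step.
Qed.

Lemma last_passage_hor_compare W W' i j j' :
  (forall i j, W (i, j.+1) = W' (i, j.+1)) -> (forall i, W (i, 0%N) <= W' (i, 0%N)) ->
  (j' <= j)%N ->
  last_passage W' (1, 0)%N (i.+1, j) - last_passage W' (1, 0)%N (i.+1, j') <=
  last_passage W (1, 0)%N (i.+1, j) - last_passage W (1, 0)%N (i.+1, j').
Proof.
move=> WE Wle; elim: j => [|j IHj]; first by rewrite leqn0 => /eqP ->; rewrite !subrr.
rewrite leq_eqVlt ltnS => /orP[/eqP ->|/IHj]; first by rewrite !subrr.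
have := @last_passage_hor_increment W W' WE Wle i j; lra.
Qed.

Lemma last_passage_col_sum W n :
  last_passage W (0, 0)%N (0, n)%N = W (0, 0)%N + \sum_(k <- [seq (0%N, j.+1) | j <- iota 0 n]) W k.
Proof.
elim: n => [|n IHn]; first by rewrite last_passage_refl big_nil addr0.
rewrite last_passage_col// IHn -[in RHS]addn1 iotaD map_cat big_cat big_seq1 /= add0n.
by rewrite addrCA; congr (_ + _); rewrite addrC.
Qed.

Lemma up_right_path_ge u s x : path up_right_step u s -> x \in u :: s ->
  (u.1 <= x.1)%N && (u.2 <= x.2)%N.
Proof.
elim: s u x => [|y s IHs] u x /=; first by rewrite inE => _ /eqP ->; rewrite !leqnn.
case/andP => uy ys; rewrite inE => /orP[/eqP ->|]; first by rewrite !leqnn.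
move=> /(IHs y x ys) /andP[]; case/orP: uy => /eqP -> /= y1 y2.
  by rewrite (ltnW y1).
by rewrite y1 (ltnW y2).
Qed.

Lemma ler_last_passage W W' u v : (u.1 <= v.1)%N -> (u.2 <= v.2)%N ->
  (forall k, (u.1 <= k.1)%N -> (u.2 <= k.2)%N -> W k <= W' k) ->
  last_passage W u v <= last_passage W' u v.
Proof.
move=> u1 u2 WW'; have [s [us lv ->]] := @last_passage_path W u v u1 u2.
apply: (@le_trans _ _ (\sum_(x <- u :: s) W' x)).
  rewrite big_seq [leRHS]big_seq; apply: ler_sum => x xs.
  by have /andP[? ?] := up_right_path_ge us xs; exact: WW'.
by rewrite -lv; apply: le_last_passage => //; rewrite lv.
Qed.

Lemma eq_last_passage W W' u v : (u.1 <= v.1)%N -> (u.2 <= v.2)%N ->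
  (forall k, (u.1 <= k.1)%N -> (u.2 <= k.2)%N -> W k = W' k) ->
  last_passage W u v = last_passage W' u v.
Proof.
move=> u1 u2 WW'; apply/eqP; rewrite eq_le.
by apply/andP; split; apply: ler_last_passage => // k k1 k2; rewrite WW'.
Qed.

Lemma last_passage_ge0 W u v : (u.1 <= v.1)%N -> (u.2 <= v.2)%N ->
  (forall k, 0 <= W k) -> 0 <= last_passage W u v.
Proof.
move=> u1 u2 W0; have [s [_ _ ->]] := @last_passage_path W u v u1 u2.
exact: sumr_ge0.
Qed.

End last_passage_recursion.

(** * The exponential moment of the two-sided passage time *)

Section mgf.
Context d (T : measurableType d) (R : realType).
Implicit Types (X W : nat * nat -> T -> R) (mu : {measure set T -> \bar R})
  (nu : nat * nat -> probability R R).

Notation G W u v t := (last_passage (fun k => W k t) u v).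

Lemma measurable_last_passage W u v : (forall k, measurable_fun setT (W k)) ->
  (u.1 <= v.1)%N -> (u.2 <= v.2)%N -> measurable_fun setT (fun t => G W u v t).
Proof.
case: u v => [a b] [a' b'] mW /= /subnKC <- /subnKC <-.
move: (a' - a)%N (b' - b)%N => i j {a' b'}.
elim: j i => [|j IHj].
  elim=> [|i IHi]; rewrite ?addn0.
    by rewrite (_ : (fun t => _) = W (a, b))//; apply/funext => t; rewrite last_passage_refl.
  rewrite addnS (_ : (fun t => _) = W ((a + i).+1, b) \+
      (fun t => G W (a, b) ((a + i)%N, (b + 0)%N) t)).
    exact: measurable_funD.
  by apply/funext => t; rewrite addn0 last_passage_row// leq_addr.
elim=> [|i IHi].
  rewrite addn0 addnS (_ : (fun t => _) = W (a, (b + j).+1) \+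
      (fun t => G W (a, b) ((a + 0)%N, (b + j)%N) t)).
    exact: measurable_funD.
  by apply/funext => t; rewrite addn0 last_passage_col// leq_addr.
rewrite !addnS (_ : (fun t => _) = W ((a + i).+1, (b + j).+1) \+
    (fun t => Num.max (G W (a, b) ((a + i)%N, (b + j.+1)%N) t)
       (G W (a, b) ((a + i.+1)%N, (b + j)%N) t))).
  by apply: measurable_funD => //; exact: measurable_maxr.
by apply/funext => t; rewrite !addnS last_passageSS// leq_addr.
Qed.

(** Burke steps across the row of height [j], from left to right: the site
    [(i, 0)] holds a horizontal increment, [(0, j)] the vertical one that travels
    through the row. *)
Fixpoint row_sweep X (j i : nat) : nat * nat -> T -> R :=
  if i is i'.+1 then burke_step (row_sweep X j i') (i, 0%N) (0%N, j) (i, j) else X.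

Fixpoint sweep X (m n : nat) : nat * nat -> T -> R :=
  if n is n'.+1 then row_sweep (sweep X m n') n m else X.

Lemma burke_stepE X h v b k t : h != v -> h != b -> v != b ->
  burke_step X h v b k t =
  if k == h then X b t + Num.max (X h t - X v t) 0 else
  if k == v then X b t + Num.max (X v t - X h t) 0 else
  if k == b then Num.min (X h t) (X v t) else X k t.
Proof.
move=> hv hb vb; rewrite /burke_step /update.
case: (eqVneq k h) => [->|kh]; first by rewrite (negbTE hb) (negbTE hv).
case: (eqVneq k v) => [->|kv]; first by rewrite (negbTE vb).
by case: eqP.
Qed.

(** After [i] steps in the row of height [j + 1], the first [i] horizontal
    increments have been raised to that height, the others are still those of
    height [j], and the vertical increment is the one at abscissa [i]. *)
Lemma row_sweepE X W j m t :
  (forall i, (i < m)%N -> X (i.+1, 0)%N t = G W (0, 0)%N (i.+1, j) t - G W (0, 0)%N (i, j) t) ->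
  (forall j', (j < j')%N -> X (0, j')%N t = W (0, j')%N t) ->
  (forall i j', (j < j')%N -> X (i.+1, j')%N t = W (i.+1, j')%N t) ->
  forall i, (i <= m)%N -> let Y := row_sweep X j.+1 i in
  [/\ forall i', (i' < i)%N ->
        Y (i'.+1, 0)%N t = G W (0, 0)%N (i'.+1, j.+1) t - G W (0, 0)%N (i', j.+1) t,
      forall i', (i <= i' < m)%N ->
        Y (i'.+1, 0)%N t = G W (0, 0)%N (i'.+1, j) t - G W (0, 0)%N (i', j) t,
      Y (0, j.+1)%N t = G W (0, 0)%N (i, j.+1) t - G W (0, 0)%N (i, j) t,
      forall j', (j.+1 < j')%N -> Y (0, j')%N t = W (0, j')%N t &
      forall i' j', (j.+1 < j')%N || (j.+1 == j') && (i <= i')%N ->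
        Y (i'.+1, j')%N t = W (i'.+1, j')%N t].
Proof.
move=> X0 XV XB; elim=> [|i IHi] im /=.
  split => //.
  - by rewrite XV// last_passage_col// addrK.
  - by move=> j' jj'; rewrite XV// ltnW.
  - move=> i' j' /orP[jj'|/andP[/eqP <- _]]; first by rewrite XB// ltnW.
    by rewrite XB.
have [Y1 Y2 Y3 Y4 Y5] := IHi (ltnW im).
have h1 : ((i.+1, 0) != (0, j.+1))%N by [].
have h2 : ((i.+1, 0) != (i.+1, j.+1))%N by rewrite xpair_eqE eqxx.
have h3 : ((0, j.+1) != (i.+1, j.+1))%N by [].
have Yh := Y2 i; rewrite leqnn im in Yh; have {}Yh := Yh isT.
have Yb : row_sweep X j.+1 i (i.+1, j.+1)%N t = W (i.+1, j.+1)%N t.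
  by apply: Y5; rewrite eqxx leqnn orbT.
have GE := @last_passageSS _ (fun k => W k t) 0 0 i j isT isT.
split.
- move=> i'; rewrite ltnS leq_eqVlt => /orP[/eqP ->|i'i].
    rewrite burke_stepE// eqxx Yb Yh Y3 GE !maxElt.
    by case: ltP => ?; case: ltP => ?; lra.
  rewrite burke_stepE// !xpair_eqE eqSS !eqxx !andbT ltn_eqF//= ?andbF.
  exact: Y1.
- move=> i' /andP[ii' i'm]; rewrite burke_stepE// !xpair_eqE eqSS !andbT gtn_eqF//= ?andbF.
  by rewrite Y2// ltnW.
- rewrite burke_stepE// !xpair_eqE /= eqxx Yb Yh Y3 GE !maxElt.
  by case: ltP => ?; case: ltP => ?; lra.
- move=> j' jj'; rewrite burke_stepE// !xpair_eqE /= gtn_eqF//; exact: Y4.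
- move=> i' j' H; rewrite burke_stepE// !xpair_eqE /=.
  have -> : (j' == 0)%N = false by case: j' H => // /orP[|/andP[]].
  rewrite andbF.
  have -> : (i'.+1 == i.+1) && (j' == j.+1) = false.
    apply/negbTE/negP => /andP[/eqP[i'i] /eqP j'j]; subst.
    by move: H; rewrite ltnn ltnn andbF.
  apply: Y5; move: H => /orP[->//|/andP[-> /ltnW ->]].
  by rewrite orbT.
Qed.

Lemma sweepE X m n t : X (0, 0)%N t = 0 ->
  [/\ forall i, (i < m)%N ->
        sweep X m n (i.+1, 0)%N t = G X (0, 0)%N (i.+1, n) t - G X (0, 0)%N (i, n) t,
      forall j', (n < j')%N -> sweep X m n (0, j')%N t = X (0, j')%N t &
      forall i j', (n < j')%N -> sweep X m n (i.+1, j')%N t = X (i.+1, j')%N t].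
Proof.
move=> X00; elim: n => [|n [IH1 IH2 IH3]] /=.
  by split => // i im; rewrite last_passage_row// addrK.
have [Y1 _ _ Y4 Y5] := row_sweepE IH1 IH2 IH3 (leqnn m).
split => // i j' nj'; apply: Y5; by rewrite nj'.
Qed.

(** Telescoping the increments along the line of height [n] leaves the
    passage time less its value on the vertical axis. *)
Lemma sweep_last_passage X m n t : X (0, 0)%N t = 0 ->
  \sum_(k <- [seq (i.+1, 0%N) | i <- iota 0 m]) sweep X m n k t =
  G X (0, 0)%N (m, n) t - \sum_(k <- [seq (0%N, j.+1) | j <- iota 0 n]) X k t.
Proof.
move=> X00; have [Y1 _ _] := sweepE m n X00.
have := last_passage_col_sum (fun k => X k t) n; rewrite X00 add0r => <-.
rewrite big_map (_ : iota 0 m = index_iota 0 m); last by rewrite /index_iota subn0.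
rewrite (eq_big_nat _ _ (F2 := fun i => G X (0, 0)%N (i.+1, n) t - G X (0, 0)%N (i, n) t)).
  by rewrite telescope_sumr.
by move=> i /andP[_ im]; exact: Y1.
Qed.

Lemma joint_law_row_sweep mu X nu c (x : R) (x0 : 0 < x) (x1 : 0 < 1 - x)
    (x2 : 0 < x + (1 - x)) m j :
  (forall k, measurable_fun setT (X k)) ->
  (forall i, (i < m)%N -> nu (i.+1, 0)%N = expo x0) -> nu (0, j.+1)%N = expo x1 ->
  (forall i, nu (i.+1, j.+1)%N = expo x2) ->
  joint_law mu X nu c ->
  forall i, (i <= m)%N -> joint_law mu (row_sweep X j.+1 i) nu c /\
    (forall k, measurable_fun setT (row_sweep X j.+1 i k)).
Proof.
move=> mX nuh nuv nub H; elim=> [_|i IHi im] //=.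
have [HX mX'] := IHi (ltnW im); split; last by move=> k; exact: measurable_burke_step.
apply: (joint_law_burke (x0 := x0) (y0 := x1) (xy0 := x2)) => //.
- by rewrite xpair_eqE eqxx.
- exact: nuh.
Qed.

Lemma joint_law_sweep mu X nu c (x : R) (x0 : 0 < x) (x1 : 0 < 1 - x)
    (x2 : 0 < x + (1 - x)) m n :
  (forall k, measurable_fun setT (X k)) ->
  (forall i, nu (i.+1, 0)%N = expo x0) ->
  (forall j, (j < n)%N -> nu (0, j.+1)%N = expo x1) ->
  (forall i j, nu (i.+1, j.+1)%N = expo x2) ->
  joint_law mu X nu c ->
  joint_law mu (sweep X m n) nu c /\ (forall k, measurable_fun setT (sweep X m n k)).
Proof.
move=> mX nuh nuv nub H; elim: n nuv => [//|n IHn] nuv /=.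
have [HX mX'] := IHn (fun j jn => nuv j (ltnW jn)).
by apply: (@joint_law_row_sweep _ _ _ _ x x0 x1 x2 m) => //; exact: nuv.
Qed.

Lemma joint_law_tilt_seq mu X nu c (l r : R) (r0 : 0 < r) (rl0 : 0 < r - l)
    (s : seq (nat * nat)) :
  (forall k, measurable_fun setT (X k)) -> uniq s ->
  (forall k, k \in s -> nu k = expo r0) -> joint_law mu X nu c ->
  exists mu' : {measure set T -> \bar R}, exists nu',
  [/\ joint_law mu' X nu' (c * (r / (r - l)) ^+ size s),
      forall k, k \in s -> nu' k = expo rl0,
      forall k, k \notin s -> nu' k = nu k &
      forall f : T -> R, measurable_fun setT f -> (forall t, 0 <= f t) ->
        (\int[mu']_t (f t)%:E = \int[mu]_t (f t * expR (l * \sum_(k <- s) X k t))%:E)%E].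
Proof.
move=> mX; elim: s mu nu c => [|k s IHs] mu nu c /=.
  move=> _ _ H; exists mu, nu; split => //; first by rewrite expr0 mulr1.
  by move=> f mf f0; apply: eq_integral => t _; rewrite big_nil mulr0 expR0 mulr1.
case/andP => ks us nus H.
pose g x := expR (l * x).
have mg : measurable_fun setT g.
  by apply: (measurableT_comp (@measurable_expR R)); exact: measurable_funM.
have g0 x : 0 <= g x by exact: expR_ge0.
have mgX : measurable_fun setT (g \o X k) by exact: measurableT_comp.
have gE A : measurable A -> (\int[nu k]_(x in A) (g x)%:E = (r / (r - l))%:E * expo rl0 A)%E.
  by move=> mA; rewrite nus ?inE ?eqxx//; exact: expo_tilt.
have H' := joint_law_tilt mg g0 mX gE mgX (fun t => g0 (X k t)) H.
have nus' i : i \in s -> update nu k (expo rl0) i = expo r0.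
  move=> is_; rewrite updateN ?nus ?inE ?is_ ?orbT//.
  by apply: contraNneq ks => <-.
have [mu' [nu' [H1 H2 H3 H4]]] := IHs _ _ _ us nus' H'.
exists mu', nu'; split.
- by rewrite exprS mulrA.
- move=> i; rewrite inE => /orP[/eqP ->|]; last exact: H2.
  by rewrite H3// updateE.
- move=> i; rewrite inE negb_or => /andP[ik is_].
  by rewrite H3// updateN.
- move=> f mf f0; rewrite H4// integral_weighted//.
  + apply: eq_integral => t _; rewrite big_cons -mulrA /g /= -expRD.
    by congr (_ * expR _)%:E; ring.
  + apply: measurable_funM => //; apply: (measurableT_comp (@measurable_expR R)).
    by apply: measurable_funM => //; apply: measurable_sum.
  + by move=> t; rewrite mulr_ge0// expR_ge0.
Qed.

(** Tilt the vertical boundary, sweep, tilt the horizontal increments on the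
    line of height [n].  By [sweep_last_passage] the two densities multiply to the
    exponential of [w - z] times the passage time. *)
Lemma last_passage_mgf mu X nu (w z : R) (w0 : 0 < w) (w1 : 0 < 1 - w) (z0 : 0 < z)
    (z1 : 0 < 1 - z) (o0 : (0 : R) < 1) m n :
  (forall k, measurable_fun setT (X k)) -> (forall t, X (0, 0)%N t = 0) ->
  (forall i, nu (i.+1, 0)%N = expo w0) ->
  (forall j, nu (0, j.+1)%N = expo z1) ->
  (forall i j, nu (i.+1, j.+1)%N = expo o0) ->
  joint_law mu X nu 1 ->
  (\int[mu]_t (expR ((w - z) * G X (0, 0)%N (m, n) t))%:E =
   ((w / z) ^+ m * ((1 - z) / (1 - w)) ^+ n)%:E)%E.
Proof.
move=> mX X00 nuh nuv nub H.
have o0' : 0 < w + (1 - w) by rewrite subrKC.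
have expo_eq r r' (h : 0 < r) (h' : 0 < r') : r = r' -> expo h = expo h'.
  by move=> e; subst r'; congr expo; exact: bool_irrelevance.
have w1' : 0 < 1 - z - (w - z) by rewrite (_ : _ - _ = 1 - w)//; ring.
have z0' : 0 < w - (w - z) by rewrite (_ : _ - _ = z)//; ring.
pose sv := [seq (0%N, j.+1) | j <- iota 0 n].
pose sh := [seq (i.+1, 0%N) | i <- iota 0 m].
have usv : uniq sv by rewrite map_inj_uniq ?iota_uniq// => ? ? [].
have ush : uniq sh by rewrite map_inj_uniq ?iota_uniq// => ? ? [].
have [|mu1 [nu1 [H1 nu1v nu1N int1]]] :=
  @joint_law_tilt_seq mu X nu 1 (w - z) (1 - z) z1 w1' sv mX usv _ H.
  by move=> k /mapP[j _ ->].
have [|||H2 mX2] := @joint_law_sweep mu1 X nu1 _ w w0 w1 o0' m n mX _ _ _ H1.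
- by move=> i; rewrite nu1N ?nuh//; apply/negP => /mapP[j _ []].
- move=> j jn; rewrite nu1v; first by apply: expo_eq; ring.
  by apply/mapP; exists j => //; rewrite mem_iota.
- move=> i j; rewrite nu1N ?nub; first by apply: expo_eq; ring.
  by apply/negP => /mapP[? _ []].
have [|mu3 [nu3 [H3 _ _ int3]]] :=
  @joint_law_tilt_seq mu1 _ nu1 _ (w - z) w w0 z0' sh mX2 ush _ H2.
  move=> k /mapP[i _ ->]; rewrite nu1N ?nuh//.
  by apply/negP => /mapP[j _ []].
have := joint_law_mass H3; rewrite !size_map !size_iota mul1r.
have -> : w - (w - z) = z by ring.
have -> : 1 - z - (w - z) = 1 - w by ring.
rewrite mulrC => <-.
rewrite -[in RHS](mul1e (mu3 _)) -integral_cst// int3//.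
rewrite int1//; last first.
  under eq_fun do rewrite mul1r; apply: (measurableT_comp (@measurable_expR R)).
  by apply: measurable_funM => //; apply: measurable_sum.
apply: eq_integral => t _; rewrite mul1r sweep_last_passage// -expRD.
by congr (expR _)%:E; rewrite -mulrDr subrK.
Qed.

End mgf.

(** * All boundary rates on one probability space *)

Section model.
Context (R : realType) d (T : measurableType d) (P : probability T R).
Variables (omega : nat * nat -> {RV P >-> R}) (w0 z0 : R).
Hypotheses (w0_gt0 : 0 < w0) (z0_lt1 : z0 < 1) (omegaP : lpp_weights w0 z0 omega).

(** Turns weights with boundary rates [w0] and [1 - z0] into weights with
    boundary rates [w] and [1 - z], and leaves the bulk as it is. *)
Definition rescale (w z : R) (k : nat * nat) : R :=
  if k.2 == 0%N then w0 / w else if k.1 == 0%N then (1 - z0) / (1 - z) else 1.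

Definition weight (w z : R) (k : nat * nat) (t : T) : R :=
  rescale w z k * Num.max (omega k t) 0.

Definition law (w z : R) (w_gt0 : 0 < w) (z_lt1 : 0 < 1 - z) (k : nat * nat) :
    probability R R :=
  match k with
  | (0%N, 0%N) => \d_(0 : R)
  | (_.+1, 0%N) => expo w_gt0
  | (0%N, _.+1) => expo z_lt1
  | (_.+1, _.+1) => expo ltr01
  end.

Lemma measurable_weight w z k : measurable_fun setT (weight w z k).
Proof. by apply: measurable_funM => //; exact: measurable_maxr. Qed.

Lemma joint_law_weight w z (w_gt0 : 0 < w) (z_lt1 : 0 < 1 - z) :
  joint_law P (weight w z) (law w_gt0 z_lt1) 1.
Proof.
have [ind bulk row col orig] := omegaP.
have z0_gt0 : 0 < 1 - z0 by rewrite subr_gt0.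
move=> J A mA; rewrite mul1e.
have mf k : measurable_fun setT (fun x : R => rescale w z k * Num.max x 0).
  by apply: measurable_funM => //; exact: measurable_maxr.
pose A' k := (fun x => rescale w z k * Num.max x 0) @^-1` A k.
have mA' k : measurable (A' k) by exact: measurable_preim.
transitivity (P (\bigcap_(k in [set` J]) (omega k @^-1` A' k))) => //.
rewrite (ind J A'); last by move=> k _.
apply: eq_bigr => -[i j] _.
case: i j => [|i] [|j] /=.
- rewrite diracE (_ : _ @^-1` _ = if 0 \in A (0, 0)%N then setT else set0).
    by case: ifP => _; rewrite ?probability_setT ?measure0.
  apply/seteqP; split => t /=; rewrite /A' /= orig maxxx mulr0.
    by move=> /mem_set ->.
  by case: ifP => // /set_mem.
- transitivity (exponential_prob (1 - z0) (A' (0, j.+1)%N)); first exact: col.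
  rewrite -(expoE z0_gt0) /A' /rescale/=.
  apply: expo_dilate => //; first exact: divr_gt0.
  by rewrite mulrC divfK// gt_eqF.
- transitivity (exponential_prob w0 (A' (i.+1, 0)%N)); first exact: row.
  rewrite -(expoE w0_gt0) /A' /rescale/=.
  apply: expo_dilate => //; first exact: divr_gt0.
  by rewrite mulrC divfK// gt_eqF.
- transitivity (exponential_prob (1 : R) (A' (i.+1, j.+1)%N)); first exact: bulk.
  rewrite -(expoE ltr01) /A' /rescale/=.
  by apply: expo_dilate => //; [exact: mulr1|exact: mA].
Qed.

Lemma weight_ge0 w z k t : 0 < w -> z < 1 -> 0 <= weight w z k t.
Proof.
move=> w_gt0 z_lt1; rewrite /weight mulr_ge0 ?le_max ?lexx ?orbT//.
rewrite /rescale; case: ifP => _; first by rewrite divr_ge0// ltW.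
by case: ifP => // _; rewrite divr_ge0// subr_ge0 ltW.
Qed.

Definition hor (w : R) (m n : nat) (t : T) : R :=
  last_passage (fun k => weight w 0 k t) (1, 0)%N (m, n).

Definition ver (z : R) (m n : nat) (t : T) : R :=
  last_passage (fun k => weight 1 z k t) (0, 1)%N (m, n).

Lemma measurable_hor w m n : (0 < m)%N -> measurable_fun setT (hor w m n).
Proof. by move=> m0; apply: measurable_last_passage => // k; exact: measurable_weight. Qed.

Lemma measurable_ver z m n : (0 < n)%N -> measurable_fun setT (ver z m n).
Proof. by move=> n0; apply: measurable_last_passage => // k; exact: measurable_weight. Qed.

Lemma hor_ge0 w m n t : (0 < m)%N -> 0 < w -> 0 <= hor w m n t.
Proof.
move=> m0 w_gt0; apply: last_passage_ge0 => // k.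
by apply: weight_ge0 => //; exact: ltr01.
Qed.

Lemma last_passage_hor_ver w z m n t : (0 < m)%N -> (0 < n)%N ->
  last_passage (fun k => weight w z k t) (0, 0)%N (m, n) =
  Num.max (hor w m n t) (ver z m n t).
Proof.
case: m n => [//|m] [//|n] _ _; rewrite last_passage_first_step.
have [_ _ _ _ orig] := omegaP.
rewrite {1}/weight orig maxxx mulr0 add0r; congr Num.max.
  by apply: eq_last_passage => // -[[|i] j] //= _ _.
apply: eq_last_passage => // -[i [|j]] //= _ _.
Qed.

Lemma hor_ver_mgf w z m n : (0 < m)%N -> (0 < n)%N -> 0 < w -> w < 1 -> 0 < z -> z < 1 ->
  (\int[P]_t (expR ((w - z) * Num.max (hor w m n t) (ver z m n t)))%:E =
   ((w / z) ^+ m * ((1 - z) / (1 - w)) ^+ n)%:E)%E.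
Proof.
move=> m0 n0 w_gt0 w_lt1 z_gt0 z_lt1.
have w1 : 0 < 1 - w by rewrite subr_gt0.
have z1 : 0 < 1 - z by rewrite subr_gt0.
have [_ _ _ _ orig] := omegaP.
rewrite -(@last_passage_mgf _ _ _ P _ _ w z w_gt0 w1 z_gt0 z1 ltr01 m n _ _ _ _ _
  (joint_law_weight w_gt0 z1))//.
- by apply: eq_integral => t _; rewrite last_passage_hor_ver.
- by move=> k; exact: measurable_weight.
- by move=> t; rewrite /weight orig maxxx mulr0.
Qed.

Lemma hor_compare w w' m n n' t : (0 < m)%N -> 0 < w' -> w' <= w -> (n' <= n)%N ->
  hor w' m n t - hor w' m n' t <= hor w m n t - hor w m n' t.
Proof.
case: m => [//|m] _ w'0 w'w n'n; apply: last_passage_hor_compare => // i.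
rewrite /weight /rescale/= ler_wpM2r ?le_max ?lexx ?orbT//.
rewrite ler_wpM2l//; first exact: ltW.
by rewrite lef_pV2// posrE (lt_le_trans w'0).
Qed.

Lemma omega_ae_ge0 : {ae P, forall t, forall k, (0 < k.1 + k.2)%N ->
  Num.max (omega k t) 0 = omega k t}.
Proof.
have [_ bulk row col orig] := omegaP.
have z0_gt0 : 0 < 1 - z0 by rewrite subr_gt0.
suff H i j : (0 < i + j)%N -> {ae P, forall t, Num.max (omega (i, j) t) 0 = omega (i, j) t}.
  have : {ae P, forall t, forall i, forall j, (0 < i + j)%N ->
      Num.max (omega (i, j) t) 0 = omega (i, j) t}.
    apply: ae_foralln => i; apply: ae_foralln => j.
    have [ij|ij] := boolP (0 < i + j)%N; last by apply: aeW => t.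
    by apply: filterS (H i j ij) => t Ht _.
  by apply: filterS => t Ht [i j]; exact: Ht.
move=> ij; exists (omega (i, j) @^-1` `]-oo, 0[%classic); split.
- exact: measurable_preim.
- have law0 r : 0 < r -> exponential_rv (omega (i, j)) r ->
      P (omega (i, j) @^-1` `]-oo, 0[%classic) = 0%E.
    by move=> r0 E; have := E `]-oo, 0[%classic (measurable_itv _); rewrite -(expoE r0) expo_lt0.
  case: i j ij {law0}(law0) => [|i] [|j]//= _ law0.
  + exact: (law0 _ z0_gt0 (col _ _)).
  + exact: (law0 _ w0_gt0 (row _ _)).
  + exact: (law0 _ ltr01 (bulk _ _ _ _)).
- move=> t /=; rewrite in_itv/=; apply: contra_notT; rewrite -leNgt => ?.
  by rewrite max_l.
Qed.

Lemma G_hor_ae v : (0 < v.1)%N -> {ae P, forall t, G_hor omega v t = hor w0 v.1 v.2 t}.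
Proof.
move=> v1; apply: filterS omega_ae_ge0 => t Ht; rewrite /G_hor /hor -surjective_pairing.
apply: eq_last_passage => // -[[|i] j] //= _ _.
rewrite /weight Ht// /rescale/=; case: ifP => _; last by rewrite mul1r.
by rewrite divff ?mul1r// gt_eqF.
Qed.

End model.

(** * The logarithm and the shape function *)

Import numFieldNormedType.Exports.

Section log_bounds.
Context (R : realType).
Implicit Types (r x y z w t : R).

Lemma ge0_from_derive (f df : R -> R) r : 1 <= r -> f 1 = 0 ->
  (forall x, 1 <= x -> is_derive x 1 f (df x)) -> (forall x, 1 <= x -> 0 <= df x) ->
  0 <= f r.
Proof.
move=> r1 f1 fd df0.
have fd' x : x \in `]1, r[ -> is_derive x 1 f (df x).
  by rewrite in_itv/= => /andP[x1 _]; apply: fd; exact: ltW.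
have fc : {within `[1, r], continuous f}.
  apply: continuous_in_subspaceT => x; rewrite inE/= in_itv/= => /andP[x1 _].
  by have [+ _] := fd x x1; move=> /derivable1_diffP/differentiable_continuous.
have [c cr E] := MVT_segment r1 fd' fc.
move: E; rewrite f1 subr0 => ->; rewrite mulr_ge0 ?subr_ge0//.
by move: cr; rewrite in_itv/= => /andP[c1 _]; exact: df0.
Qed.

(** The trapezoidal rule overestimates the integral of the convex function
    [1 / x]. *)
Lemma ln_le_trapezoid r : 1 <= r -> ln r <= (r - r^-1) / 2.
Proof.
move=> r1; rewrite -subr_ge0.
apply: (@ge0_from_derive (fun x => (x - x^-1) / 2 - ln x)
  (fun x => (1 - x^-1) ^+ 2 / 2)) => //.
- by rewrite ln1 invr1 subrr mul0r subrr.
- move=> x x1; have x0 : 0 < x by exact: lt_le_trans x1.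
  have xN0 : x != 0 by rewrite gt_eqF.
  have dln := is_derive1_ln x0.
  have dV := @is_deriveV R idfun x 1 1 xN0 (is_derive_id x 1).
  have D := is_deriveB (is_deriveM (is_deriveB (is_derive_id x 1) dV)
    (is_derive_cst (2^-1 : R^o) x 1)) dln.
  apply: (is_derive_eq D); rewrite /GRing.scale /= !mulr1 mulr0 add0r.
  by field.
- by move=> x _; rewrite divr_ge0// sqr_ge0.
Qed.

(** The midpoint rule underestimates the same integral. *)
Lemma ln_ge_midpoint r : 1 <= r -> 2 * (r - 1) / (r + 1) <= ln r.
Proof.
move=> r1; rewrite -subr_ge0.
apply: (@ge0_from_derive (fun x => ln x - 2 * (x - 1) / (x + 1))
  (fun x => (x - 1) ^+ 2 / (x * (x + 1) ^+ 2))) => //.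
- by rewrite ln1 subrr mulr0 mul0r subrr.
- move=> x x1; have x0 : 0 < x by exact: lt_le_trans x1.
  have x1N0 : x + 1 != 0 by rewrite gt_eqF// addr_gt0.
  have xN0 : x != 0 by rewrite gt_eqF.
  have dln := is_derive1_ln x0.
  have dp := is_deriveD (is_derive_id x 1) (is_derive_cst (1 : R^o) x 1).
  have dm := is_deriveB (is_derive_id x 1) (is_derive_cst (1 : R^o) x 1).
  have dV := @is_deriveV R (fun x => x + 1) x _ 1 x1N0 dp.
  have D := is_deriveB dln (is_deriveM (is_deriveM (is_derive_cst (2 : R^o) x 1) dm) dV).
  apply: (is_derive_eq D); rewrite /GRing.scale /=.
  rewrite -[(_ * _ : R -> R) x]/(2 * (x - 1)) subr0 addr0 !mulr1 mulr0 addr0.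
  by field; apply/andP.
- by move=> x x1; rewrite divr_ge0// ?sqr_ge0// mulr_ge0 ?sqr_ge0// (le_trans _ x1).
Qed.

End log_bounds.

Section shape.
Context (R : realType).
Implicit Types (x y z w t G r : R).

(** The function [meanM] with its arguments separated. *)
Definition shape x y t := x / t + y / (1 - t).

(** The left-hand side is the integral of the convex function [shape x y]
    from [z] to [w]. *)
Lemma log_mgf_le_trapezoid x y z w : 0 <= x -> 0 <= y -> 0 < z -> z <= w -> w < 1 ->
  x * ln (w / z) + y * ln ((1 - z) / (1 - w)) <= (w - z) / 2 * (shape x y z + shape x y w).
Proof.
move=> x0 y0 z0 zw w1.
have w0 : 0 < w by exact: lt_le_trans zw.
have z1 : 0 < 1 - z by lra.
have w1' : 0 < 1 - w by lra.
have -> : (w - z) / 2 * (shape x y z + shape x y w) =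
    x * ((w / z - (w / z)^-1) / 2) + y * (((1 - z) / (1 - w) - ((1 - z) / (1 - w))^-1) / 2).
  by rewrite /shape; field; rewrite !gt_eqF.
by apply: lerD; apply: ler_wpM2l => //; apply: ln_le_trapezoid; rewrite ler_pdivlMr//; lra.
Qed.

(** The midpoint rule for the integral of [shape x y] from [z] to [w]. *)
Lemma log_mgf_ge_midpoint x y z w : 0 <= x -> 0 <= y -> 0 < z -> z <= w -> w < 1 ->
  (w - z) * shape x y ((z + w) / 2) <= x * ln (w / z) + y * ln ((1 - z) / (1 - w)).
Proof.
move=> x0 y0 z0 zw w1.
have w0 : 0 < w by exact: lt_le_trans zw.
have z1 : 0 < 1 - z by lra.
have w1' : 0 < 1 - w by lra.
have -> : (w - z) * shape x y ((z + w) / 2) =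
    x * (2 * (w / z - 1) / (w / z + 1)) +
    y * (2 * ((1 - z) / (1 - w) - 1) / ((1 - z) / (1 - w) + 1)).
  rewrite /shape; field.
  by rewrite !gt_eqF//; lra.
by apply: lerD; apply: ler_wpM2l => //; apply: ln_ge_midpoint; rewrite ler_pdivlMr//; lra.
Qed.

Lemma log_mgfE (m n : nat) z w : 0 < z -> z < 1 -> 0 < w -> w < 1 ->
  (w / z) ^+ m * ((1 - z) / (1 - w)) ^+ n =
  expR (m%:R * ln (w / z) + n%:R * ln ((1 - z) / (1 - w))).
Proof.
move=> z0 z1 w0 w1; rewrite expRD !expRM_natl !lnK// posrE divr_gt0// subr_gt0//.
Qed.

Section critical.
Variables (G c x y : R).
Hypotheses (G0 : 0 <= G) (c0 : 0 < c) (c1 : c < 1)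
  (xE : x = G * c ^+ 2) (yE : y = G * (1 - c) ^+ 2).

(** For [x = G * c ^ 2] and [y = G * (1 - c) ^ 2] the function [shape x y] is
    minimal at [c], with value [G]. *)
Lemma shape_critical t : 0 < t -> t < 1 ->
  shape x y t = G + G * (c - t) ^+ 2 / (t * (1 - t)).
Proof.
move=> t0 t1; rewrite /shape xE yE; field; rewrite !gt_eqF//; lra.
Qed.

Lemma shape_ge_critical t : 0 < t -> t < 1 -> G + 4 * G * (c - t) ^+ 2 <= shape x y t.
Proof.
move=> t0 t1; rewrite shape_critical// lerD2l ler_pdivlMr; last by rewrite mulr_gt0; lra.
have : t * (1 - t) <= 4^-1 by have := sqr_ge0 (t - 2^-1); nra.
have := mulr_ge0 G0 (sqr_ge0 (c - t)); nra.
Qed.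

Definition shape_gap z w := (c - z) * (c ^+ 2 * (1 - w) + (1 - c) ^+ 2 * w) +
  (c - w) * (c ^+ 2 * (1 - c) + (1 - c) ^+ 2 * c).

Lemma shape_diffE z w : 0 < z -> z < 1 -> 0 < w -> w < 1 ->
  shape x y z - shape x y w = (w - z) * G * shape_gap z w / (z * w * ((1 - z) * (1 - w))).
Proof.
move=> z0 z1 w0 w1; rewrite /shape /shape_gap xE yE; field.
by rewrite !gt_eqF// subr_gt0.
Qed.

Lemma shape_gap_ge0 z w : 0 < w -> w < 1 -> z <= c -> w <= c -> 0 <= shape_gap z w.
Proof.
move=> w0 w1 zc wc; have cp : 0 < c := c0; have cq : c < 1 := c1.
by rewrite /shape_gap addr_ge0// mulr_ge0 ?subr_ge0// ?addr_ge0 ?mulr_ge0 ?sqr_ge0//; lra.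
Qed.

Lemma shape_decr z w : 0 < z -> z <= w -> w <= c -> shape x y w <= shape x y z.
Proof.
move=> z0 zw wc; have cp : 0 < c := c0; have cq : c < 1 := c1.
have w0 : 0 < w by lra. have w1 : w < 1 by lra. have z1 : z < 1 by lra.
rewrite -subr_ge0 shape_diffE//.
have N0 : 0 <= shape_gap z w by apply: shape_gap_ge0 => //; lra.
by rewrite !(mulr_ge0, invr_ge0)//; lra.
Qed.

Lemma shape_diff_le r z w : 0 < r -> r / 2 <= z -> z <= w -> w <= c -> c <= 1 - r ->
  shape x y z - shape x y w <= (w - z) * G * ((c - z) + (c - w)) * (4 / r ^+ 4).
Proof.
move=> r0 rz zw wc cr; have cp : 0 < c := c0; have cq : c < 1 := c1.
have z0 : 0 < z by lra. have w0 : 0 < w by lra.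
have z1 : 0 < 1 - z by lra. have w1 : 0 < 1 - w by lra.
rewrite shape_diffE//; [|lra|lra].
have N0 : 0 <= shape_gap z w by apply: shape_gap_ge0; lra.
have Nle : shape_gap z w <= (c - z) + (c - w).
  have c21 : c ^+ 2 <= 1 by rewrite expr2; nra.
  have c22 : (1 - c) ^+ 2 <= 1 by rewrite expr2; nra.
  have c20 := sqr_ge0 c; have c20' := sqr_ge0 (1 - c).
  rewrite /shape_gap; apply: lerD.
    rewrite -[leRHS]mulr1 ler_wpM2l ?subr_ge0//; first lra.
    by rewrite (le_trans (_ : _ <= (1 - w) + w))//; [apply: lerD; rewrite ler_piMl//; lra|lra].
  rewrite -[leRHS]mulr1 ler_wpM2l ?subr_ge0//.
  by rewrite (le_trans (_ : _ <= (1 - c) + c))//; [apply: lerD; rewrite ler_piMl//; lra|lra].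
have D : r ^+ 4 / 4 <= z * w * ((1 - z) * (1 - w)).
  have -> : r ^+ 4 / 4 = (r / 2 * (r / 2)) * (r * r) by field.
  by apply: ler_pM; rewrite ?mulr_ge0 //; (try lra); apply: ler_pM; lra.
have D0 : 0 < r ^+ 4 / 4 by rewrite divr_gt0// exprn_gt0.
rewrite -[_ / r ^+ 4]invf_div; apply: ler_pM.
- by rewrite !mulr_ge0// subr_ge0.
- by rewrite invr_ge0 ltW// (lt_le_trans D0).
- by rewrite ler_wpM2l// mulr_ge0// subr_ge0.
- by rewrite lef_pV2// posrE// (lt_le_trans D0).
Qed.

End critical.
End shape.

(** * Bounds for expectations *)

Section critical_parameter.
Context (R : realType).

Definition crit (m n : nat) : R := zeta (vec (m, n)).

(** With [G = (sqrt m + sqrt n) ^ 2], the coordinates of the endpoint are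
    [G * c ^ 2] and [G * (1 - c) ^ 2]. *)
Lemma critP (m n : nat) : (0 < m)%N -> (0 < n)%N ->
  [/\ 0 < crit m n, crit m n < 1 & exists G : R,
     [/\ 0 < G, m%:R = G * crit m n ^+ 2 & n%:R = G * (1 - crit m n) ^+ 2]].
Proof.
move=> m0 n0; rewrite /crit /zeta /vec /=.
have a0 : 0 < Num.sqrt (m%:R : R) by rewrite sqrtr_gt0 ltr0n.
have b0 : 0 < Num.sqrt (n%:R : R) by rewrite sqrtr_gt0 ltr0n.
have aE : Num.sqrt (m%:R : R) ^+ 2 = m%:R by rewrite sqr_sqrtr.
have bE : Num.sqrt (n%:R : R) ^+ 2 = n%:R by rewrite sqr_sqrtr.
suff H (a b : R) : 0 < a -> 0 < b -> [/\ 0 < a / (a + b), a / (a + b) < 1 &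
    exists G : R, [/\ 0 < G, a ^+ 2 = G * (a / (a + b)) ^+ 2 &
      b ^+ 2 = G * (1 - a / (a + b)) ^+ 2]].
  by have := H _ _ a0 b0; rewrite aE bE.
move=> {}a0 {}b0.
have ab0 : 0 < a + b by rewrite addr_gt0.
split; first exact: divr_gt0.
  by rewrite ltr_pdivrMr// mul1r ltrDl.
exists ((a + b) ^+ 2); split; first exact: exprn_gt0.
  by field; rewrite gt_eqF.
by field; rewrite gt_eqF.
Qed.

End critical_parameter.

Section expectation_bound.
Context (R : realType) d (T : measurableType d) (P : probability T R).
Implicit Types (f g : T -> R) (a b c : R).

(** A bound for an expectation, together with the measurability and the sign
    that make such bounds additive and monotone. *)
Definition mean_le f c := [/\ measurable_fun setT f, forall t, 0 <= f t &
  (\int[P]_t (f t)%:E <= c%:E)%E].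

Lemma mean_le_dom f g a b : measurable_fun setT f -> (forall t, 0 <= f t <= g t) ->
  a <= b -> mean_le g a -> mean_le f b.
Proof.
move=> mf fg ab [mg g0 ga]; split => //; first by move=> t; case/andP: (fg t).
apply: (@le_trans _ _ a%:E); last by rewrite lee_fin.
apply: le_trans ga; apply: ge0_le_integral => //.
- by move=> t _; rewrite lee_fin; case/andP: (fg t).
- exact/measurable_EFinP.
- exact/measurable_EFinP.
- by move=> t _; rewrite lee_fin; case/andP: (fg t).
Qed.

Lemma mean_le_add f g a b : mean_le f a -> mean_le g b -> mean_le (fun t => f t + g t) (a + b).
Proof.
move=> [mf f0 fa] [mg g0 gb]; split; first exact: measurable_funD.
  by move=> t; rewrite addr_ge0.
under eq_integral do rewrite EFinD.
rewrite ge0_integralD//; last 4 first.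
- by move=> t _; rewrite lee_fin.
- exact/measurable_EFinP.
- by move=> t _; rewrite lee_fin.
- exact/measurable_EFinP.
by rewrite EFinD leeD.
Qed.

Lemma mean_le_scale f a c : 0 <= c -> mean_le f a -> mean_le (fun t => c * f t) (c * a).
Proof.
move=> c0 [mf f0 fa]; split; first exact: measurable_funM.
  by move=> t; rewrite mulr_ge0.
under eq_integral do rewrite EFinM.
rewrite ge0_integralZl//; last 2 first.
- exact/measurable_EFinP.
- by move=> t _; rewrite lee_fin.
by rewrite EFinM lee_wpmul2l.
Qed.

Lemma mean_le_cst a : 0 <= a -> mean_le (cst a) a.
Proof.
move=> a0; split => //=; rewrite -[leRHS]mule1 -(probability_setT P).
by rewrite -integral_cst.
Qed.

Definition pospow (u p : R) : R := Num.max u 0 `^ p.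

Lemma pospow_ge0 u p : 0 <= pospow u p.
Proof. exact: powR_ge0. Qed.

Lemma measurable_pospow f p : measurable_fun setT f ->
  measurable_fun setT (fun t => pospow (f t) p).
Proof.
move=> mf; apply: (measurableT_comp (@measurable_powR R p)).
exact: measurable_maxr.
Qed.

(** From [u <= (p / l) * exp (l * u / p)]. *)
Lemma pospow_le_exp u p l : 0 < l -> 1 <= p ->
  pospow u p <= (p / l) `^ p * expR (l * u).
Proof.
move=> l0 p1; have p0 : 0 < p by lra.
have [u0|u0] := leP u 0.
  rewrite /pospow max_r// powR0 ?gt_eqF//.
  by rewrite mulr_ge0 ?powR_ge0 ?expR_ge0.
have pl0 : 0 <= p / l by apply: divr_ge0; apply: ltW.
have -> : l * u = (l * u / p) * p by field; rewrite gt_eqF.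
rewrite expRM -powRM ?expR_ge0// /pospow max_l; last exact: ltW.
apply: ge0_ler_powR; rewrite ?nnegrE; [exact: ltW|exact: ltW| |].
  by rewrite mulr_ge0// expR_ge0.
rewrite [leLHS](_ : u = p / l * (l * u / p)); last by field; rewrite !gt_eqF.
rewrite ler_wpM2l//.
have := expR_ge1Dx (l * u / p); lra.
Qed.

Lemma powR_add_le4 a b c e p : 0 <= a -> 0 <= b -> 0 <= c -> 0 <= e -> 0 <= p ->
  (a + b + c + e) `^ p <= 4 `^ p * (a `^ p + b `^ p + c `^ p + e `^ p).
Proof.
move=> a0 b0 c0 e0 p0.
set M := Num.max (Num.max a b) (Num.max c e).
have aM : a <= M by rewrite !le_max lexx.
have bM : b <= M by rewrite !le_max lexx !orbT.
have cM : c <= M by rewrite !le_max lexx !orbT.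
have eM : e <= M by rewrite !le_max lexx !orbT.
have M0 : 0 <= M by exact: le_trans aM.
apply: (@le_trans _ _ ((4 * M) `^ p)).
  by apply: ge0_ler_powR; rewrite ?nnegrE ?addr_ge0 ?mulr_ge0//; lra.
rewrite powRM// ler_wpM2l ?powR_ge0//.
have H x : 0 <= x `^ p by exact: powR_ge0.
have Ha := H a; have Hb := H b; have Hc := H c; have He := H e.
rewrite /M; case: (leP (Num.max a b) (Num.max c e)) => _.
  by case: (leP c e) => _; lra.
by case: (leP a b) => _; lra.
Qed.

End expectation_bound.

(** * Moments of the horizontal passage time *)

(** Of the model, only the exponential moment of the maximum, the sign of [hor] and
    the comparison of its vertical increments enter. *)
Section moments.
Context (R : realType) d (T : measurableType d) (P : probability T R).
Variables hor ver : R -> nat -> nat -> T -> R.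
Hypothesis mhor : forall w m n, (0 < m)%N -> measurable_fun setT (hor w m n).
Hypothesis mver : forall z m n, (0 < n)%N -> measurable_fun setT (ver z m n).
Hypothesis hor_ge0 : forall (w : R) m n t, (0 < m)%N -> 0 < w -> 0 <= hor w m n t.
Hypothesis mgf : forall (w z : R) m n, (0 < m)%N -> (0 < n)%N ->
  0 < w -> w < 1 -> 0 < z -> z < 1 ->
  (\int[P]_t (expR ((w - z) * Num.max (hor w m n t) (ver z m n t)))%:E =
   ((w / z) ^+ m * ((1 - z) / (1 - w)) ^+ n)%:E)%E.
Hypothesis compare : forall (w w' : R) m n n' t, (0 < m)%N -> 0 < w' -> w' <= w -> (n' <= n)%N ->
  hor w' m n t - hor w' m n' t <= hor w m n t - hor w m n' t.

Notation crit m n := (crit R m n).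
Notation mu m n w := (shape m%:R n%:R w).
Notation mean_le := (mean_le P).

Variable r : R.
Hypothesis r0 : 0 < r.

Let top w z m n t := Num.max (hor w m n t) (ver z m n t).

Let mtop w z m n : (0 < m)%N -> (0 < n)%N -> measurable_fun setT (top w z m n).
Proof. by move=> m0 n0; apply: measurable_maxr; [exact: mhor|exact: mver]. Qed.

Let measurable_exp (f : T -> R) (a b : R) : measurable_fun setT f ->
  measurable_fun setT (fun t => expR (a * (f t - b))).
Proof.
move=> mf; apply: (measurableT_comp (@measurable_expR R)).
by apply: measurable_funM => //; exact: measurable_funB.
Qed.

Let top_exp (w z : R) m n : (0 < m)%N -> (0 < n)%N -> 0 < w -> w < 1 -> 0 < z -> z < 1 ->
  mean_le (fun t => expR ((w - z) * top w z m n t))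
     (expR (m%:R * ln (w / z) + n%:R * ln ((1 - z) / (1 - w)))).
Proof.
move=> m0 n0 w0 w1 z0 z1; split.
- apply: (measurableT_comp (@measurable_expR R)).
  by apply: measurable_funM => //; exact: mtop.
- by move=> t; exact: expR_ge0.
- by rewrite /top mgf// log_mgfE.
Qed.

Definition chernoff_const : R := 4 / r ^+ 6.

Lemma chernoff_const_ge0 : 0 <= chernoff_const.
Proof. by rewrite divr_ge0// exprn_ge0// ltW. Qed.

Let critical_mass_le (G c : R) (m : nat) : 0 < G -> m%:R = G * c ^+ 2 -> r <= c -> G * (4 / r ^+ 4) <= chernoff_const * m%:R.
Proof.
move=> G0 mE rc.
have cr : r ^+ 2 <= c ^+ 2 by rewrite ler_pXn2r ?nnegrE// ltW//; move: r0; lra.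
rewrite mE /chernoff_const (_ : 4 / r ^+ 6 * (G * c ^+ 2) = G * (4 / r ^+ 4) * (c ^+ 2 / r ^+ 2)).
  rewrite ler_peMr//; first by rewrite mulr_ge0 ?ltW// divr_gt0// exprn_gt0.
  by rewrite ler_pdivlMr ?exprn_gt0// mul1r.
by field; rewrite gt_eqF.
Qed.

Let critical_mass_ge (G c : R) (m : nat) : 0 < G -> m%:R = G * c ^+ 2 -> 0 < c -> c < 1 -> m%:R <= G.
Proof.
move=> G0 -> c0 c1; rewrite ler_piMr//; first exact: ltW.
by rewrite expr2 mulr_ile1// ltW.
Qed.

(** The exponential moment of the maximum with [z = w - l] dominates that of
    [hor w].  By the trapezoidal rule its logarithm exceeds [l * mu w] by at most
    [l / 2 * (mu (w - l) - mu w)], which is of order [l ^ 2 * m * (h + l)] because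
    the derivative of [mu] vanishes at the critical parameter. *)
Lemma hor_exp_upper m n (w l : R) : (0 < m)%N -> (0 < n)%N ->
  r <= w -> w <= crit m n -> crit m n <= 1 - r -> 0 < l -> l <= r / 2 ->
  mean_le (fun t => expR (l * (hor w m n t - mu m n w)))
     (expR (chernoff_const * l ^+ 2 * m%:R * (crit m n - w + l))).
Proof.
move=> m0 n0 rw wz z1 l0 lr; have rp : 0 < r := r0.
have [c0 c1 [G [G0 mE nE]]] := critP R m0 n0.
set c := crit m n in c0 c1 mE nE wz z1 *.
have := @top_exp w (w - l) m n m0 n0; rewrite (_ : w - (w - l) = l); last by ring.
move=> /(_ _ _ _ _)/[dup] _ H.
have {}H : mean_le (fun t => expR (l * top w (w - l) m n t))
     (expR (m%:R * ln (w / (w - l)) + n%:R * ln ((1 - (w - l)) / (1 - w)))).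
  by apply: H; lra.
apply: mean_le_dom (mean_le_scale (expR_ge0 (- (l * mu m n w))) H).
- by apply: measurable_exp; exact: mhor.
- move=> t; rewrite expR_ge0/= -expRD ler_expR mulrBr addrC lerD2l.
  by apply: ler_wpM2l; [exact: ltW|rewrite le_max lexx].
rewrite -expRD ler_expR.
have tr := @log_mgf_le_trapezoid R m%:R n%:R (w - l) w (ler0n _ _) (ler0n _ _)
  ltac:(lra) ltac:(lra) ltac:(lra).
have df := @shape_diff_le R G c m%:R n%:R (ltW G0) c0 c1 mE nE r (w - l) w
  r0 ltac:(lra) ltac:(lra) wz z1.
have GK := critical_mass_le G0 mE (le_trans rw wz).
rewrite (_ : w - (w - l) = l) in tr df; last by ring.
set A := shape _ _ w in tr df *; set B := shape _ _ (w - l) in tr df.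
apply: (@le_trans _ _ (l / 2 * (B - A))).
  apply: (le_trans (lerD (lexx _) tr)); nra.
apply: (@le_trans _ _ (l / 2 * (l * G * (c - (w - l) + (c - w)) * (4 / r ^+ 4)))).
  by rewrite ler_wpM2l// divr_ge0// ltW.
have -> : chernoff_const * l ^+ 2 * m%:R * (c - w + l) = l ^+ 2 * (c - w + l) * (chernoff_const * m%:R) by ring.
apply: (@le_trans _ _ (l ^+ 2 * (c - w + l) * (G * (4 / r ^+ 4)))).
  have -> : l / 2 * (l * G * (c - (w - l) + (c - w)) * (4 / r ^+ 4)) =
    l ^+ 2 * (c - w + l / 2) * (G * (4 / r ^+ 4)) by field; rewrite gt_eqF.
  rewrite ler_wpM2r//; first by rewrite mulr_ge0 ?ltW// divr_gt0// exprn_gt0.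
  by rewrite ler_wpM2l ?sqr_ge0//; lra.
by rewrite ler_wpM2l// mulr_ge0 ?sqr_ge0//; lra.
Qed.

(** The same computation with [z = w + l] and a negative exponent, by the
    midpoint rule. *)
Lemma top_exp_lower m n (w l : R) : (0 < m)%N -> (0 < n)%N ->
  r <= w -> crit m n <= 1 - r -> 0 < l -> l <= crit m n - w ->
  exists G, [/\ 0 < G, m%:R = G * crit m n ^+ 2, n%:R = G * (1 - crit m n) ^+ 2 &
  mean_le (fun t => expR (l * (mu m n w - top w (w + l) m n t)))
     (expR (l ^+ 2 * (crit m n - w) * (G * (4 / r ^+ 4))))].
Proof.
move=> m0 n0 rw z1 l0 lh; have rp : 0 < r := r0.
have [c0 c1 [G [G0 mE nE]]] := critP R m0 n0.
exists G; split => //.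
set c := crit m n in c0 c1 mE nE z1 lh *.
have := @top_exp w (w + l) m n m0 n0; rewrite (_ : w - (w + l) = - l); last by ring.
move=> H.
have {}H : mean_le (fun t => expR (- l * top w (w + l) m n t))
     (expR (m%:R * ln (w / (w + l)) + n%:R * ln ((1 - (w + l)) / (1 - w)))).
  by apply: H; lra.
apply: mean_le_dom (mean_le_scale (expR_ge0 (l * mu m n w)) H).
- apply: (measurableT_comp (@measurable_expR R)).
  by apply: measurable_funM => //; apply: measurable_funB => //; exact: mtop.
- by move=> t; rewrite expR_ge0/= -expRD ler_expR mulrBr mulNr.
rewrite -expRD ler_expR.
have wl1 : 0 < 1 - (w + l) by lra.
have w1 : 0 < 1 - w by lra.
have wl0 : 0 < w + l by lra.
have w0 : 0 < w by lra.
have mid := @log_mgf_ge_midpoint R m%:R n%:R w (w + l) (ler0n _ _) (ler0n _ _)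
  w0 ltac:(lra) ltac:(lra).
have df := @shape_diff_le R G c m%:R n%:R (ltW G0) c0 c1 mE nE r w ((w + (w + l)) / 2)
  r0 ltac:(lra) ltac:(lra) ltac:(lra) z1.
have -> : w / (w + l) = ((w + l) / w)^-1 by rewrite invf_div.
have -> : (1 - (w + l)) / (1 - w) = ((1 - w) / (1 - (w + l)))^-1 by rewrite invf_div.
rewrite !lnV ?posrE ?divr_gt0//.
rewrite (_ : w + l - w = l) in mid; last by ring.
set A := shape _ _ w in df *; set B := shape _ _ _ in mid df.
apply: (@le_trans _ _ (l * (A - B))).
  by move: mid; move: (ln _) (ln _) => u v; rewrite !mulrN; lra.
apply: (le_trans (ler_wpM2l (ltW l0) df)).
have -> : l * (((w + (w + l)) / 2 - w) * G * (c - w + (c - (w + (w + l)) / 2)) * (4 / r ^+ 4)) =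
  l ^+ 2 * (c - w - l / 4) * (G * (4 / r ^+ 4)) by field; rewrite gt_eqF.
rewrite ler_wpM2r//; first by rewrite mulr_ge0 ?ltW// divr_gt0// exprn_gt0.
by rewrite ler_wpM2l ?sqr_ge0//; lra.
Qed.

(** The order of magnitude of a [p]-th moment norm at distance [h] from the
    critical parameter. *)
Definition dev (p h : R) (m : nat) : R := Num.sqrt (p * h * m%:R).
(** The exponential parameter, up to constants, that minimizes Chernoff's bound
    for the [p]-th moment at distance [h]. *)
Definition tilt_unit (p h : R) (m : nat) : R := Num.sqrt (p / (h * m%:R)).

Lemma tilt_unitP (p h : R) (m : nat) : 0 < p -> 0 < h -> (0 < m)%N ->
  [/\ 0 < tilt_unit p h m, tilt_unit p h m ^+ 2 * (h * m%:R) = p &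
      dev p h m = tilt_unit p h m * (h * m%:R)].
Proof.
move=> p0 h0 m0; have M0 : 0 < (m%:R : R) by rewrite ltr0n.
have hM : 0 < h * m%:R by exact: mulr_gt0.
split; first by rewrite sqrtr_gt0 divr_gt0.
  by rewrite /tilt_unit sqr_sqrtr ?divfK ?gt_eqF// divr_ge0// ltW.
have sqE : h * m%:R = Num.sqrt ((h * m%:R) ^+ 2) by rewrite sqrtr_sqr ger0_norm// ltW.
rewrite /dev /tilt_unit [X in _ = _ * X]sqE -sqrtrM; last by rewrite divr_ge0// ltW.
by congr Num.sqrt; field; rewrite !gt_eqF.
Qed.

Lemma tilt_unit_le (p h k : R) (m : nat) : 0 < p -> 0 < h -> (0 < m)%N -> 0 <= k ->
  p <= k ^+ 2 * (h ^+ 3 * m%:R) -> tilt_unit p h m <= k * h.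
Proof.
move=> p0 h0 m0 k0 ph; have [q0 qE _] := tilt_unitP p0 h0 m0.
have M0 : 0 < (m%:R : R) by rewrite ltr0n.
have hM : 0 < h * m%:R by exact: mulr_gt0.
rewrite -(@ler_pXn2r _ 2)// ?nnegrE ?mulr_ge0//; try exact: ltW.
rewrite -(ler_pM2r hM) qE (le_trans ph)//.
by rewrite [leRHS](_ : _ = k ^+ 2 * (h ^+ 3 * m%:R)) //; ring.
Qed.

Lemma dev_gt0 (p h : R) (m : nat) : 0 < p -> 0 < h -> (0 < m)%N -> 0 < dev p h m.
Proof. by move=> p0 h0 m0; rewrite sqrtr_gt0 !mulr_gt0// ltr0n. Qed.

Let moment_algebra (p h c e : R) (m : nat) : 0 < p -> 0 < h -> (0 < m)%N -> 0 < c ->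
  (p / (c * tilt_unit p h m)) `^ p * expR (e * p) = (expR e / c * dev p h m) `^ p.
Proof.
move=> p0 h0 m0 c0; have [q0 qE ->] := tilt_unitP p0 h0 m0.
have hM : 0 < h * m%:R by rewrite mulr_gt0// ltr0n.
rewrite expRM -powRM ?expR_ge0//; last by rewrite divr_ge0 ?mulr_ge0// ltW.
congr (_ `^ p); rewrite -{1}qE; field; rewrite !gt_eqF//.
Qed.

Definition upper_const (k : R) : R :=
  let c := r / (2 * k) in expR (2 * chernoff_const * c ^+ 2) / c.

Lemma upper_const_gt0 (k : R) : 1 <= k -> 0 < upper_const k.
Proof.
by move=> k1; rewrite divr_gt0 ?expR_gt0// divr_gt0//; lra.
Qed.

(** Chernoff's bound with a multiple of [tilt_unit] as parameter.  The relation
    between [p] and [h ^ 3 * m] keeps this parameter below [h], so that the term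
    [h + l] in [hor_exp_upper] stays of order [h]. *)
Lemma hor_upper_moment (k : R) : 1 <= k ->
  forall m n (w p : R), (0 < m)%N -> (0 < n)%N -> r <= w -> w < crit m n -> crit m n <= 1 - r ->
  1 <= p -> p <= k ^+ 2 * ((crit m n - w) ^+ 3 * m%:R) ->
  mean_le (fun t => pospow (hor w m n t - mu m n w) p)
    ((upper_const k * dev p (crit m n - w) m) `^ p).
Proof.
move=> k1 m n w p m0 n0 rw wz z1 p1 pk; have rp : 0 < r := r0.
have k0 : 0 < k by lra.
rewrite /upper_const; set c := r / (2 * k).
have c0 : 0 < c by rewrite divr_gt0// mulr_gt0.
have p0 : 0 < p by lra.
set h := crit m n - w in pk *.
have h0 : 0 < h by rewrite subr_gt0.
have h1 : h <= 1 by rewrite /h; lra.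
have [q0 qE SE] := tilt_unitP p0 h0 m0.
have qh := tilt_unit_le p0 h0 m0 (ltW k0) pk.
set q := tilt_unit p h m in q0 qE SE qh.
have l0 : 0 < c * q by exact: mulr_gt0.
have lh : c * q <= r / 2 * h.
  have -> : r / 2 * h = c * (k * h) by rewrite /c; field; rewrite gt_eqF.
  by rewrite ler_wpM2l// ltW.
have lr : c * q <= r / 2 by rewrite (le_trans lh)// ler_piMr// divr_ge0// ltW.
have r1 : r <= 1 by lra.
have lh' : c * q <= h by nra.
have H := hor_exp_upper m0 n0 rw (ltW wz) z1 l0 lr.
have pl0 : 0 <= (p / (c * q)) `^ p by exact: powR_ge0.
apply: mean_le_dom (mean_le_scale pl0 H).
- by apply: measurable_pospow; apply: measurable_funB => //; exact: mhor.
- by move=> t; rewrite pospow_ge0 pospow_le_exp.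
rewrite -moment_algebra// -/q ler_wpM2l// ler_expR -/h.
have -> : 2 * chernoff_const * c ^+ 2 * p = chernoff_const * (c * q) ^+ 2 * m%:R * (h + h) by rewrite -qE; ring.
rewrite ler_wpM2l//; last lra.
apply: mulr_ge0 => //; apply: mulr_ge0; [exact: chernoff_const_ge0|exact: sqr_ge0].
Qed.

Definition below_tilt : R := r ^+ 4 / 8.
Definition below_const : R := expR (chernoff_const * below_tilt ^+ 2) / below_tilt.

Lemma below_tilt_gt0 : 0 < below_tilt.
Proof. by rewrite divr_gt0// exprn_gt0. Qed.

Lemma below_const_gt0 : 0 < below_const.
Proof. by rewrite divr_gt0 ?expR_gt0 ?below_tilt_gt0. Qed.

(** By the trapezoidal rule the exponential moment with the parameters [c] and
    [w + l] centres [ver (w + l)] at or below the mean of [mu (w + l)] and [mu c].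
    The former is at most [mu w], the latter is [G], and
    [mu w >= G + 4 * G * h ^ 2], so the centre lies by [2 * G * h ^ 2] below
    [mu w]. *)
Lemma ver_exp_upper (G w l : R) m n : (0 < m)%N -> (0 < n)%N -> 0 < G ->
  m%:R = G * crit m n ^+ 2 -> n%:R = G * (1 - crit m n) ^+ 2 ->
  0 < w -> 0 < l -> l <= (crit m n - w) / 8 ->
  mean_le (fun t => expR ((crit m n - (w + l)) *
       (ver (w + l) m n t - (mu m n w - G * (crit m n - w) ^+ 2))))
     (expR (- (l * (m%:R * (crit m n - w) ^+ 2) / 2))).
Proof.
move=> m0 n0 G0 mE nE w0 l0 lh8; have [c0 c1 _] := critP R m0 n0.
have mG := critical_mass_ge G0 mE c0 c1.
set c := crit m n in c0 c1 mE nE lh8 *; set a := mu m n w - _; pose th := c - (w + l).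
have th0 : 0 < th by rewrite /th; lra.
have thl : l <= th by rewrite /th; lra.
have z0 : 0 < w + l by lra.
have z1 : w + l < 1 by lra.
have zc : w + l <= c by lra.
have wz : w <= w + l by lra.
have w1 : w < 1 by lra.
have mz := shape_decr (ltW G0) c0 c1 mE nE w0 wz zc.
have mw := shape_ge_critical (ltW G0) mE nE w0 w1.
have mc : mu m n c = G by rewrite (shape_critical mE nE)// subrr expr0n/= mulr0 mul0r addr0.
have HV := @top_exp c (w + l) m n m0 n0 c0 c1 z0 z1.
apply: mean_le_dom (mean_le_scale (expR_ge0 (- (th * a))) HV).
- by apply: measurable_exp; exact: mver.
- move=> t; rewrite expR_ge0/= -expRD ler_expR -/th mulrBr addrC lerD2l.
  by apply: ler_wpM2l; [exact: ltW|rewrite le_max lexx orbT].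
rewrite -expRD ler_expR.
have tr := @log_mgf_le_trapezoid R m%:R n%:R (w + l) c (ler0n _ _) (ler0n _ _) z0 zc c1.
have E : th * (mu m n (w + l) + mu m n c) / 2 <= th * (a - G * (c - w) ^+ 2).
  rewrite -mulrA; apply: ler_wpM2l; first exact: ltW.
  by rewrite mc /a; lra.
have D0 : 0 <= m%:R * (c - w) ^+ 2 by rewrite mulr_ge0 ?sqr_ge0.
have F : l * (m%:R * (c - w) ^+ 2) <= th * (G * (c - w) ^+ 2).
  by apply: ler_pM => //; [exact: ltW|apply: ler_wpM2r => //; exact: sqr_ge0].
have lD0 : 0 <= l * (m%:R * (c - w) ^+ 2) by apply: mulr_ge0 => //; exact: ltW.
by move: tr; rewrite -/th; lra.
Qed.

(** With [z = w + l] and [l] a small multiple of [tilt_unit], take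
    [Y = (p / l) ^ p * exp (l * (mu w - max (hor w) (ver z)))].  It dominates the
    moment when [ver z <= hor w].  Otherwise the maximum is [ver z], and either
    [ver z] exceeds the level [mu w - G * h ^ 2], unlikely by
    [ver_exp_upper], or the maximum lies by [G * h ^ 2] below [mu w], unlikely by
    [top_exp_lower].  Here [G] is the minimum of [mu]. *)
Lemma hor_lower_split m n (w p : R) :
  (0 < m)%N -> (0 < n)%N -> r <= w -> w < crit m n -> crit m n <= 1 - r ->
  1 <= p -> p <= (crit m n - w) ^+ 3 * m%:R ->
  exists Y B : T -> R,
  [/\ mean_le Y ((below_const * dev p (crit m n - w) m) `^ p),
      mean_le B (2 * expR (- (below_tilt * tilt_unit p (crit m n - w) m * (m%:R * (crit m n - w) ^+ 2) / 2))) &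
      forall t, pospow (mu m n w - hor w m n t) p <= Y t \/ 1 <= B t].
Proof.
move=> m0 n0 rw wz z1 p1 ph; have rp : 0 < r := r0.
have p0 : 0 < p by lra.
have := @top_exp_lower m n w; set c := crit m n in wz z1 ph *.
set h := c - w in ph *.
have h0 : 0 < h by rewrite subr_gt0.
have h1 : h <= 1 by rewrite /h; lra.
have [q0 qE SE] := tilt_unitP p0 h0 m0.
have qh : tilt_unit p h m <= h.
  by rewrite -[leRHS]mul1r; apply: tilt_unit_le => //; rewrite expr1n mul1r.
set q := tilt_unit p h m in q0 qE SE qh *.
have cL0 := below_tilt_gt0.
have r1 : r <= 1 by lra.
have cL8 : below_tilt <= 8^-1.
  by rewrite /below_tilt -[leRHS]mul1r ler_wpM2r ?invr_ge0// exprn_ile1// ltW.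
have l0 : 0 < below_tilt * q by exact: mulr_gt0.
have lq : below_tilt * q <= below_tilt * h by rewrite ler_wpM2l// ltW.
have lh8 : below_tilt * q <= h / 8 by rewrite (le_trans lq)// mulrC ler_wpM2l// ltW.
move=> /(_ (below_tilt * q) m0 n0 rw z1 l0 _)[|G [G0 mE nE H]]; first lra.
have M0 : 0 < (m%:R : R) by rewrite ltr0n.
have c0 : 0 < c by lra.
have c1 : c < 1 by lra.
have mG := critical_mass_ge G0 mE c0 c1.
have GK : G * (4 / r ^+ 4) <= chernoff_const * m%:R by apply: critical_mass_le mE _ => //; lra.
set l := below_tilt * q in l0 lq lh8 H *.
have w0 : 0 < w by exact: lt_le_trans rw.
have D0 : 0 < r ^+ 4 by exact: exprn_gt0.
(* the level that separates the two ways in which the maximum can be attained by [ver] *)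
pose a := mu m n w - G * h ^+ 2.
exists (fun t => (p / l) `^ p * expR (l * (mu m n w - top w (w + l) m n t))).
exists (fun t => expR ((c - (w + l)) * (ver (w + l) m n t - a)) +
   expR (- (l * (G * h ^+ 2))) * expR (l * (mu m n w - top w (w + l) m n t))).
split.
- have pl0 : 0 <= (p / l) `^ p by exact: powR_ge0.
  have [mZ _ _] := mean_le_scale pl0 H.
  apply: mean_le_dom (mean_le_scale pl0 H) => //.
    by move=> t; rewrite lexx mulr_ge0 ?expR_ge0.
  rewrite /below_const -moment_algebra// -/q -/l ler_wpM2l// ler_expR.
  have -> : chernoff_const * below_tilt ^+ 2 * p = l ^+ 2 * h * (chernoff_const * m%:R) by rewrite /l -qE; ring.
  by rewrite ler_wpM2l// mulr_ge0 ?sqr_ge0// ltW.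
- have -> : 2 * expR (- (below_tilt * q * (m%:R * h ^+ 2) / 2)) =
    expR (- (l * (m%:R * h ^+ 2) / 2)) + expR (- (l * (m%:R * h ^+ 2) / 2)).
    by rewrite -/l; ring.
  have mGh : m%:R * h ^+ 2 <= G * h ^+ 2 by rewrite ler_wpM2r// sqr_ge0.
  have Gh0 : 0 <= G * h ^+ 2 by rewrite mulr_ge0 ?sqr_ge0// ltW.
  apply: mean_le_add; last first.
    have [mZ _ _] := mean_le_scale (expR_ge0 (- (l * (G * h ^+ 2)))) H.
    apply: mean_le_dom (mean_le_scale (expR_ge0 (- (l * (G * h ^+ 2)))) H) => //.
      by move=> t; rewrite lexx mulr_ge0 ?expR_ge0.
    rewrite -expRD ler_expR.
    have E : l ^+ 2 * h * (G * (4 / r ^+ 4)) <= l * (G * h ^+ 2) / 2.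
      have -> : l ^+ 2 * h * (G * (4 / r ^+ 4)) = l * (G * h) * (4 / r ^+ 4) * l by ring.
      have -> : l * (G * h ^+ 2) / 2 = l * (G * h) * (4 / r ^+ 4) * (below_tilt * h).
        by rewrite /below_tilt; field; rewrite gt_eqF.
      apply: ler_wpM2l => //; apply: ltW.
      have lG0 : 0 < l * (G * h) by rewrite !mulr_gt0.
      by rewrite mulr_gt0// divr_gt0.
    have F : l * (m%:R * h ^+ 2) <= l * (G * h ^+ 2) by rewrite ler_wpM2l// ltW.
    by rewrite -/h; lra.
  exact: ver_exp_upper G0 mE nE w0 l0 lh8.
- move=> t; have [hv|vh] := leP (ver (w + l) m n t) (hor w m n t).
    by left; rewrite /top (max_l hv); exact: pospow_le_exp.
  right; have [va|va] := leP a (ver (w + l) m n t).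
    rewrite -[leLHS]addr0 lerD// ?mulr_ge0 ?expR_ge0//.
    have th0 : 0 <= c - (w + l) by rewrite /h in lh8; lra.
    by rewrite -[leLHS]expR0 ler_expR mulr_ge0// subr_ge0.
  rewrite -[leLHS]add0r lerD// ?expR_ge0//.
  rewrite -expRD -[leLHS]expR0 ler_expR /top (max_r (ltW vh)).
  have : l * (ver (w + l) m n t) <= l * a by rewrite ler_wpM2l// ltW.
  rewrite /a; lra.
Qed.

Lemma ler_powR_base (a b p : R) : 0 <= p -> 0 <= a -> a <= b -> a `^ p <= b `^ p.
Proof.
by move=> p0 a0 ab; apply: ge0_ler_powR; rewrite ?nnegrE// (le_trans a0).
Qed.

Lemma powR_scale_le (c x p : R) : 1 <= c -> 0 <= x -> 1 <= p -> c * x `^ p <= (c * x) `^ p.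
Proof.
move=> c1 x0 p1; rewrite powRM//; last by lra.
rewrite ler_wpM2r ?powR_ge0// -[leLHS]powRr1; last by lra.
by rewrite ler_powR.
Qed.

Let nE_ratio m n : (0 < m)%N -> (0 < n)%N ->
  (n%:R : R) = m%:R * ((1 - crit m n) / crit m n) ^+ 2.
Proof.
move=> m0 n0; have [c0 c1 [G [G0 mE nE]]] := critP R m0 n0.
by rewrite nE mE; field; rewrite gt_eqF.
Qed.

Let ratio_lt (s t : R) : 0 < s -> s < t -> t <= 1 ->
  ((1 - t) / t) ^+ 2 < ((1 - s) / s) ^+ 2.
Proof.
move=> s0 st t1; have t0 : 0 < t by lra.
rewrite ltr_pXn2r// ?nnegrE ?divr_ge0//; try lra.
by rewrite ltr_pdivrMr// mulrAC ltr_pdivlMr//; lra.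
Qed.

(** The critical parameter of [(m, y)] decreases in [y].  The ordinates whose
    critical parameter lies between [c + H] and [c + 2 * H] form an interval of
    length at least [1], hence contain an integer. *)
Lemma shifted_endpoint m n (H : R) : (0 < m)%N -> (0 < n)%N ->
  2 * r <= crit m n -> 0 < H -> crit m n + 2 * H <= 1 - r -> 1 <= 2 * r * (H * m%:R) ->
  exists n', [/\ (0 < n')%N, (n' <= n)%N, crit m n + H <= crit m n', crit m n' <= crit m n + 2 * H &
    n%:R - n'%:R <= 4 / r ^+ 3 * (H * m%:R)].
Proof.
move=> m0 n0 rc H0 c2 big; have rp : 0 < r := r0.
have [c0 c1 _] := critP R m0 n0.
have nE := nE_ratio m0 n0.
set c := crit m n in rc c2 c0 c1 nE *.
have M0 : 0 < (m%:R : R) by rewrite ltr0n.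
pose s1 := c + H; pose s2 := c + 2 * H.
have s10 : 0 < s1 by rewrite /s1; lra.
have s20 : 0 < s2 by rewrite /s2; lra.
pose U := m%:R * ((1 - s1) / s1) ^+ 2.
pose L := m%:R * ((1 - s2) / s2) ^+ 2.
have L0 : 0 <= L by rewrite mulr_ge0 ?sqr_ge0.
have UL : 1 <= U - L.
  have -> : U - L = H * m%:R * ((s1 + s2 - 2 * s1 * s2) / (s1 ^+ 2 * s2 ^+ 2)).
    rewrite /U /L (_ : H = s2 - s1); last by rewrite /s1 /s2; ring.
    by field; rewrite !gt_eqF.
  apply: (le_trans big); rewrite mulrC ler_wpM2l//; first by rewrite mulr_ge0// ltW.
  have s11 : s1 <= 1 by rewrite /s1; lra.
  have s21 : s2 <= 1 - r by rewrite /s2.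
  have s12 : s1 <= s2 by rewrite /s1 /s2; lra.
  rewrite ler_pdivlMr; last by rewrite mulr_gt0// exprn_gt0.
  have P1 : s1 * s2 <= 1 by nra.
  have P0 : 0 < s1 * s2 by exact: mulr_gt0.
  have -> : s1 ^+ 2 * s2 ^+ 2 = (s1 * s2) ^+ 2 by ring.
  have Q : 2 * r * (s1 * s2) <= s1 + s2 - 2 * s1 * s2.
    have h1 : s1 * r <= s1 * (1 - s2) by rewrite ler_wpM2l ?(ltW s10)//; lra.
    have h2 : s2 * r <= s2 * (1 - s1) by rewrite ler_wpM2l ?(ltW s20)//; lra.
    have h3 : r * (s1 * s2) <= r * s1.
      by rewrite ler_wpM2l ?(ltW rp)// ler_piMr ?(ltW s10)//; lra.
    have h4 : r * (s1 * s2) <= r * s2.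
      by rewrite ler_wpM2l ?(ltW rp)// ler_piMl ?(ltW s20).
    lra.
  apply: le_trans Q; apply: ler_wpM2l; first by rewrite mulr_ge0// ltW.
  by rewrite expr2 ler_piMl// ltW.
have U0 : 0 <= U by lra.
have /andP[nU Un] := truncn_itv U0.
(* the largest ordinate whose critical parameter is at least [c + H] *)
exists (Num.truncn U).
set n' := Num.truncn U in nU Un *.
have n'L : L < n'%:R.
  by rewrite -natr1 in Un; lra.
have n'0 : (0 < n')%N by rewrite -(ltr0n R); lra.
have [d0 d1 _] := critP R m0 n'0.
have n'E := nE_ratio m0 n'0.
set e := crit m n' in d0 d1 n'E *.
have se : s1 <= e.
  rewrite leNgt; apply/negP => es; move: nU; rewrite n'E /U ler_pM2l// leNgt.
  by rewrite ratio_lt// /s1; lra.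
have es : e <= s2.
  rewrite leNgt; apply/negP => es; move: n'L; rewrite n'E /L ltr_pM2l// ltNge.
  by rewrite ltW// ratio_lt//; lra.
split => //.
  rewrite -(ler_nat R) (le_trans nU)// nE /U ler_pM2l// ltW// ratio_lt// /s1; lra.
apply: (@le_trans _ _ (n%:R - L)); first by lra.
have -> : n%:R - L = H * m%:R * (2 * (c + s2 - 2 * c * s2) / (c ^+ 2 * s2 ^+ 2)).
  rewrite nE /L (_ : H = (s2 - c) / 2); last by rewrite /s2; field.
  by field; rewrite !gt_eqF.
rewrite mulrC ler_wpM2r//; first by rewrite mulr_ge0// ltW.
have rs2 : 2 * r <= s2 by rewrite /s2; lra.
have cs : c <= s2 by rewrite /s2; lra.
apply: (@le_trans _ _ (2 * (2 * s2) / (c ^+ 2 * s2 ^+ 2))).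
  apply: ler_wpM2r; first by rewrite invr_ge0 mulr_ge0 ?sqr_ge0.
  apply: ler_wpM2l => //.
  have := mulr_ge0 (ltW c0) (ltW s20); lra.
have -> : 2 * (2 * s2) / (c ^+ 2 * s2 ^+ 2) = 4 / (c ^+ 2 * s2).
  by field; rewrite !gt_eqF.
have pc : 0 < c ^+ 2 * s2 by apply: mulr_gt0 => //; exact: exprn_gt0.
have pr : 0 < r ^+ 3 by exact: exprn_gt0.
rewrite ler_wpM2l// lef_pV2 ?posrE//.
have -> : r ^+ 3 = r ^+ 2 * r by ring.
rewrite ler_pM ?sqr_ge0//; [exact: ltW| |lra].
by rewrite ler_pXn2r ?nnegrE//; lra.
Qed.

Definition shift_const : R := 8 / r ^+ 5.

Lemma shift_const_ge0 : 0 <= shift_const.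
Proof. by rewrite divr_ge0// exprn_ge0// ltW. Qed.

(** With [v' = (m, n')] and [w' = c - 2 * H], monotonicity of the vertical
    increments gives
      [mu v w - hor v w <= (mu v' w - hor v' w) + (mu v w' - hor v w')
         + (hor v' w' - mu v' w') + (n - n') * (1 / (1 - w) - 1 / (1 - w'))],
    and both factors of the last term are of order [H]. *)
Lemma hor_lower_compare m n (w H : R) : (0 < m)%N -> (0 < n)%N ->
  2 * r <= crit m n -> w <= 1 - 2 * r -> w < crit m n -> crit m n - w <= H -> 3 * H <= r ->
  1 <= 2 * r * (H * m%:R) ->
  exists n', [/\ (0 < n')%N, crit m n + H <= crit m n', crit m n' <= crit m n + 2 * H &
    forall p t, 1 <= p ->
    pospow (mu m n w - hor w m n t) p <= 4 `^ p *
     (pospow (mu m n' w - hor w m n' t) p +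
      pospow (mu m n (crit m n - 2 * H) - hor (crit m n - 2 * H) m n t) p +
      pospow (hor (crit m n - 2 * H) m n' t - mu m n' (crit m n - 2 * H)) p +
      (shift_const * (H ^+ 2 * m%:R)) `^ p)].
Proof.
move=> m0 n0 rc wr wc hH Hr big; have rp : 0 < r := r0.
have H0 : 0 < H by lra.
have [|n' [n'0 n'n z1 z2 nn]] := shifted_endpoint m0 n0 rc H0 _ big; first by lra.
exists n'; split => // p t p1.
set w' := crit m n - 2 * H.
have p0 : 0 <= p by lra.
have w'0 : 0 < w' by rewrite /w'; lra.
have w'w : w' <= w by rewrite /w'; lra.
have cmp := compare t m0 w'0 w'w n'n.
have e0 : 0 <= shift_const * (H ^+ 2 * m%:R).
  by apply: mulr_ge0; [exact: shift_const_ge0|rewrite mulr_ge0 ?sqr_ge0].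
have err : (n%:R - n'%:R) * ((1 - w)^-1 - (1 - w')^-1) <= shift_const * (H ^+ 2 * m%:R).
  have w1 : r <= 1 - w by lra.
  have w'1 : r <= 1 - w' by lra.
  have d0 : 0 < 1 - w by lra. have d0' : 0 < 1 - w' by lra.
  have nn0 : 0 <= n%:R - n'%:R :> R by rewrite subr_ge0 ler_nat.
  have -> : (1 - w)^-1 - (1 - w')^-1 = (w - w') / ((1 - w) * (1 - w')).
    by field; rewrite !gt_eqF.
  apply: (@le_trans _ _ (4 / r ^+ 3 * (H * m%:R) * (2 * H / (r * r)))).
    apply: ler_pM => //.
      by rewrite divr_ge0 ?mulr_ge0 ?subr_ge0//; lra.
    apply: ler_pM.
    - by rewrite subr_ge0.
    - by rewrite invr_ge0 mulr_ge0; lra.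
    - by rewrite /w'; lra.
    - rewrite lef_pV2 ?posrE ?mulr_gt0//; apply: ler_pM => //; exact: ltW.
  have -> : 4 / r ^+ 3 * (H * m%:R) * (2 * H / (r * r)) = shift_const * (H ^+ 2 * m%:R).
    by rewrite /shift_const; field; rewrite gt_eqF.
  exact: lexx.
set x1 := mu m n' w - _; set x2 := mu m n w' - _; set y3 := _ - mu m n' w'.
have le : mu m n w - hor w m n t <= x1 + x2 + y3 + shift_const * (H ^+ 2 * m%:R).
  rewrite /x1 /x2 /y3 /shape.
  move: err cmp; rewrite mulrBr !mulrBl; lra.
apply: (@le_trans _ _ ((Num.max x1 0 + Num.max x2 0 + Num.max y3 0 +
    shift_const * (H ^+ 2 * m%:R)) `^ p)).
  have g1 : 0 <= Num.max x1 0 by rewrite le_max lexx orbT.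
  have g2 : 0 <= Num.max x2 0 by rewrite le_max lexx orbT.
  have g3 : 0 <= Num.max y3 0 by rewrite le_max lexx orbT.
  have f1 : x1 <= Num.max x1 0 by rewrite le_max lexx.
  have f2 : x2 <= Num.max x2 0 by rewrite le_max lexx.
  have f3 : y3 <= Num.max y3 0 by rewrite le_max lexx.
  apply: ler_powR_base => //; first by rewrite le_max lexx orbT.
  rewrite ge_max; apply/andP; split; lra.
by apply: powR_add_le4 => //; rewrite le_max lexx orbT.
Qed.

Let mu_le m n (w : R) : (0 < m)%N -> (0 < n)%N -> r <= w -> w < crit m n -> crit m n <= 1 - r ->
  mu m n w <= 2 / r ^+ 3 * m%:R.
Proof.
move=> m0 n0 rw wz z1; have rp : 0 < r := r0.
have [c0 c1 [G [G0 mE nE]]] := critP R m0 n0.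
set c := crit m n in wz z1 c0 c1 mE nE *.
have r3 : 0 < r ^+ 3 by exact: exprn_gt0.
have M0 : 0 <= (m%:R : R) by [].
have n_le : n%:R <= m%:R / r ^+ 2.
  rewrite ler_pdivlMr ?exprn_gt0// mE nE -mulrA ler_wpM2l ?(ltW G0)// -exprMn.
  by rewrite ler_pXn2r ?nnegrE//; nra.
have i1 : w^-1 <= r^-1 by rewrite lef_pV2 ?posrE//; lra.
have i2 : (1 - w)^-1 <= r^-1 by rewrite lef_pV2 ?posrE; lra.
have -> : 2 / r ^+ 3 * m%:R = m%:R / r ^+ 3 + m%:R / r ^+ 2 / r.
  by field; rewrite gt_eqF.
apply: lerD.
  apply: (le_trans (ler_wpM2l M0 i1)); apply: ler_wpM2l => //.
  rewrite lef_pV2 ?posrE// -[leRHS]mulr1 exprS ler_wpM2l ?(ltW rp)//.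
  by rewrite exprn_ile1 ?(ltW rp)//; lra.
by apply: ler_pM => //; rewrite invr_ge0; lra.
Qed.

Let pospow_le_trivial m n (w p : R) t : (0 < m)%N -> (0 < n)%N ->
  r <= w -> w < crit m n -> crit m n <= 1 - r -> 1 <= p ->
  pospow (mu m n w - hor w m n t) p <= (2 / r ^+ 3 * m%:R) `^ p.
Proof.
move=> m0 n0 rw wz z1 p1; have rp : 0 < r := r0.
have w0 : 0 < w by lra.
have := mu_le m0 n0 rw wz z1; have := hor_ge0 n t m0 w0 => hg mg.
apply: ler_powR_base; [lra|by rewrite le_max lexx orbT|].
rewrite ge_max; apply/andP; split; first lra.
by rewrite mulr_ge0// divr_ge0// exprn_ge0// ltW.
Qed.

Let mhor_pospow m n (w a p : R) : (0 < m)%N ->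
  measurable_fun setT (fun t => pospow (a - hor w m n t) p).
Proof.
by move=> m0; apply: measurable_pospow; apply: measurable_funB => //; exact: mhor.
Qed.

(** From [hor w >= 0] and [mu w <= 2 / r ^ 3 * m]. *)
Lemma hor_lower_trivial m n (w p a : R) : (0 < m)%N -> (0 < n)%N ->
  r <= w -> w < crit m n -> crit m n <= 1 - r -> 1 <= p -> 2 / r ^+ 3 * m%:R <= a ->
  mean_le (fun t => pospow (mu m n w - hor w m n t) p) (a `^ p).
Proof.
move=> m0 n0 rw wz z1 p1 ma; have rp : 0 < r := r0.
have M0 : 0 <= 2 / r ^+ 3 * m%:R by rewrite mulr_ge0// divr_ge0// exprn_ge0// ltW.
apply: mean_le_dom (mean_le_cst P (powR_ge0 (2 / r ^+ 3 * m%:R) p)).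
- exact: mhor_pospow.
- by move=> t; rewrite pospow_ge0/=; exact: pospow_le_trivial.
- by apply: ler_powR_base => //; lra.
Qed.

(** On the exceptional event the bound [x <= (eta * x ^ 2 + 1 / eta) / 2]
    plays the part of the Cauchy-Schwarz inequality. *)
Lemma mean_le_split_event (x Y B : T -> R) (a W E : R) : 0 < W ->
  measurable_fun setT x -> (forall t, 0 <= x t) ->
  (forall t, x t <= Y t \/ 1 <= B t) ->
  mean_le Y a -> mean_le (fun t => x t ^+ 2) (W ^+ 2) -> mean_le B (2 * expR (- E)) ->
  mean_le x (a + 3 / 2 * (W * expR (- (E / 2)))).
Proof.
move=> W0 mx x0 YB HY HX HB.
(* gives [eta * W ^ 2] and [eta^-1 * exp (- E)] the common value [W * exp (- E / 2)] *)
pose eta := expR (- (E / 2)) / W.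
have eta0 : 0 < eta by rewrite divr_gt0 ?expR_gt0.
have ei0 : 0 < eta^-1 by rewrite invr_gt0.
have H2i : 0 <= (2 : R)^-1 by [].
have Hsum := mean_le_add HY (mean_le_scale H2i (mean_le_add (mean_le_scale (ltW eta0) HX)
  (mean_le_scale (ltW ei0) HB))).
apply: mean_le_dom Hsum => //.
  move=> t; rewrite x0/=; have [_ Y0 _] := HY; have [_ B0 _] := HB.
  have [le|ge] := YB t.
    have g1 : 0 <= eta * x t ^+ 2 by apply: mulr_ge0; [exact: ltW|exact: sqr_ge0].
    have g2 : 0 <= eta^-1 * B t by apply: mulr_ge0 => //; exact: ltW.
    apply: (le_trans le); lra.
  have : 0 <= eta * (x t - eta^-1) ^+ 2 by rewrite mulr_ge0 ?sqr_ge0 ?(ltW eta0).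
  have -> : eta * (x t - eta^-1) ^+ 2 = eta * x t ^+ 2 - 2 * x t + eta^-1.
    by field; rewrite gt_eqF.
  have : eta^-1 <= eta^-1 * B t by apply: ler_peMr => //; exact: ltW.
  have := Y0 t; lra.
have -> : eta * W ^+ 2 + eta^-1 * (2 * expR (- E)) = 3 * (W * expR (- (E / 2))).
  have -> : expR (- E) = expR (- (E / 2)) ^+ 2.
    by rewrite expr2 -expRD; congr (expR _); field.
  by rewrite /eta; field; rewrite !gt_eqF ?expR_gt0.
by rewrite mulrA [2^-1 * 3]mulrC.
Qed.

Let exp_tail (u : R) : 0 < u -> expR (- u) <= u^-1.
Proof.
move=> u0; rewrite expRN lef_pV2 ?posrE ?expR_gt0//.
by have := expR_ge1Dx u; lra.
Qed.

Let exp_tail2 (u : R) : 0 < u -> expR (- u) <= 4 / u ^+ 2.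
Proof.
move=> u0; have -> : 4 / u ^+ 2 = ((u / 2)^-1) ^+ 2 by field; rewrite gt_eqF.
have -> : - u = 2%:R * - (u / 2) by field.
rewrite expRM_natl ler_pXn2r ?nnegrE ?expR_ge0 ?invr_ge0 ?divr_ge0 ?(ltW u0)//.
by apply: exp_tail; rewrite divr_gt0.
Qed.

Definition base_const : R := 3 * (below_const + 36 / (r ^+ 5 * below_tilt)).

Lemma base_const_ge0 : 0 <= base_const.
Proof.
have rp : 0 < r := r0; have := below_const_gt0.
have : 0 < 36 / (r ^+ 5 * below_tilt) by rewrite divr_gt0// mulr_gt0 ?exprn_gt0 ?below_tilt_gt0.
by rewrite /base_const; lra.
Qed.

(** At distances of order one the exceptional event of [hor_lower_split] has a
    probability exponentially small in [sqrt (p * m)], which brings the trivial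
    bound of order [m ^ p] down to the order [(p * m) ^ (p / 2)]. *)
Lemma hor_lower_base m n (w p : R) : (0 < m)%N -> (0 < n)%N ->
  r <= w -> w < crit m n -> crit m n <= 1 - r -> r / 3 <= crit m n - w ->
  1 <= p -> p <= (crit m n - w) ^+ 3 * m%:R ->
  mean_le (fun t => pospow (mu m n w - hor w m n t) p) ((base_const * dev p (crit m n - w) m) `^ p).
Proof.
move=> m0 n0 rw wz z1 rh p1 ph; have rp : 0 < r := r0.
have [Y [B [HY HB YB]]] := hor_lower_split m0 n0 rw wz z1 p1 ph.
set h := crit m n - w in rh ph HY HB *.
have p0 : 0 < p by lra.
have h0 : 0 < h by lra.
have [q0 qE SE] := tilt_unitP p0 h0 m0.
have S0 := dev_gt0 p0 h0 m0.
set q := tilt_unit p h m in q0 qE SE HB; set S := dev p h m in SE S0 HY *.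
have M0 : 0 < (m%:R : R) by rewrite ltr0n.
have AL0 := below_const_gt0; have cL0 := below_tilt_gt0.
set M := 2 / r ^+ 3 * m%:R.
have Mp : 0 <= M by rewrite mulr_ge0// divr_ge0// exprn_ge0// ltW.
apply: mean_le_dom (mean_le_add HY (mean_le_scale (powR_ge0 M p) HB)).
- exact: mhor_pospow.
- move=> t; rewrite pospow_ge0/=; have [_ Y0 _] := HY; have [_ B0 _] := HB.
  have [le|ge] := YB t.
    by rewrite (le_trans le)// lerDl mulr_ge0 ?powR_ge0.
  apply: (le_trans (pospow_le_trivial t m0 n0 rw wz z1 p1)).
  by rewrite -[leLHS]add0r lerD// ler_peMr ?powR_ge0.
have D0 : 0 < 36 / (r ^+ 5 * below_tilt) by rewrite divr_gt0// mulr_gt0// exprn_gt0.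
have E : - (below_tilt * q * (m%:R * h ^+ 2) / 2) = - (below_tilt * h / (2 * q)) * p.
  by rewrite -qE; field; rewrite gt_eqF.
rewrite E expRM.
have F : M * expR (- (below_tilt * h / (2 * q))) <= 36 / (r ^+ 5 * below_tilt) * S.
  have u0 : 0 < below_tilt * h / (2 * q) by rewrite divr_gt0 ?mulr_gt0.
  apply: (le_trans (ler_wpM2l Mp (exp_tail u0))).
  rewrite /M SE.
  have -> : 2 / r ^+ 3 * m%:R * (below_tilt * h / (2 * q))^-1 =
    q * (h * m%:R) / (r ^+ 3 * below_tilt) * (4 / h ^+ 2) by field; rewrite !gt_eqF.
  have -> : 36 / (r ^+ 5 * below_tilt) * (q * (h * m%:R)) =
    q * (h * m%:R) / (r ^+ 3 * below_tilt) * (4 / (r / 3) ^+ 2) by field; rewrite !gt_eqF.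
  apply: ler_wpM2l.
    by rewrite divr_ge0 ?mulr_ge0 ?exprn_ge0//; apply: ltW.
  rewrite ler_wpM2l// lef_pV2 ?posrE ?exprn_gt0//; last by rewrite divr_gt0.
  by rewrite ler_pXn2r ?nnegrE//; [rewrite divr_ge0// ltW|apply: ltW].
set D := 36 / (r ^+ 5 * below_tilt) in D0 F *.
have G : M `^ p * (2 * expR (- (below_tilt * h / (2 * q))) `^ p) <= 2 * ((below_const + D) * S) `^ p.
  rewrite mulrCA -powRM ?expR_ge0// ler_wpM2l//.
  apply: ler_powR_base; [exact: ltW|by rewrite mulr_ge0 ?expR_ge0|].
  by rewrite (le_trans F)// ler_wpM2r ?(ltW S0)//; lra.
have I : (below_const * S) `^ p <= ((below_const + D) * S) `^ p.
  apply: ler_powR_base; [exact: ltW|by rewrite mulr_ge0// ltW|].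
  by rewrite ler_wpM2r ?(ltW S0)//; lra.
have ADS : 0 <= (below_const + D) * S by rewrite mulr_ge0//; [lra|exact: ltW].
have J := powR_scale_le (c := 3) (x := (below_const + D) * S) (p := p) ltac:(lra) ADS p1.
rewrite /base_const -/D (_ : 3 * (below_const + D) * S = 3 * ((below_const + D) * S)); last by rewrite mulrA.
lra.
Qed.

Lemma mean_le_weaken (f : T -> R) (a b : R) : mean_le f a -> a <= b -> mean_le f b.
Proof. by move=> [mf f0 fa] ab; split => //; rewrite (le_trans fa)// lee_fin. Qed.

(** The four terms of [hor_lower_compare] cost a factor [4 ^ q] when the
    [q]-th power is taken, and another one when the four bounds are added. *)
Lemma hor_lower_compare_moment m n (w H q V : R) : (0 < m)%N -> (0 < n)%N ->
  2 * r <= crit m n -> w <= 1 - 2 * r -> w < crit m n -> crit m n - w <= H -> 3 * H <= r ->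
  1 <= 2 * r * (H * m%:R) -> 1 <= q -> shift_const * (H ^+ 2 * m%:R) <= V ->
  let w' := crit m n - 2 * H in
  mean_le (fun t => pospow (mu m n w' - hor w' m n t) q) (V `^ q) ->
  (forall n', (0 < n')%N -> crit m n + H <= crit m n' -> crit m n' <= crit m n + 2 * H ->
    mean_le (fun t => pospow (mu m n' w - hor w m n' t) q) (V `^ q) /\
    mean_le (fun t => pospow (hor w' m n' t - mu m n' w') q) (V `^ q)) ->
  mean_le (fun t => pospow (mu m n w - hor w m n t) q) ((16 * V) `^ q).
Proof.
move=> m0 n0 rc wr wc hH Hr big q1 eV w' H2 H13; have rp : 0 < r := r0.
have [n' [n'0 z1 z2 cmp]] := hor_lower_compare m0 n0 rc wr wc hH Hr big.
have [H1 H3] := H13 n' n'0 z1 z2.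
have e0 : 0 <= shift_const * (H ^+ 2 * m%:R).
  by apply: mulr_ge0; [exact: shift_const_ge0|rewrite mulr_ge0 ?sqr_ge0].
have V0 : 0 <= V by lra.
have H4 := mean_le_cst P (powR_ge0 (shift_const * (H ^+ 2 * m%:R)) q).
have H5 := mean_le_scale (powR_ge0 4 q) (mean_le_add (mean_le_add (mean_le_add H1 H2) H3) H4).
apply: mean_le_dom H5.
- exact: mhor_pospow.
- by move=> t; rewrite pospow_ge0; exact: cmp.
have E4 : (shift_const * (H ^+ 2 * m%:R)) `^ q <= V `^ q by apply: ler_powR_base => //; lra.
have -> : 16 * V = 4 * (4 * V) by ring.
rewrite [leRHS]powRM// ?mulr_ge0// ler_wpM2l ?powR_ge0//.
have := powR_scale_le (c := 4) ltac:(lra) V0 q1; lra.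
Qed.

(** The induction on scales runs where [h ^ 3 * m >= scale_min ^ 2 * p], that
    is, where [h >= scale_min * tilt_unit p h m].  The summand [r^-1] makes
    the endpoint large enough for [shifted_endpoint], the first summand makes the
    exponential in [step_exp] win. *)
Definition scale_min : R := (96 / below_tilt) ^+ 2 + r^-1 + 2.

Let scale_min_ge : [/\ 2 <= scale_min, r^-1 <= scale_min & (96 / below_tilt) ^+ 2 <= scale_min].
Proof.
have rp : 0 < r^-1 by rewrite invr_gt0.
have cp : 0 < (96 / below_tilt) ^+ 2 by rewrite exprn_gt0// divr_gt0// below_tilt_gt0.
by rewrite /scale_min; split; lra.
Qed.

Let dev_le (a b h h' : R) m : 0 <= a -> 0 < h -> 0 <= h' -> 0 <= b -> (0 < m)%N ->
  forall p, 0 < p -> a * h' <= b ^+ 2 * h -> dev (a * p) h' m <= b * dev p h m.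
Proof.
move=> a0 h0 h'0 b0 m0 p p0 le.
have -> : b * dev p h m = Num.sqrt (b ^+ 2 * (p * h * m%:R)).
  by rewrite sqrtrM ?sqr_ge0// sqrtr_sqr ger0_norm.
rewrite /dev ler_wsqrtr//.
have -> : a * p * h' * m%:R = a * h' * (p * m%:R) by ring.
have -> : b ^+ 2 * (p * h * m%:R) = b ^+ 2 * h * (p * m%:R) by ring.
by rewrite ler_wpM2r// mulr_ge0// ltW.
Qed.

Definition upper_at (C : R) := forall m n (w p : R), (0 < m)%N -> (0 < n)%N ->
  r <= w -> w < crit m n -> crit m n <= 1 - r -> 1 <= p -> p <= (crit m n - w) ^+ 3 * m%:R ->
  mean_le (fun t => pospow (hor w m n t - mu m n w) p) ((C * dev p (crit m n - w) m) `^ p).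

(** The lower bound at all distances between [h0] and [r].  Fixing [h0] and
    leaving the endpoint and [w] free makes it an induction hypothesis that survives
    a change of endpoint. *)
Definition lower_at (C h0 : R) := forall m n (w p : R), (0 < m)%N -> (0 < n)%N ->
  2 * r <= crit m n -> w <= 1 - 2 * r -> h0 <= crit m n - w -> crit m n - w <= r ->
  1 <= p -> scale_min ^+ 2 * p <= (crit m n - w) ^+ 3 * m%:R ->
  mean_le (fun t => pospow (mu m n w - hor w m n t) p) ((C * dev p (crit m n - w) m) `^ p).

(** By [exp (- u) <= 4 / u ^ 2] the left-hand side is at most the first summand of
    [scale_min] divided by [s]. *)
Let step_exp (s : R) : scale_min <= s -> 144 * s * expR (- (below_tilt * s / 4)) <= 1.
Proof.
have [s2 _ sc] := scale_min_ge => ss; have cL0 := below_tilt_gt0.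
have s0' : 0 < s by lra.
have u0 : 0 < below_tilt * s / 4 by rewrite divr_gt0// mulr_gt0.
apply: (@le_trans _ _ (144 * s * (4 / (below_tilt * s / 4) ^+ 2))).
  by rewrite ler_wpM2l ?exp_tail2// mulr_ge0// ltW.
have -> : 144 * s * (4 / (below_tilt * s / 4) ^+ 2) = (96 / below_tilt) ^+ 2 / s.
  by field; rewrite !gt_eqF.
by rewrite ler_pdivrMr// mul1r; lra.
Qed.

Lemma lower_at_le (C h0 h1 : R) : h0 <= h1 -> lower_at C h0 -> lower_at C h1.
Proof.
move=> h01 H m n w p m0 n0 rc wr h1w; apply: H => //; exact: le_trans h1w.
Qed.

(** All moments on the right-hand side of [hor_lower_compare] are taken at
    distances between [g] and [4 * H], where the hypotheses apply; the order of
    magnitude at such a distance is at most twice that at distance [H]. *)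
Lemma hor_lower_shift (C g V H q w : R) m n : (0 < m)%N -> (0 < n)%N ->
  0 < C -> upper_at C -> lower_at C g -> 0 < g -> g <= 2 * H -> g <= H + (crit m n - w) ->
  2 * r <= crit m n -> w <= 1 - 2 * r -> w < crit m n -> crit m n - w <= H -> 3 * H <= r ->
  1 <= 2 * r * (H * m%:R) -> 1 <= q -> scale_min ^+ 2 * q <= g ^+ 3 * m%:R ->
  shift_const * (H ^+ 2 * m%:R) <= V -> C * (2 * dev q H m) <= V ->
  mean_le (fun t => pospow (mu m n w - hor w m n t) q) ((16 * V) `^ q).
Proof.
move=> m0 n0 C0 up low g0 gH gw rc wr wc hH H3r big q1 qg eV dV.
have rp : 0 < r := r0.
have q0 : 0 < q by lra.
have H0 : 0 < H by lra.
have M0 : 0 < (m%:R : R) by rewrite ltr0n.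
have devV h' : 0 <= h' -> h' <= 4 * H -> (C * dev q h' m) `^ q <= V `^ q.
  move=> h'0 h'4.
  apply: ler_powR_base; [exact: ltW|by apply: mulr_ge0; [exact: ltW|exact: sqrtr_ge0]|].
  apply: le_trans dV; apply: ler_wpM2l; first exact: ltW.
  have := @dev_le 1 2 H h' m ler01 H0 h'0 (ler0n R 2) m0 q q0.
  by rewrite !mul1r; apply; rewrite expr2; lra.
have cube h' : g <= h' -> scale_min ^+ 2 * q <= h' ^+ 3 * m%:R.
  move=> gh; apply: (le_trans qg); apply: ler_wpM2r; first exact: ltW.
  by rewrite ler_pXn2r ?nnegrE//; lra.
have cube' h' : g <= h' -> q <= h' ^+ 3 * m%:R.
  move=> /cube; apply: le_trans; rewrite ler_peMl ?(ltW q0)// exprn_ege1//.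
  by have [s2 _ _] := scale_min_ge; lra.
apply: (hor_lower_compare_moment m0 n0 rc wr wc hH H3r big q1 eV).
  set c := crit m n in gw rc wc hH *.
  have hE : c - (c - 2 * H) = 2 * H by ring.
  have low' := low m n (c - 2 * H) q m0 n0 rc; rewrite -/c hE in low'.
  have w'r : c - 2 * H <= 1 - 2 * r by lra.
  have h2r : 2 * H <= r by lra.
  have h2p : 0 <= 2 * H by lra.
  have h24 : 2 * H <= 4 * H by lra.
  exact: mean_le_weaken (low' w'r gH h2r q1 (cube _ gH)) (devV _ h2p h24).
move=> n' n'0; set e := crit m n'; set c := crit m n in gw rc wc hH * => z1 z2; split.
  have e2 : g <= e - w by lra.
  have e3 : e - w <= r by lra.
  have ec : 2 * r <= e by lra.
  have e0 : 0 <= e - w by lra.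
  have e4 : e - w <= 4 * H by lra.
  exact: mean_le_weaken (low m n' w q m0 n'0 ec wr e2 e3 q1 (cube _ e2)) (devV _ e0 e4).
have e2 : g <= e - (c - 2 * H) by lra.
have e4 : e - (c - 2 * H) <= 4 * H by lra.
have e0 : 0 <= e - (c - 2 * H) by lra.
have rw' : r <= c - 2 * H by lra.
have we : c - 2 * H < e by lra.
have er : e <= 1 - r by lra.
exact: mean_le_weaken (up m n' (c - 2 * H) q m0 n'0 rw' we er q1 (cube' _ e2)) (devV _ e0 e4).
Qed.

(** On the scale [h] the lattice is fine enough for [shifted_endpoint]. *)
Lemma scale_not_small (m : nat) (h p : R) : 1 <= p -> 0 < h -> h <= 1 ->
  scale_min ^+ 2 * p <= h ^+ 3 * m%:R -> 1 <= 2 * r * (h * m%:R).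
Proof.
move=> p1 h0 h1 ph; have rp : 0 < r := r0.
have [s2 sr _] := scale_min_ge.
have hm : h ^+ 3 * m%:R <= h * m%:R.
  by rewrite ler_wpM2r// exprS ler_piMr ?(ltW h0)// exprn_ile1 ?(ltW h0).
have sm : scale_min <= h * m%:R.
  apply: le_trans hm; apply: le_trans ph; rewrite expr2 -mulrA ler_peMr; [|lra|].
    by [].
  by rewrite -[leLHS]mulr1; apply: ler_pM; lra.
have rhm : r^-1 <= h * m%:R by lra.
have := ler_wpM2l (ltW rp) rhm; rewrite mulfV ?gt_eqF//; lra.
Qed.

(** At distance [h], with [s = h / tilt_unit p h m], the moment of order [2 * p]
    is known up to the factor [s] from the doubled distance; the exceptional event of
    [hor_lower_split] has probability of order [exp (- below_tilt * s * p / 2)], and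
    [mean_le_split_event] lets the exponential absorb the factor.  The constant [C]
    is thus reproduced, which is what an induction over all scales requires. *)
Lemma hor_lower_step (C h0 : R) : 0 < C -> shift_const <= C -> 2 * below_const <= C -> base_const <= C ->
  upper_at C -> 0 < h0 -> lower_at C (2 * h0) -> lower_at C h0.
Proof.
move=> C0 CC3 CAL CCB up h00 IH m n w p m0 n0 rc wr hh hr p1 pk.
have rp : 0 < r := r0.
set c := crit m n in rc hh hr pk *; set h := c - w in hh hr pk *.
have cE : c = w + h by rewrite /h; ring.
have h0' : 0 < h by lra.
have wc : w < c by lra.
have rw : r <= w by lra.
have c1 : c <= 1 - r by lra.
have h1 : h <= 1 by lra.
have p0 : 0 < p by lra.
have [s2 _ _] := scale_min_ge.
have s01 : 1 <= scale_min ^+ 2 by rewrite exprn_ege1//; lra.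
have pk' : p <= h ^+ 3 * m%:R by apply: le_trans pk; rewrite ler_peMl// ltW.
have S0 := dev_gt0 p0 h0' m0.
have [hr3|hr3] := leP (r / 3) h.
  apply: mean_le_weaken (hor_lower_base m0 n0 rw wc c1 hr3 p1 pk') _.
  apply: ler_powR_base; [exact: ltW| |by apply: ler_wpM2r => //; exact: ltW].
  by apply: mulr_ge0; [exact: base_const_ge0|exact: ltW].
have [q0 qE SE] := tilt_unitP p0 h0' m0.
have [Y [B [HY HB YB]]] := hor_lower_split m0 n0 rw wc c1 p1 pk'.
have M0 : 0 < (m%:R : R) by rewrite ltr0n.
have big := scale_not_small p1 h0' h1 pk.
set q := tilt_unit p h m in q0 qE SE HB; set S := dev p h m in SE S0 HY *.
pose s := h / q.
have ss : scale_min <= s.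
  rewrite /s ler_pdivlMr// -(@ler_pXn2r _ 2)// ?nnegrE; [|rewrite mulr_ge0// ?(ltW q0)//; lra|exact: ltW].
  rewrite -(ler_pM2r (mulr_gt0 h0' M0)) exprMn -mulrA qE (le_trans pk)//.
  by rewrite [leRHS](_ : _ = h ^+ 3 * m%:R)//; ring.
have s1 : 1 <= s by apply: le_trans ss; lra.
have sp : 0 < s by exact: lt_le_trans s1.
have hs : h = s * q by rewrite /s divfK// gt_eqF.
have CS0 : 0 < C * S by exact: mulr_gt0.
(* bounds the moment norm of order [2 * p], with the loss [s] to be made up for *)
pose V := 3 * (C * S) * s.
have V0 : 0 < V by apply: mulr_gt0 => //; exact: mulr_gt0.
have CSV : 3 * (C * S) <= V by rewrite /V ler_peMr// mulr_ge0// ltW.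
have X2 : mean_le (fun t => pospow (mu m n w - hor w m n t) (2 * p)) ((16 * V) `^ (2 * p)).
  have IH' : lower_at C (2 * h) by apply: lower_at_le IH; rewrite ler_pM2l.
  have h20 : 0 < 2 * h by exact: mulr_gt0.
  apply: (hor_lower_shift m0 n0 C0 up IH') => //.
  - by rewrite -/c -/h mulrDl mul1r.
  - by rewrite mulrC -ler_pdivlMr// ltW.
  - by apply: (le_trans p1); rewrite ler_peMl ?ler1n// ltW.
  - have := ler_wpM2l (ler0n R 2) pk; rewrite mulrCA => le; apply: (le_trans le).
    rewrite exprMn -[leRHS]mulrA; apply: ler_wpM2r; last by rewrite -natrX ler_nat.
    by rewrite mulr_ge0 ?exprn_ge0// ltW.
  - have -> : h ^+ 2 * m%:R = S * s by rewrite SE {1}hs /s; field; rewrite gt_eqF.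
    have le : shift_const * (S * s) <= C * (S * s).
      by apply: ler_wpM2r => //; rewrite mulr_ge0// ltW.
    apply: (le_trans le); have -> : V = 3 * (C * (S * s)) by rewrite /V; ring.
    by rewrite ler_peMl ?ler1n//; apply/ltW; apply: mulr_gt0 => //; exact: mulr_gt0.
  - apply: le_trans CSV; rewrite [leRHS]mulrCA; apply: ler_wpM2l; first exact: ltW.
    have h2 : 2 * h <= (3 / 2) ^+ 2 * h.
      by apply: ler_wpM2r; [exact: ltW|rewrite expr2; lra].
    have d0 : 0 <= (3 / 2 : R) by [].
    have := dev_le (ler0n R 2) h0' (ltW h0') d0 m0 p0 h2; rewrite -/S.
    by move=> /(ler_wpM2l (ler0n R 2)); rewrite mulrA (_ : 2 * (3 / 2) = 3 :> R)//; field.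
pose W := (16 * V) `^ p.
have W0 : 0 < W by rewrite powR_gt0// mulr_gt0.
pose E := below_tilt * s / 2 * p.
have HBE : mean_le B (2 * expR (- E)).
  apply: mean_le_weaken HB _; rewrite ler_wpM2l// ler_expR lerN2.
  rewrite (_ : E = below_tilt * q * (m%:R * h ^+ 2) / 2)// /E -[X in _ * X = _]qE hs.
  by field.
have pow2 u : pospow u (2 * p) = pospow u p ^+ 2.
  by rewrite /pospow [2 * p]mulrC powRrM powR_mulrn ?powR_ge0.
have XW : (16 * V) `^ (2 * p) = W ^+ 2.
  by rewrite /W [2 * p]mulrC powRrM powR_mulrn ?powR_ge0.
have {}X2 : mean_le (fun t => pospow (mu m n w - hor w m n t) p ^+ 2) (W ^+ 2).
  by rewrite -XW; under eq_fun do rewrite -pow2.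
apply: mean_le_weaken (mean_le_split_event W0 (mhor_pospow _ _ _ _ m0) _ YB HY X2 HBE) _.
  by move=> t; exact: pospow_ge0.
have F : W * expR (- (E / 2)) <= (C * S / 3) `^ p.
  have -> : - (E / 2) = - (below_tilt * s / 4) * p by rewrite /E; field.
  rewrite expRM /W -powRM ?expR_ge0//; last by rewrite mulr_ge0// ltW.
  apply: ler_powR_base; [exact: ltW| |].
    by rewrite mulr_ge0 ?expR_ge0// mulr_ge0// ltW.
  have := step_exp ss; rewrite /V => le.
  have -> : 16 * (3 * (C * S) * s) * expR (- (below_tilt * s / 4)) =
    C * S / 3 * (144 * s * expR (- (below_tilt * s / 4))) by field.
  by rewrite ler_piMr// divr_ge0// ltW.
have F3 : 3 * (C * S / 3) `^ p <= (C * S) `^ p.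
  have := powR_scale_le (c := 3) (x := C * S / 3) (p := p) (ler1n R 3) _ p1.
  rewrite [3 * (C * S / 3)](_ : _ = C * S); last by field.
  by apply; rewrite divr_ge0// ltW.
have F2 : 2 * (below_const * S) `^ p <= (C * S) `^ p.
  have ALS : 0 <= below_const * S by apply: mulr_ge0; [exact: ltW below_const_gt0|exact: ltW].
  apply: (le_trans (powR_scale_le (c := 2) (ler1n R 2) ALS p1)).
  apply: ler_powR_base; [exact: ltW|by rewrite mulr_ge0|].
  by rewrite mulrA ler_wpM2r// ltW.
lra.
Qed.

Definition lower_main_const : R := upper_const 1 + shift_const + 2 * below_const + base_const + 1.

Lemma lower_main_const_gt0 : 0 < lower_main_const.
Proof.
have := upper_const_gt0 (lexx 1); have := below_const_gt0; have := shift_const_ge0; have := base_const_ge0.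
by rewrite /lower_main_const; lra.
Qed.

(** Doubling a positive distance leads beyond [r], where [lower_at] is empty. *)
Lemma hor_lower_main : [/\ 0 < lower_main_const, shift_const <= lower_main_const,
  upper_at lower_main_const, base_const <= lower_main_const &
  forall h0, 0 < h0 -> lower_at lower_main_const h0].
Proof.
rewrite /lower_main_const.
move: (upper_const 1) (upper_const_gt0 (lexx 1)) (hor_upper_moment (lexx 1)) => A A0 HA.
set C := A + _ + _ + _ + _.
have AL0 := below_const_gt0; have C30 := shift_const_ge0; have CB0 := base_const_ge0.
have C0 : 0 < C by rewrite /C; lra.
have AC : A <= C by rewrite /C; lra.
have CC3 : shift_const <= C by rewrite /C; lra.
have CCB : base_const <= C by rewrite /C; lra.
have CAL : 2 * below_const <= C by rewrite /C; lra.
have up : upper_at C.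
  move=> m n w p m0 n0 rw wc c1 p1 pk.
  apply: mean_le_weaken (HA m n w p m0 n0 rw wc c1 p1 _) _.
    by rewrite expr1n mul1r.
  apply: ler_powR_base; [exact: le_trans ler01 p1|by apply: mulr_ge0; [exact: ltW|exact: sqrtr_ge0]|].
  by apply: ler_wpM2r; [exact: sqrtr_ge0|].
split => //.
move=> h0 h00.
have [j hj] : exists j : nat, r < 2 ^+ j * h0.
  exists (Num.truncn (r / h0)).+1; rewrite -ltr_pdivrMr//.
  have r0' : 0 <= r / h0 by rewrite divr_ge0// ltW.
  have /andP[_ lt] := truncn_itv r0'; apply: (lt_le_trans lt).
  by rewrite -natrX ler_nat ltnW// ltn_expl.
elim: j h0 h00 hj => [|j IHj] h0 h00 hj.
  move=> m n w p _ _ _ _ h1 h2 _ _; move: hj; rewrite expr0 mul1r ltNge.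
  by rewrite (le_trans h1 h2).
apply: hor_lower_step => //.
by apply: IHj; [rewrite mulr_gt0|rewrite mulrA -exprSr].
Qed.

Definition sparse_const (k : R) : R := 2 / r ^+ 3 * (k / ((r / 3) ^+ 3 / scale_min ^+ 2)).

(** If [p] is at least a multiple of [m], then [h] is bounded below and the
    trivial bound is of the right order. *)
Lemma hor_lower_sparse (k : R) m n (w p : R) : 1 <= k -> (0 < m)%N -> (0 < n)%N ->
  r <= w -> w < crit m n -> crit m n <= 1 - r -> 1 <= p ->
  p <= k * ((crit m n - w) ^+ 3 * m%:R) -> (r / 3) ^+ 3 * m%:R <= scale_min ^+ 2 * p ->
  mean_le (fun t => pospow (mu m n w - hor w m n t) p)
    ((sparse_const k * dev p (crit m n - w) m) `^ p).
Proof.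
move=> k1 m0 n0 rw wc c1 p1 pk pc; have rp : 0 < r := r0.
have k0 : 0 < k by exact: lt_le_trans k1.
have sp : 0 < scale_min by have [s2 _ _] := scale_min_ge; exact: lt_le_trans s2.
rewrite /sparse_const; set cc := (r / 3) ^+ 3 / scale_min ^+ 2.
have cc0 : 0 < cc by rewrite divr_gt0 ?exprn_gt0 ?divr_gt0.
have {}pc : cc * m%:R <= p.
  by rewrite /cc mulrAC ler_pdivrMr ?exprn_gt0// mulrC [leRHS]mulrC mulrC.
apply: (hor_lower_trivial m0 n0 rw wc c1 p1); clearbody cc.
set h := crit m n - w in pk *.
have h0 : 0 < h by rewrite subr_gt0.
have h1 : h <= 1 by rewrite /h; lra.
have M0 : 0 < (m%:R : R) by rewrite ltr0n.
have h3 : h ^+ 3 <= h.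
  by rewrite exprS ler_piMr ?(ltW h0)// exprn_ile1 ?(ltW h0).
have ck : cc / k <= h.
  apply: le_trans h3; rewrite ler_pdivrMr// -(ler_pM2r M0) [h ^+ 3 * k]mulrC -mulrA.
  exact: le_trans pc pk.
have cck : 0 <= cc / k by rewrite divr_ge0// ltW.
have ccm : 0 <= cc / k * m%:R by rewrite mulr_ge0.
have mS : cc / k * m%:R <= dev p h m.
  rewrite /dev -[leLHS]ger0_norm// -sqrtr_sqr ler_wsqrtr//.
  have -> : (cc / k * m%:R) ^+ 2 = (cc * m%:R) * (cc / k) * m%:R / k.
    by field; rewrite gt_eqF.
  rewrite ler_pdivrMr//; apply: (@le_trans _ _ (p * h * m%:R)).
    apply: ler_wpM2r => //; apply: ler_pM => //.
    by rewrite mulr_ge0// ltW.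
  have ph0 : 0 <= p * h by apply: mulr_ge0; [exact: le_trans ler01 p1|exact: ltW].
  by rewrite ler_peMr// mulr_ge0.
have -> : 2 / r ^+ 3 * m%:R = 2 / r ^+ 3 * (k / cc) * (cc / k * m%:R).
  by field; rewrite !gt_eqF.
apply: ler_wpM2l => //.
by rewrite mulr_ge0 ?divr_ge0 ?exprn_ge0// ltW.
Qed.

Definition gap_const (k : R) : R := 16 * (lower_main_const * scale_min * (scale_min ^+ 2 * k)).

(** If [h ^ 3 * m] lies between [p / k] and [scale_min ^ 2 * p], comparison with
    the distance [H] for which [H ^ 3 * m = scale_min ^ 2 * p] costs a factor that
    depends on [k] alone. *)
Lemma hor_lower_gap (k : R) m n (w p : R) : 1 <= k -> (0 < m)%N -> (0 < n)%N ->
  2 * r <= crit m n -> w <= 1 - 2 * r -> w < crit m n -> 1 <= p ->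
  p <= k * ((crit m n - w) ^+ 3 * m%:R) -> (crit m n - w) ^+ 3 * m%:R <= scale_min ^+ 2 * p ->
  scale_min ^+ 2 * p <= (r / 3) ^+ 3 * m%:R ->
  mean_le (fun t => pospow (mu m n w - hor w m n t) p)
    ((gap_const k * dev p (crit m n - w) m) `^ p).
Proof.
move=> k1 m0 n0 rc wr wc p1 pk Lp pc; have rp : 0 < r := r0.
rewrite /gap_const; move: lower_main_const hor_lower_main => C [C0 C3C up _ low].
have k0 : 0 < k by exact: lt_le_trans k1.
have p0 : 0 < p by exact: lt_le_trans p1.
have [s2 _ _] := scale_min_ge.
have sp : 0 < scale_min by exact: lt_le_trans s2.
have s1 : 1 <= scale_min by lra.
set h := crit m n - w in pk Lp *.
have h0 : 0 < h by rewrite subr_gt0.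
have M0 : 0 < (m%:R : R) by rewrite ltr0n.
have L0 : 0 < scale_min ^+ 2 by exact: exprn_gt0.
have X0 : 0 < scale_min ^+ 2 * p / m%:R by rewrite divr_gt0// mulr_gt0.
(* the least distance to which [hor_lower_main] applies *)
pose H := (scale_min ^+ 2 * p / m%:R) `^ 3^-1.
have H0 : 0 < H by exact: powR_gt0.
have H3 : H ^+ 3 * m%:R = scale_min ^+ 2 * p.
  rewrite -powR_mulrn ?powR_ge0// -powRrM mulVf ?pnatr_eq0// powRr1 ?(ltW X0)//.
  by rewrite divfK// gt_eqF.
clearbody H.
have cube_le (a b : R) : 0 <= a -> 0 <= b -> a ^+ 3 * m%:R <= b ^+ 3 * m%:R -> a <= b.
  by move=> a0 b0; rewrite ler_pM2r// ler_pXn2r.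
have hH : h <= H by apply: cube_le; [exact: ltW|exact: ltW|rewrite H3].
have Hr : H <= r / 3.
  by apply: cube_le; [exact: ltW|by rewrite divr_ge0// ltW|rewrite H3].
have H3r : 3 * H <= r by rewrite mulrC -ler_pdivlMr.
have c1 : crit m n < 1 by have [_ ? _] := critP R m0 n0.
have H1 : H <= 1 by lra.
have Lk1 : 1 <= scale_min ^+ 2 * k by rewrite -[leLHS]mulr1 ler_pM// exprn_ege1.
have Lk0 : 0 < scale_min ^+ 2 * k by exact: mulr_gt0.
have HLk : H <= scale_min ^+ 2 * k * h.
  apply: cube_le; [exact: ltW|by rewrite mulr_ge0// ltW|].
  rewrite H3 exprMn -[leRHS]mulrA; apply: (@le_trans _ _ (scale_min ^+ 2 * k * (h ^+ 3 * m%:R))).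
    by rewrite -mulrA; apply: ler_wpM2l => //; exact: ltW.
  apply: ler_wpM2r; first by rewrite mulr_ge0 ?exprn_ge0// ltW.
  exact: ler_eXnr.
have SH0 := dev_gt0 p0 H0 m0; set SH := dev p H m in SH0.
move: (scale_min ^+ 2 * k) Lk1 Lk0 HLk => Lk Lk1 Lk0 HLk.
have SHS : SH <= Lk * dev p h m.
  have := @dev_le 1 Lk h H m ler01 h0 (ltW H0) (ltW Lk0) m0 p p0.
  rewrite !mul1r; apply; rewrite expr2 -mulrA; apply: (le_trans HLk).
  by rewrite ler_peMl//; apply: mulr_ge0; exact: ltW.
have big : 1 <= 2 * r * (H * m%:R) by apply: (scale_not_small p1 H0 H1); rewrite H3.
pose V := C * scale_min * SH.
have Cs0 : 0 < C * scale_min by exact: mulr_gt0.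
have V0 : 0 < V by exact: mulr_gt0.
have eV : shift_const * (H ^+ 2 * m%:R) <= V.
  have HS : H ^+ 2 * m%:R = scale_min * SH.
    have [q0 qE SE] := tilt_unitP p0 H0 m0; rewrite /SH SE; set q := tilt_unit p H m in q0 qE SE *.
    have E : H = scale_min * q.
      apply/eqP; rewrite -(eqrXn2 (n := 2))//; [|exact: ltW|by rewrite mulr_ge0// ltW].
      apply/eqP; apply: (@mulIf _ (H * m%:R)); first by rewrite mulf_neq0// gt_eqF.
      by rewrite exprMn -[RHS]mulrA qE -H3; ring.
    by transitivity (scale_min * q * (H * m%:R)); [rewrite -E; ring|ring].
  by rewrite HS /V mulrA; apply: ler_wpM2r; [exact: ltW|apply: ler_wpM2r => //; exact: ltW].
have dV : C * (2 * dev p H m) <= V.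
  by rewrite /V -mulrA; apply: ler_wpM2l; [exact: ltW|apply: ler_wpM2r => //; exact: ltW].
have X : mean_le (fun t => pospow (mu m n w - hor w m n t) p) ((16 * V) `^ p).
  apply: (@hor_lower_shift C H V H p w m n m0 n0 C0 up (low H H0)) => //; rewrite ?H3//.
    by rewrite ler_peMl ?(ltW H0)// ler1n.
  by rewrite lerDl ltW.
apply: mean_le_weaken X _; apply: ler_powR_base; [exact: ltW|by rewrite mulr_ge0// ltW|].
rewrite /V -[leRHS]mulrA ler_wpM2l// -[leRHS]mulrA.
by apply: ler_wpM2l => //; exact: ltW.
Qed.

Definition lower_const (k : R) : R := lower_main_const + sparse_const k + gap_const k.

Lemma lower_const_ge (k : R) : 1 <= k -> [/\ 0 < lower_main_const,
  lower_main_const <= lower_const k, 0 < sparse_const k, sparse_const k <= lower_const k &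
  0 < gap_const k /\ gap_const k <= lower_const k].
Proof.
move=> k1; have rp : 0 < r := r0; have k0 : 0 < k by exact: lt_le_trans k1.
have sp : 0 < scale_min by have [s2 _ _] := scale_min_ge; exact: lt_le_trans s2.
have C0 := lower_main_const_gt0.
have t1 : 0 < sparse_const k.
  by rewrite mulr_gt0 ?divr_gt0 ?exprn_gt0 ?divr_gt0.
have t2 : 0 < gap_const k.
  by apply: mulr_gt0 => //; apply: mulr_gt0; [exact: mulr_gt0|rewrite mulr_gt0 ?exprn_gt0].
by rewrite /lower_const; split; [..|split]; lra.
Qed.

Lemma lower_const_gt0 (k : R) : 1 <= k -> 0 < lower_const k.
Proof. by move=> /lower_const_ge[C0 CC _ _ _]; exact: lt_le_trans CC. Qed.

Lemma hor_lower_moment (k : R) m n (w p : R) : 1 <= k -> (0 < m)%N -> (0 < n)%N ->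
  2 * r <= crit m n -> crit m n <= 1 - 2 * r -> r <= w -> w < crit m n ->
  1 <= p -> p <= k * ((crit m n - w) ^+ 3 * m%:R) ->
  mean_le (fun t => pospow (mu m n w - hor w m n t) p) ((lower_const k * dev p (crit m n - w) m) `^ p).
Proof.
move=> k1 m0 n0 rc c2 rw wc p1 pk; have rp : 0 < r := r0.
have [Cm0 CmC Cs0 CsC [Cg0 CgC]] := lower_const_ge k1.
have p0 : 0 < p by exact: lt_le_trans p1.
have c1 : crit m n <= 1 - r by lra.
have wr : w <= 1 - 2 * r by lra.
have d0 : 0 <= dev p (crit m n - w) m by exact: sqrtr_ge0.
have CS (C' : R) : 0 < C' -> C' <= lower_const k ->
    (C' * dev p (crit m n - w) m) `^ p <= (lower_const k * dev p (crit m n - w) m) `^ p.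
  move=> C'0 C'C; apply: ler_powR_base; [exact: ltW|by rewrite mulr_ge0// ltW|].
  exact: ler_wpM2r.
have [Lp|Lp] := leP (scale_min ^+ 2 * p) ((crit m n - w) ^+ 3 * m%:R).
  have [_ _ _ CBC low] := hor_lower_main.
  have h0 : 0 < crit m n - w by rewrite subr_gt0.
  have [hr|hr] := leP (crit m n - w) r.
    exact: mean_le_weaken (low _ h0 m n w p m0 n0 rc wr (lexx _) hr p1 Lp) (CS _ Cm0 CmC).
  have hr3 : r / 3 <= crit m n - w by lra.
  have pk' : p <= (crit m n - w) ^+ 3 * m%:R.
    apply: le_trans Lp; rewrite ler_peMl ?(ltW p0)// exprn_ege1//.
    by have [s2 _ _] := scale_min_ge; lra.
  apply: mean_le_weaken (hor_lower_base m0 n0 rw wc c1 hr3 p1 pk') _.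
  apply: le_trans (CS _ Cm0 CmC).
  apply: ler_powR_base; [exact: ltW| |exact: ler_wpM2r].
  by apply: mulr_ge0 => //; exact: base_const_ge0.
have [pc|pc] := leP ((r / 3) ^+ 3 * m%:R) (scale_min ^+ 2 * p).
  exact: mean_le_weaken (hor_lower_sparse k1 m0 n0 rw wc c1 p1 pk pc) (CS _ Cs0 CsC).
exact: mean_le_weaken (hor_lower_gap k1 m0 n0 rc wr wc p1 pk (ltW Lp) (ltW pc)) (CS _ Cg0 CgC).
Qed.

(** The bound of the theorem is the [p]-th power of a length. *)
Lemma powR_scale (C p b : R) : 0 <= C -> 0 <= p -> 0 <= b ->
  (C * Num.sqrt (p * b)) `^ p = C `^ p * p `^ (p / 2) * b `^ (p / 2).
Proof.
move=> C0 p0 b0; rewrite powRM ?sqrtr_ge0// sqrtrM// powRM ?sqrtr_ge0// mulrA.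
by rewrite -!powR12_sqrt// -!powRrM !(mulrC 2^-1).
Qed.

Lemma two_sided_moment m n (w p a : R) : (0 < m)%N -> 1 <= p -> 0 <= a ->
  mean_le (fun t => pospow (hor w m n t - mu m n w) p) (a `^ p) ->
  mean_le (fun t => pospow (mu m n w - hor w m n t) p) (a `^ p) ->
  mean_le (fun t => `|hor w m n t - mu m n w| `^ p) ((2 * a) `^ p).
Proof.
move=> m0 p1 a0 up low; apply: mean_le_dom (mean_le_add up low).
- apply: (measurableT_comp (@measurable_powR R p)).
  apply: measurableT_comp => //; apply: measurable_funB => //; exact: mhor.
- move=> t; rewrite powR_ge0/= /pospow -(opprB (hor w m n t)).
  set u := hor w m n t - mu m n w.
  have [u0|u0] := leP 0 u.
    by rewrite ger0_norm// lerDl powR_ge0.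
  rewrite ltr0_norm//; have u1 : 0 < - u by lra.
  by rewrite (max_l (ltW u1)) lerDr powR_ge0.
- rewrite powRM//; have := powR_ge0 a p; have : 2 <= 2 `^ p.
    by rewrite -[leLHS]powRr1 ?ler_powR//; lra.
  by move=> h1 h2; nra.
Qed.

Lemma small_order_gap (h p N : R) : 0 < p -> p <= N ->
  r * Num.min (p `^ (1 / 3) * N `^ (- (1 / 3))) 1 <= h ->
  0 < h /\ r ^+ 3 * p <= h ^+ 3 * N.
Proof.
move=> p0 pN; have N0 : 0 < N by exact: lt_le_trans pN.
have q1 : p `^ (1 / 3) * N `^ (- (1 / 3)) <= 1.
  rewrite powRN ler_pdivrMr ?powR_gt0// (mul1r (N `^ _)).
  by apply: ge0_ler_powR; rewrite ?nnegrE ?divr_ge0// ltW.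
rewrite min_l//; set q := p `^ _ * _ in q1 *.
have q0 : 0 < q by rewrite mulr_gt0// powR_gt0.
have q3 : q ^+ 3 * N = p.
  rewrite exprMn -!powR_mulrn ?powR_ge0// -!powRrM.
  rewrite (_ : 1 / 3 * 3%:R = 1 :> R); last by field.
  rewrite (_ : - (1 / 3) * 3%:R = - 1 :> R); last by field.
  by rewrite powRN !powRr1 ?divfK ?gt_eqF// ltW.
have rq0 : 0 < r * q by rewrite mulr_gt0.
move=> hq; have h0 : 0 < h by exact: lt_le_trans hq.
split => //; rewrite -q3 mulrA -exprMn; apply: ler_wpM2r; first exact: ltW.
by rewrite ler_pXn2r ?nnegrE// ltW.
Qed.

Lemma large_order_gap (h p N : R) : 0 < N -> N < p ->
  r * Num.min (p `^ (1 / 3) * N `^ (- (1 / 3))) 1 <= h -> r <= h.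
Proof.
move=> N0 Np; rewrite min_r ?mulr1//.
rewrite powRN ler_pdivlMr ?powR_gt0// (mul1r (N `^ _)).
have p0 : 0 <= p by rewrite ltW// (lt_trans N0).
by apply: ge0_ler_powR; rewrite ?nnegrE ?divr_ge0// ltW.
Qed.

Lemma endpoint_size_le m n : (0 < m)%N -> (0 < n)%N -> r <= crit m n ->
  m%:R + n%:R <= (1 + r ^- 2) * m%:R :> R.
Proof.
move=> m0 n0 rc; rewrite mulrDl mul1r lerD2l.
have [c0 c1 [G [G0 mE nE]]] := critP R m0 n0.
have rp : 0 < r := r0.
rewrite mulrC ler_pdivlMr ?exprn_gt0// mE nE -mulrA; apply: ler_wpM2l; first exact: ltW.
rewrite -exprMn ler_pXn2r ?nnegrE//; [|by apply: mulr_ge0; [rewrite subr_ge0|]; exact: ltW|exact: ltW].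
by apply: le_trans rc; rewrite ler_piMl ?(ltW rp)// gerBl ltW.
Qed.

(** For [h] bounded below and [m <= p] an exponential moment with a fixed
    parameter bounds the upper deviations, and the trivial bound the lower ones. *)
Lemma hor_large_order m n (w p : R) : (0 < m)%N -> (0 < n)%N ->
  r <= w -> crit m n <= 1 - r -> r <= crit m n - w -> 1 <= p -> m%:R <= p ->
  mean_le (fun t => pospow (hor w m n t - mu m n w) p) ((2 / r * expR chernoff_const * p) `^ p) /\
  mean_le (fun t => pospow (mu m n w - hor w m n t) p) ((2 / r ^+ 3 * p) `^ p).
Proof.
move=> m0 n0 rw c1 rh p1 mp; have rp : 0 < r := r0.
have wc : w < crit m n by rewrite -subr_gt0 (lt_le_trans rp).
have p0 : 0 <= p by exact: le_trans ler01 p1.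
have r30 : 0 <= 2 / r ^+ 3 by rewrite divr_ge0// exprn_ge0// ltW.
split; last by apply: (hor_lower_trivial m0 n0 rw wc c1 p1); exact: ler_wpM2l.
have l0 : 0 < r / 2 by rewrite divr_gt0.
have E := hor_exp_upper m0 n0 rw (ltW wc) c1 l0 (lexx _).
apply: mean_le_dom (mean_le_scale (powR_ge0 (p / (r / 2)) p) E).
- by apply: measurable_pospow; apply: measurable_funB => //; exact: mhor.
- by move=> t; rewrite pospow_ge0/=; exact: pospow_le_exp.
have -> : 2 / r * expR chernoff_const * p = p / (r / 2) * expR chernoff_const by field; rewrite gt_eqF.
have pr0 : 0 <= p / (r / 2) by rewrite divr_ge0// ltW.
rewrite (powRM p pr0 (expR_ge0 chernoff_const)).
apply: ler_wpM2l; first exact: powR_ge0.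
rewrite -expRM ler_expR; set h := crit m n - w in rh *.
have h1 : h + r / 2 <= 1 by rewrite /h; lra.
have h0 : 0 <= h + r / 2 by lra.
have r2 : (r / 2) ^+ 2 <= 1 by rewrite expr_le1 ?(ltW l0)//; lra.
have -> : chernoff_const * (r / 2) ^+ 2 * m%:R * (h + r / 2) = chernoff_const * (m%:R * ((r / 2) ^+ 2 * (h + r / 2))) by ring.
apply: ler_wpM2l; first exact: chernoff_const_ge0.
rewrite -[leRHS]mulr1; apply: ler_pM => //; first by rewrite mulr_ge0 ?sqr_ge0.
by rewrite -[leRHS]mulr1; apply: ler_pM => //; exact: sqr_ge0.
Qed.

Definition moment_const : R :=
  let k := (1 + r ^- 2) / r ^+ 3 + 1 in
  2 * (upper_const k + lower_const k + 2 / r * expR chernoff_const + 2 / r ^+ 3).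

Lemma moment_const_ge : let k := (1 + r ^- 2) / r ^+ 3 + 1 in
  [/\ 1 <= k, 0 < upper_const k, 0 < lower_const k, 0 < 2 / r * expR chernoff_const & 0 < 2 / r ^+ 3].
Proof.
have rp : 0 < r := r0; set k := _ + 1.
have k1 : 1 <= k by rewrite /k lerDr divr_ge0 ?exprn_ge0 ?addr_ge0 ?invr_ge0 ?exprn_ge0// ltW.
split => //; [exact: upper_const_gt0|exact: lower_const_gt0| |].
  by rewrite mulr_gt0 ?expR_gt0 ?divr_gt0.
by rewrite divr_gt0 ?exprn_gt0.
Qed.

Lemma moment_const_gt0 : 0 < moment_const.
Proof.
have [_ A0 B0 C0 D0] := moment_const_ge; apply: mulr_gt0 => //.
by do 2!apply: addr_gt0 => //; exact: addr_gt0.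
Qed.

(** If [p <= m + n], the assumption on [w] reads
    [r ^ 3 * p <= h ^ 3 * (m + n)], and the two one-sided bounds apply.
    Otherwise [w <= c - r] and [m <= p], the case of [hor_large_order]. *)
Lemma hor_moment m n (w p : R) : (0 < m)%N -> (0 < n)%N ->
  2 * r <= crit m n -> crit m n <= 1 - 2 * r -> r <= w -> 1 <= p ->
  w <= crit m n - r * Num.min (p `^ (1 / 3) * (m%:R + n%:R) `^ (- (1 / 3))) 1 ->
  mean_le (fun t => `|hor w m n t - mu m n w| `^ p)
    ((moment_const * Num.sqrt (p * Num.max p ((crit m n - w) * (m%:R + n%:R)))) `^ p).
Proof.
move=> m0 n0 rc c2 rw p1; rewrite lerBrDr -lerBrDl => wc.
have rp : 0 < r := r0.
have p0 : 0 < p by exact: lt_le_trans p1.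
have N0 : 0 < m%:R + n%:R :> R by rewrite addr_gt0 ?ltr0n.
have c1 : crit m n <= 1 - r by apply: (le_trans c2); rewrite lerD2l lerN2 ler_peMl ?ler1n// ltW.
have rc1 : r <= crit m n by apply: le_trans rc; rewrite ler_peMl ?ler1n// ltW.
have [k1 A0 B0 C10 C20] := moment_const_ge.
rewrite /moment_const; set k := _ + 1 in k1 A0 B0 *.
set C := _ + _ + _ + _; set D := Num.sqrt _.
have D0 : 0 <= D by exact: sqrtr_ge0.
have CD (C' x : R) : 0 <= C' -> C' <= C -> 0 <= x -> x <= D -> (C' * x) `^ p <= (C * D) `^ p.
  move=> C'0 C'C x0 xD; apply: ler_powR_base; [exact: ltW|exact: mulr_ge0|exact: ler_pM].
have AC : upper_const k <= C by rewrite /C; lra.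
have BC : lower_const k <= C by rewrite /C; lra.
have CC1 : 2 / r * expR chernoff_const <= C by rewrite /C; lra.
have CC2 : 2 / r ^+ 3 <= C by rewrite /C; lra.
have C0 : 0 <= C by apply: le_trans CC2; exact: ltW.
rewrite -[2 * _ * D]mulrA.
suff [Hup Hlow] : mean_le (fun t => pospow (hor w m n t - mu m n w) p) ((C * D) `^ p) /\
    mean_le (fun t => pospow (mu m n w - hor w m n t) p) ((C * D) `^ p).
  exact: (two_sided_moment m0 p1 (mulr_ge0 C0 D0) Hup Hlow).
have [pN|Np] := leP p (m%:R + n%:R).
  have [h0 h3] := small_order_gap p0 pN wc.
  have wc' : w < crit m n by rewrite -subr_gt0.
  have h30 : 0 <= (crit m n - w) ^+ 3 by rewrite exprn_ge0// ltW.
  have h3m : 0 <= (crit m n - w) ^+ 3 * m%:R by rewrite mulr_ge0.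
  have pk : p <= k * ((crit m n - w) ^+ 3 * m%:R).
    apply: (@le_trans _ _ ((1 + r ^- 2) / r ^+ 3 * ((crit m n - w) ^+ 3 * m%:R))); last first.
      by apply: ler_wpM2r => //; rewrite /k lerDl.
    have -> : (1 + r ^- 2) / r ^+ 3 * ((crit m n - w) ^+ 3 * m%:R) =
      (crit m n - w) ^+ 3 * ((1 + r ^- 2) * m%:R) / r ^+ 3 by ring.
    rewrite ler_pdivlMr ?exprn_gt0// mulrC; apply: (le_trans h3).
    by apply: ler_wpM2l => //; exact: endpoint_size_le.
  have dD : dev p (crit m n - w) m <= D.
    rewrite /dev /D; apply: ler_wsqrtr; rewrite -mulrA; apply: ler_wpM2l; first exact: ltW.
    rewrite le_max; apply/orP; right; apply: ler_wpM2l; first exact: ltW.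
    by rewrite lerDl.
  have d0 : 0 <= dev p (crit m n - w) m by exact: sqrtr_ge0.
  split.
    have pk2 : p <= k ^+ 2 * ((crit m n - w) ^+ 3 * m%:R).
      by apply: (le_trans pk); apply: ler_wpM2r => //; exact: ler_eXnr.
    exact: mean_le_weaken (hor_upper_moment k1 m0 n0 rw wc' c1 p1 pk2) (CD _ _ (ltW A0) AC d0 dD).
  exact: mean_le_weaken (hor_lower_moment k1 m0 n0 rc c2 rw wc' p1 pk) (CD _ _ (ltW B0) BC d0 dD).
have rh := large_order_gap N0 Np wc.
have pD : p <= D.
  rewrite /D -[leLHS]ger0_norm ?(ltW p0)// -sqrtr_sqr expr2; apply: ler_wsqrtr.
  by apply: ler_wpM2l; [exact: ltW|rewrite le_max lexx].
have mp : m%:R <= p by apply: le_trans (ltW Np); rewrite lerDl.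
have [Hup Hlow] := hor_large_order m0 n0 rw c1 rh p1 mp.
split; first exact: mean_le_weaken Hup (CD _ _ (ltW C10) CC1 (ltW p0) pD).
exact: mean_le_weaken Hlow (CD _ _ (ltW C20) CC2 (ltW p0) pD).
Qed.

End moments.

(** * From the cone to uniform constants, and reflection *)

Lemma cone_zeta (R : realType) (delta : R) (x : R * R) : 0 < delta -> cone delta x ->
  let s := Num.sqrt delta in
  s / (1 + s) <= zeta x /\ zeta x <= 1 - s / (1 + s).
Proof.
case: x => x y d0 [/= x0 y0 yx xy]; set s := Num.sqrt delta; rewrite /zeta /=.
have s0 : 0 < s by rewrite sqrtr_gt0.
set a := Num.sqrt x; set b := Num.sqrt y.
have a0 : 0 < a by rewrite sqrtr_gt0.
have b0 : 0 < b by rewrite sqrtr_gt0.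
have sb : s * b <= a by rewrite /s /a /b -sqrtrM ?(ltW d0)// ler_wsqrtr.
have sa : s * a <= b by rewrite /s /a /b -sqrtrM ?(ltW d0)// ler_wsqrtr.
have s1 : 0 < 1 + s by lra.
have ab : 0 < a + b by lra.
split.
  by rewrite ler_pdivrMr// mulrAC ler_pdivlMr//; lra.
rewrite ler_pdivrMr// (_ : 1 - s / (1 + s) = (1 + s)^-1); last first.
  by field; rewrite gt_eqF.
by rewrite mulrC ler_pdivlMr//; lra.
Qed.

Section horizontal.
Context (R : realType) (delta epsilon : R).
Hypotheses (delta_gt0 : 0 < delta) (epsilon_gt0 : 0 < epsilon).

(** Keeps the critical parameter of every endpoint in the cone, and [w], at a
    distance from [0] and [1] that depends on [delta] and [epsilon] alone. *)
Definition margin : R :=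
  Num.min epsilon (Num.sqrt delta / (1 + Num.sqrt delta) / 2).

Lemma margin_gt0 : 0 < margin.
Proof.
have s0 : 0 < Num.sqrt delta by rewrite sqrtr_gt0.
by rewrite lt_min epsilon_gt0 !divr_gt0// addr_gt0.
Qed.

(** The given weights are almost surely nonnegative, so that [G_hor] agrees
    almost surely with [hor] at the rate [w]. *)
Lemma G_hor_moment d (T : measurableType d) (P : probability T R)
    (v : nat * nat) (p w z : R) (omega : nat * nat -> {RV P >-> R}) :
  (0 < v.1)%N -> (0 < v.2)%N -> cone delta (vec v) ->
  1 <= p -> 0 < w -> z < 1 -> lpp_weights w z omega -> epsilon <= w ->
  w <= zeta (vec v)
       - epsilon * Num.min (p `^ (1 / 3) * normL1 (vec v) `^ (- (1 / 3))) 1 ->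
  ('E_P[fun t => (`|G_hor omega v t - meanM w (vec v)| `^ p)%R] <=
   (moment_const margin `^ p * p `^ (p / 2)
    * Num.max p ((zeta (vec v) - w) * normL1 (vec v)) `^ (p / 2))%:E)%E.
Proof.
move=> v1 v2 vc p1 w0 z1 wP ew wle.
have [c1 c2] := cone_zeta delta_gt0 vc.
have r0 := margin_gt0; set r := margin in r0 *.
have re : r <= epsilon by rewrite ge_min lexx.
have rs : 2 * r <= Num.sqrt delta / (1 + Num.sqrt delta).
  by rewrite mulrC -ler_pdivlMr// ge_min lexx orbT.
case: v v1 v2 vc wle c1 c2 => m n /= m0 n0 vc wle c1 c2.
have NE : normL1 (vec (m, n)) = m%:R + n%:R :> R by rewrite /normL1 /= !ger0_norm.
rewrite NE -/(crit R m n) in wle c1 c2 *.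
have p0 : 0 <= p by exact: le_trans ler01 p1.
have q0 : 0 <= Num.min (p `^ (1 / 3) * (m%:R + n%:R) `^ (- (1 / 3))) 1.
  by rewrite le_min ler01 mulr_ge0 ?powR_ge0.
set hr := hor omega w z; set vr := ver omega w z.
have [||||||||||mf _ le] := @hor_moment R d T P hr vr _ _ _ _ _ r r0 m n w p m0 n0.
- by move=> w' m' n' m'0; exact: measurable_hor.
- by move=> z' m' n' n'0; exact: measurable_ver.
- by move=> w' m' n' t m'0 w'0; exact: hor_ge0.
- by move=> w' z' m' n' ? ? ? ? ? ?; exact: (hor_ver_mgf w0 z1 wP).
- by move=> w' w'' m' n' n'' t ? ? ? ?; exact: hor_compare.
- exact: le_trans c1.
- by apply: (le_trans c2); rewrite lerD2l lerN2.
- exact: le_trans ew.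
- by [].
- by apply: (le_trans wle); rewrite lerD2l lerN2 ler_wpM2r.
rewrite -powR_scale//; last 2 first.
- by rewrite ltW// moment_const_gt0.
- by rewrite le_max p0.
apply: le_trans le; rewrite unlock.
rewrite le_eqVlt; apply/orP; left; apply/eqP.
apply: ae_eq_integral => //.
- apply/measurable_EFinP.
  apply: (measurableT_comp (@measurable_powR R p)).
  apply: measurableT_comp => //; apply: measurable_funB => //.
  by apply: measurable_last_passage.
- by apply/measurable_EFinP.
have := G_hor_ae w0 z1 wP (v := (m, n)) m0.
by apply: filterS => t Ht _; rewrite Ht.
Qed.

End horizontal.

Section transposition.
Context (R : realType).

Definition flip (k : nat * nat) : nat * nat := (k.2, k.1).

Lemma flipK : involutive flip.
Proof. by case. Qed.

Lemma last_passage_flip (W : nat * nat -> R) (u v : nat * nat) :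
  (u.1 <= v.1)%N -> (u.2 <= v.2)%N ->
  last_passage W u v = last_passage (W \o flip) (flip u) (flip v).
Proof.
suff le (V : nat * nat -> R) a b : (a.1 <= b.1)%N -> (a.2 <= b.2)%N ->
    last_passage V a b <= last_passage (V \o flip) (flip a) (flip b).
  move=> u1 u2; apply/eqP; rewrite eq_le le//=.
  have -> : W = (W \o flip) \o flip by apply/funext => k /=; rewrite flipK.
  by rewrite -{2}(flipK u) -{2}(flipK v) le.
move=> a1 a2; have [s [as_ sb ->]] := last_passage_path V a1 a2.
have fs : path up_right_step (flip a) (map flip s).
  rewrite path_map; apply: sub_path as_ => x y /orP[] /eqP ->; rewrite /= /up_right_step /flip /=.
    by rewrite eqxx orbT.
  by rewrite eqxx.
have := le_last_passage (V \o flip) fs; rewrite last_map sb => /(_ a2 a1).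
rewrite -map_cons big_map; under eq_bigr do rewrite /= flipK.
by [].
Qed.

(** Reflection exchanges the two axes, hence the rates [w] and [1 - z]. *)
Lemma lpp_weights_flip d (T : measurableType d) (P : probability T R) w z
    (omega : nat * nat -> {RV P >-> R}) :
  lpp_weights w z omega -> lpp_weights (1 - z) (1 - w) (omega \o flip).
Proof.
move=> [ind bulk row col orig]; split => //=.
- move=> J A mA.
  have flipJ k : (k \in [fset flip x | x in J]%fset) = (flip k \in J).
    apply/imfsetP/idP => [[x xJ ->]|kJ]; first by rewrite flipK.
    by exists (flip k) => //; rewrite flipK.
  have /= := ind [fset flip x | x in J]%fset (A \o flip).
  rewrite (_ : \bigcap_(i in _) _ = \bigcap_(i in [set` J]) ((omega \o flip) i @^-1` A i)).
    move=> -> //; last by move=> k; rewrite flipJ => /mA.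
    rewrite (perm_big (map flip J))/=; last first.
      apply: uniq_perm; [exact: fset_uniq|rewrite map_inj_uniq ?fset_uniq//|].
        exact: (can_inj flipK).
      by move=> k; rewrite flipJ -{2}(flipK k) mem_map//; exact: (can_inj flipK).
    by rewrite big_map; apply: eq_bigr => k _; rewrite /= flipK.
  apply/seteqP; split => t /= H k /=.
    by move=> kJ; have := H (flip k); rewrite /= flipJ flipK; exact.
  by rewrite flipJ => kJ; have := H _ kJ; rewrite /= flipK.
- by move=> i j i0 j0; exact: bulk.
- by rewrite opprB addrC subrK.
Qed.

Lemma zeta_flip (v : nat * nat) : (0 < v.1)%N -> (0 < v.2)%N ->
  zeta (vec (flip v)) = 1 - zeta (vec v) :> R.
Proof.
case: v => m n /= m0 n0; rewrite /zeta /=.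
have a0 : 0 < Num.sqrt (m%:R : R) by rewrite sqrtr_gt0 ltr0n.
have b0 : 0 < Num.sqrt (n%:R : R) by rewrite sqrtr_gt0 ltr0n.
by field; rewrite !gt_eqF// addr_gt0.
Qed.

Lemma normL1_flip v : normL1 (vec (flip v)) = normL1 (vec v) :> R.
Proof. by rewrite /normL1 addrC. Qed.

Lemma meanM_flip t v : meanM (1 - t) (vec (flip v)) = meanM t (vec v) :> R.
Proof. by rewrite /meanM /= opprB addrC [1 + _]addrC subrK. Qed.

Lemma cone_flip delta v : cone delta (vec v) -> cone delta (vec (flip v) : R * R).
Proof. by case. Qed.

End transposition.

Theorem theorem2p10 (R : realType) (delta epsilon : R)
    (delta_gt0 : 0 < delta) (epsilon_gt0 : 0 < epsilon) :
  exists C0 : R, 0 < C0 /\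
  forall (d : measure_display) (T : measurableType d) (P : probability T R)
    (v : nat * nat) (p w z : R) (omega : nat * nat -> {RV P >-> R}),
  (0 < v.1)%N -> (0 < v.2)%N -> cone delta (vec v) ->
  1 <= p -> 0 < w -> z < 1 ->
  lpp_weights w z omega ->
  (epsilon <= w ->
   w <= zeta (vec v)
        - epsilon * Num.min (p `^ (1 / 3) * normL1 (vec v) `^ (- (1 / 3))) 1 ->
   ('E_P[fun t => (`|G_hor omega v t - meanM w (vec v)| `^ p)%R] <=
    (C0 `^ p * p `^ (p / 2)
     * Num.max p ((zeta (vec v) - w) * normL1 (vec v)) `^ (p / 2))%:E)%E)
  /\
  (zeta (vec v)
     + epsilon * Num.min (p `^ (1 / 3) * normL1 (vec v) `^ (- (1 / 3))) 1 <= z ->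
   z <= 1 - epsilon ->
   ('E_P[fun t => (`|G_ver omega v t - meanM z (vec v)| `^ p)%R] <=
    (C0 `^ p * p `^ (p / 2)
     * Num.max p ((z - zeta (vec v)) * normL1 (vec v)) `^ (p / 2))%:E)%E).
Proof.
exists (moment_const (margin delta epsilon)); split.
  exact/moment_const_gt0/margin_gt0.
move=> d T P v p w z omega v1 v2 vc p1 w0 z1 wP; split.
  exact: (G_hor_moment delta_gt0 epsilon_gt0 v1 v2 vc p1 w0 z1 wP).
move=> zv ze.
have fP := lpp_weights_flip wP.
have zw0 : 0 < 1 - z by rewrite subr_gt0.
have w1 : 1 - w < 1 by rewrite gtrBl.
have ew : epsilon <= 1 - z by lra.
have hyp : 1 - z <= zeta (vec (flip v)) -
    epsilon * Num.min (p `^ (1 / 3) * normL1 (vec (flip v)) `^ (- (1 / 3))) 1.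
  by rewrite zeta_flip// normL1_flip; lra.
have := G_hor_moment delta_gt0 epsilon_gt0 (v := flip v) v2 v1 (cone_flip vc) p1 zw0 w1 fP ew hyp.
rewrite zeta_flip// normL1_flip meanM_flip.
rewrite (_ : 1 - zeta (vec v) - (1 - z) = z - zeta (vec v)); last by ring.
rewrite (_ : (fun t => `|G_hor (omega \o flip) (flip v) t - _| `^ p) =
  (fun t => `|G_ver omega v t - meanM z (vec v)| `^ p))//.
by apply/funext => t; rewrite /G_ver (last_passage_flip _ (v := v)).
Qed.
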